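(* Let $U\subseteq (S^3,h)$ be an open subset of the three-sphere endowed with its canonical metric $h$, and let $A$ be a (smooth) one-form on $U$. Then the Riemannian metric on $(0,\infty)\times U$ given by $$g=\rho^2h+\rho^{-2}(\rho\,\mathrm{d}\rho+A)^2\qquad(\rho\in(0,\infty))$$ is Einstein if and only if the equation $$\mathrm{d}A+2*A=0$$ holds on $U$ with respect to a suitable choice of orientation on $U$, where $*$ is the Hodge star operator of $(U,h)$. Moreover, if $\mathrm{d}A+2*A=0$ holds (for a suitable choice of orientation on $U$), then $g$ is Ricci-flat and self-dual (with respect to a suitable choice of orientation on $(0,\infty)\times U$).
   Context: The canonical metric on $S^3$ is the round metric of constant sectional curvature $1$. In the formula for $g$, $\rho$ is the coordinate on $(0,\infty)$, and $h$ and $A$ denote their pull-backs to $(0,\infty)\times U$ by the projection to $U$. A Riemannian metric $g$ is Einstein if its Ricci tensor equals $c\,g$ for some constant $c\in\mathbb{R}$. A metric on an oriented four-manifold is self-dual if the anti-self-dual part $W_-$ of its Weyl tensor vanishes. *)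

(* Defs.v *)
From HB Require Import structures.
From mathcomp Require Import all_boot all_order all_algebra.
From mathcomp Require Import all_classical all_reals all_analysis.
Set Implicit Arguments.
Unset Strict Implicit.
Unset Printing Implicit Defensive.
Import Order.TTheory GRing.Theory Num.Theory.
Import numFieldNormedType.Exports.
Local Open Scope classical_set_scope.
Local Open Scope ring_scope.

Definition partial {R : realType} {n : nat} {W : normedModType R}
    (i : 'I_n) (f : 'rV[R]_n -> W) : 'rV[R]_n -> W :=
  fun x => 'D_('e_i) f x.

(* For D open: all iterated partial derivatives exist and are continuous on D.
   Existence has to be demanded, as 'D_v f x is a total function. *)
Definition smooth_on {R : realType} {n : nat} {W : normedModType R}
    (D : set 'rV[R]_n) (f : 'rV[R]_n -> W) : Prop :=
  forall (s : seq 'I_n) (x : 'rV[R]_n), D x ->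
    {for x, continuous (foldr partial f s)} /\
    forall i : 'I_n, derivable (foldr partial f s) x 'e_i.

(* An orientation of D is encoded by its sign relative to a fixed reference
   orientation; it may differ from component to component of D. *)
Definition is_orientation {R : realType} {n : nat}
    (D : set 'rV[R]_n) (o : 'rV[R]_n -> R) : Prop :=
  (forall x, D x -> o x = 1 \/ o x = -1) /\ {within D, continuous o}.

Definition det4 {R : realType} (a b c d : 'rV[R]_4) : R :=
  \det (\matrix_(i < 4) tnth [tuple a; b; c; d] i).

(* g x is the Gram matrix of the coordinate vector fields d_i at x, where x
   ranges over an open subset of R^n. *)
Section RiemannianCoordinates.
Context {R : realType} {n : nat} (g : 'rV[R]_n -> 'M[R]_n).

(* Gamma^k_ij *)
Definition christoffel (k i j : 'I_n) (x : 'rV[R]_n) : R :=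
  2^-1 * \sum_(l < n) invmx (g x) k l *
    (partial i (fun y => g y j l) x + partial j (fun y => g y i l) x
     - partial l (fun y => g y i j) x).

(* The d_l-component of R(d_i, d_j) d_k, where
   R(X, Y) Z = nabla_X nabla_Y Z - nabla_Y nabla_X Z - nabla_[X, Y] Z. *)
Definition curvature (l k i j : 'I_n) (x : 'rV[R]_n) : R :=
  partial i (christoffel l j k) x - partial j (christoffel l i k) x
  + \sum_(m < n) (christoffel l i m x * christoffel m j k x
                  - christoffel l j m x * christoffel m i k x).

(* g(R(d_i, d_j) d_k, d_l) *)
Definition riemann (l k i j : 'I_n) (x : 'rV[R]_n) : R :=
  \sum_(m < n) g x l m * curvature m k i j x.

(* Ric(Y, Z) is the trace of X |-> R(X, Y) Z. *)
Definition ricci (x : 'rV[R]_n) : 'M[R]_n :=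
  \matrix_(j, k) \sum_(i < n) curvature i k i j x.

Definition scalar_curvature (x : 'rV[R]_n) : R :=
  \tr (invmx (g x) *m ricci x).

Definition schouten (x : 'rV[R]_n) : 'M[R]_n :=
  (n%:R - 2)^-1 *:
    (ricci x - (scalar_curvature x / (2 * (n%:R - 1))) *: g x).

Definition weyl (l k i j : 'I_n) (x : 'rV[R]_n) : R :=
  riemann l k i j x
  - (schouten x l i * g x k j + g x l i * schouten x k j
     - schouten x l j * g x k i - g x l j * schouten x k i).

Definition einstein (D : set 'rV[R]_n) : Prop :=
  exists c : R, forall x, D x -> ricci x = c *: g x.

Definition ricci_flat (D : set 'rV[R]_n) : Prop :=
  forall x, D x -> ricci x = 0.

End RiemannianCoordinates.

(* The Hodge star on 2-forms F = 1/2 sum_ij F i j dx_i /\ dx_j of a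
   four-dimensional inner product G with orientation sign s:
   ( *F)_ij = 1/2 sum_ab vol_ijab F^ab. *)
Definition star2 {R : realType} (s : R) (G F : 'M[R]_4) : 'M[R]_4 :=
  \matrix_(i, j) (2^-1 * \sum_(a < 4) \sum_(b < 4)
    (s * Num.sqrt (\det G) * det4 'e_i 'e_j 'e_a 'e_b)
    * (invmx G *m F *m (invmx G)^T) a b).

(* W_- = 1/2 (W - *W), the star acting on the first pair of indices. *)
Definition weyl_minus {R : realType} (o : 'rV[R]_4 -> R)
    (g : 'rV[R]_4 -> 'M[R]_4) (i j : 'I_4) (x : 'rV[R]_4) : 'M[R]_4 :=
  let W := \matrix_(l, k) weyl g l k i j x in
  2^-1 *: (W - star2 (o x) (g x) W).

Definition self_dual {R : realType} (o : 'rV[R]_4 -> R)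
    (g : 'rV[R]_4 -> 'M[R]_4) (D : set 'rV[R]_4) : Prop :=
  forall x, D x -> forall i j : 'I_4, weyl_minus o g i j x = 0.

Section Sphere.
Context {R : realType}.
Implicit Types (U : set 'rV[R]_4) (A : 'rV[R]_4 -> 'rV[R]_4).

Definition dot (v w : 'rV[R]_4) : R := \sum_(i < 4) v 0 i * w 0 i.

Definition sphere3 : set 'rV[R]_4 := [set u | dot u u = 1].

Definition open_in_sphere3 U : Prop :=
  exists O : set 'rV[R]_4, open O /\ U = sphere3 `&` O.

(* T_u S^3; the canonical metric h is the restriction of dot to it. *)
Definition tangent (u : 'rV[R]_4) : set 'rV[R]_4 := [set v | dot u v = 0].

(* The inverse of the diffeomorphism (rho, u) |-> rho u from (0, oo) x S^3
   onto R^4 \ {0}: a global chart. *)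
Definition polar (x : 'rV[R]_4) : R * 'rV[R]_4 :=
  let rho := Num.sqrt (dot x x) in (rho, rho^-1 *: x).

(* (0, oo) x U in this chart; it is open in R^4 when U is open in S^3. *)
Definition cone U : set 'rV[R]_4 := polar @^-1` ([set r | 0 < r] `*` U).

(* The pull-back of A, as an R^4-valued function, by (0, oo) x U -> U. *)
Definition radial A (x : 'rV[R]_4) : 'rV[R]_4 := A (polar x).2.

(* A one-form on U is represented by the tangent vector field A such that its
   value at v in T_u S^3 is dot (A u) v.  As (0, oo) x U -> U is a surjective
   submersion, A is smooth iff its pull-back is. *)
Definition smooth_one_form U A : Prop :=
  (forall u, U u -> tangent u (A u)) /\ smooth_on (cone U) (radial A).

(* dA(v, w) at u for v, w in T_u S^3, computed with the extension radial A of A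
   to a neighbourhood of U in R^4 and with v, w constant vector fields on R^4;
   d commutes with the restriction to U. *)
Definition ext_deriv A (u v w : 'rV[R]_4) : R :=
  'D_v (fun x => dot (radial A x) w) u - 'D_w (fun x => dot (radial A x) v) u.

(* ( *A)(v, w) = vol(A^sharp, v, w).  The reference orientation of S^3 is that
   of the boundary of the unit ball, with volume form det4 u at u. *)
Definition hodge (o : 'rV[R]_4 -> R) A (u v w : 'rV[R]_4) : R :=
  o u * det4 u (A u) v w.

(* dA + 2 *A = 0 on U *)
Definition beltrami U (o : 'rV[R]_4 -> R) A : Prop :=
  forall u, U u -> forall v w, tangent u v -> tangent u w ->
    ext_deriv A u v w + 2 * hodge o A u v w = 0.

(* rho^2 h + rho^-2 (rho drho + A)^2 at p = (rho, u), on X = (r, v) in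
   R x T_u S^3 *)
Definition warped_metric A (p X Y : R * 'rV[R]_4) : R :=
  p.1 ^+ 2 * dot X.2 Y.2
  + p.1 ^- 2 * ((p.1 * X.1 + dot (A p.2) X.2) * (p.1 * Y.1 + dot (A p.2) Y.2)).

Definition warped_coord A (x : 'rV[R]_4) : 'M[R]_4 :=
  \matrix_(i, j) warped_metric A (polar x) (partial i polar x) (partial j polar x).

End Sphere.

(* Main.v *)
Require Import Defs.
From HB Require Import structures.
From mathcomp Require Import all_boot all_order all_algebra.
From mathcomp Require Import all_classical all_reals all_analysis.
From mathcomp Require Import ring lra.
Set Implicit Arguments.
Unset Strict Implicit.
Unset Printing Implicit Defensive.
Import Order.TTheory GRing.Theory Num.Theory.
Import numFieldNormedType.Exports.
Local Open Scope classical_set_scope.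
Local Open Scope ring_scope.

(** Put y = rho u in R^4 minus the origin, and let beta = rho^-2 A be the one-form
    with coefficients b y = rho^-3 A(y / rho) ([cone_form]); it is homogeneous of
    degree -3 and y . b = 0.  In this chart the metric is the sum of the squares of
    e^a = dy^a + y_a beta, a unipotent perturbation of the flat coframe
    ([warped_coord_frame]).  Everything is governed by the two-form F = d beta
    ([ext_form]), homogeneous of degree -4, with F y = 2 b ([half_mulv_ext_form]).

    The Beltrami equation says that F is an eigenform of the flat Hodge star of R^4.
    At u in U, the restriction of F to the tangent space of the sphere is dA
    ([ext_deriv_bilin]), and its contraction with the normal u is 2 A up to sign, so that
    dA + 2 *A = 0 compares the tangential part of F with the dual of its normal part
    ([beltrami_dual_form]).

    Curvature.  The first structure equation determines connection matrices that are
    linear in F with coefficients linear in y ([conn], [torsion_pointwise]), and the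
    second one their curvature ([curvature_pointwise]).  The Ricci tensor in the frame
    is the sum of a part linear in the divergence J of F and of a part linear in the
    Maxwell stress tensor T = 1/2 (F^2 - 1/4 tr(F^2)) ([frame_ricci]).

    If *F = o F with o locally constant of square 1, then dF = 0 gives J = 0, and T = 0
    by algebra, so that the metric is Ricci-flat and its Weyl tensor is its Riemann
    tensor.  The connection matrices take their values in one of the two ideals of
    so(4), hence so does the curvature ([cone_curvature_dual]); that is self-duality,
    because the Hodge star of the metric acts on frame components as the flat one
    ([star2_frame]).

    Conversely, under y -> t y the two parts of the Ricci tensor scale by t^-4 and
    t^-6 in the frame, while the Einstein constant scales by 1; hence the constant, J
    and T all vanish ([einstein_ricci_parts]).  T = 0 says that the products of the
    components of F^+ = F + *F with those of F^- = F - *F vanish, so that at each point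
    F^+ = 0 or F^- = 0.  The choice has to be locally constant.  As dF = 0 and J = 0,
    the components of F^+ and F^- are harmonic; by unique continuation
    ([harmonic_flat_near0]) the interior of the zero set of F^+ is relatively closed,
    and off it F^- vanishes by density ([einstein_beltrami]). *)

(** * Differential calculus in R^n *)

(** A mean value theorem that does not distinguish the signs of [h]. *)
Lemma MVT_from0 (R : realType) (g dg : R -> R) (h : R) :
  (forall s, `|s| <= `|h| -> is_derive s (1 : R) g (dg s)) ->
  exists2 c, `|c| <= `|h| & g h - g 0 = h * dg c.
Proof.
move=> gd.
have gc (a b : R) : (forall s, s \in `[a, b] -> `|s| <= `|h|) ->
    {within `[a, b], continuous g}.
  move=> ab; apply: derivable_within_continuous => s sab.
  by have /ab/gd[] := sab.
have gdo (a b : R) : (forall s, s \in `[a, b] -> `|s| <= `|h|) ->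
    forall s, s \in `]a, b[ -> is_derive s (1 : R) g (dg s).
  by move=> ab s sab; apply/gd/ab; exact: subset_itv_oo_cc.
have [h0|h0] := leP 0 h.
  have abs s : s \in `[0, h] -> `|s| <= `|h|.
    by rewrite in_itv/= => /andP[s0 sh]; rewrite !ger0_norm.
  have [c ch e] := MVT_segment h0 (gdo _ _ abs) (gc _ _ abs).
  exists c; first exact: abs.
  by rewrite e subr0 mulrC.
have abs s : s \in `[h, 0] -> `|s| <= `|h|.
  rewrite in_itv/= => /andP[sh s0].
  by rewrite !ler0_norm ?lerN2// ltW.
have [c ch e] := MVT_segment (ltW h0) (gdo _ _ abs) (gc _ _ abs).
exists c; first exact: abs.
by rewrite -opprB e sub0r mulrN opprK mulrC.
Qed.

Section Lines.
Context {R : realType} {V : normedModType R}.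
Implicit Types (f : V -> R) (p v : V).

Lemma is_derive_line f p v (t : R) : derivable f (p + t *: v) v ->
  is_derive t (1 : R) (fun s : R => f (p + s *: v)) ('D_v f (p + t *: v)).
Proof.
move=> fd.
have E : (fun h : R => h^-1 *: (f (p + (h *: 1 + t) *: v) - f (p + t *: v))) =
         (fun h => h^-1 *: (f (h *: v + (p + t *: v)) - f (p + t *: v))).
  rewrite funeqE => h; congr (_ *: (f _ - _)).
  by rewrite [h *: 1]mulr1 scalerDl addrCA.
by split; rewrite /derivable /derive/= E.
Qed.

Lemma MVT_line f p v (h : R) :
  (forall s, `|s| <= `|h| -> derivable f (p + s *: v) v) ->
  exists2 c, `|c| <= `|h| & f (p + h *: v) - f p = h * 'D_v f (p + c *: v).
Proof.
move=> fd.
have := @MVT_from0 R (fun s => f (p + s *: v)) (fun s => 'D_v f (p + s *: v)) h.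
by rewrite scale0r addr0; apply=> s /fd; exact: is_derive_line.
Qed.

End Lines.

Lemma continuous_sumr (R : realType) (T : topologicalType) (n : nat)
    (f : 'I_n -> T -> R) (x : T) : (forall i, {for x, continuous (f i)}) ->
  {for x, continuous (fun y => \sum_(i < n) f i y)}.
Proof.
move=> fc; rewrite (_ : (fun _ => _) = \sum_(i < n) f i); last first.
  by rewrite funeqE => y; rewrite fct_sumE.
elim/big_ind : _ => [|g h gc hc|i _]; [exact: cvg_cst| |exact: fc].
exact: cvgD.
Qed.

Lemma is_diff_littleo (R : realType) (V W : normedModType R) (f : V -> W)
    (df : {linear V -> W}) (x : V) : continuous df ->
  (forall e : R, 0 < e ->
    \forall h \near (0 : V), `|f (x + h) - f x - df h| <= e * `|h|) ->
  is_diff x f df.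
Proof.
move=> dfc dfe.
have dfo : f \o shift x = cst (f x) + df +o_ 0 id.
  apply/eqaddoP => e e0; apply: filterS (dfe e e0) => h.
  by rewrite [x + h]addrC -addrA -opprD.
have dE := diff_unique dfc dfo.
split; last exact: dE.
by apply/diff_locallyP; rewrite dE; split.
Qed.

Section ContinuousPartials.
Context {R : realType} {n : nat}.
Local Notation V := 'rV[R]_n.

Lemma coord_le_norm (x : V) i : `|x 0 i| <= `|x|.
Proof.
rewrite [in leRHS]/Num.Def.normr/= mx_normrE.
exact: (le_trans _ (le_bigmax _ (fun ij : 'I_1 * 'I_n => `|x ij.1 ij.2|) (0, i))).
Qed.

Lemma norm_le_coord (x : V) (e : R) : 0 <= e ->
  (forall i, `|x 0 i| <= e) -> `|x| <= e.
Proof.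
move=> e0 xe; rewrite /Num.Def.normr/= mx_normrE; apply: bigmax_le => // -[i j] _.
by rewrite ord1 xe.
Qed.

(** The first [k] coordinates of [h]: the vertices [x + trunc k h] of a staircase
    from [x] to [x + h] along the axes. *)
Definition trunc (k : nat) (h : V) : V := \row_i (if (i < k)%N then h 0 i else 0).

Lemma trunc0 h : trunc 0 h = 0.
Proof. by apply/rowP => i; rewrite !mxE. Qed.

Lemma trunc_all h : trunc n h = h.
Proof. by apply/rowP => i; rewrite !mxE ltn_ord. Qed.

Lemma truncS (i : 'I_n) h : trunc i.+1 h = trunc i h + h 0 i *: 'e_i.
Proof.
apply/rowP => j; rewrite !mxE eqxx/= ltnS leq_eqVlt.
case: (eqVneq j i) => [->|ji]; first by rewrite eqxx ltnn mulr1 add0r.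
by rewrite (negbTE (_ : (j : nat) != i))// orFb mulr0 addr0.
Qed.

(** Continuous partial derivatives give differentiability: the increment of [f] is
    the sum of its increments along the edges of a staircase, and the mean value
    theorem applies to each edge. *)
Lemma differentiable_partial (D : set V) (f : V -> R) (x : V) : open D -> D x ->
  (forall y i, D y -> derivable f y 'e_i) ->
  (forall i, {for x, continuous (partial i f)}) ->
  is_diff x f (fun v => \sum_(i < n) v 0 i * partial i f x).
Proof.
move=> Dop Dx fd fc.
have dlin : linear (fun v : V => \sum_(i < n) v 0 i * partial i f x : R).
  move=> a u v; rewrite scaler_sumr -big_split/=; apply: eq_bigr => i _.
  by rewrite !mxE mulrDl /GRing.scale/= mulrA.
pose dfL := GRing.isLinear.Build R V R _ _ dlin.
pose df : {linear V -> R} := HB.pack (fun v : V => \sum_(i < n) v 0 i * partial i f x : R) dfL.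
have dfc : continuous df.
  move=> v; rewrite /df/=.
  apply: continuous_sumr => i.
  by apply: continuousM; [exact: coord_continuous|exact: cst_continuous].
apply: (@is_diff_littleo _ _ _ f df) => // _/posnumP[e].
  have e0 : 0 < e%:num / n.+1%:R by [].
  have : \forall y \near x, D y /\
      forall i, `|partial i f y - partial i f x| <= e%:num / n.+1%:R.
    near=> y; split; first by near: y; exact: open_nbhs_nbhs.
    near: y; apply: filter_forall => i.
    have /cvgrPdist_le/(_ _ e0) := fc i.
    by apply: filterS => y; rewrite distrC.
  move=> /nbhs_ballP[d /= d0 dD].
  near=> h.
  have hd : `|h| < d by near: h; exact: (@nbhs0_lt R (V : normedModType R)).
  have Pk k : (k <= n)%N -> `|f (x + trunc k h) - f x
      - \sum_(i < n | (i < k)%N) h 0 i * partial i f x|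
      <= k%:R * (e%:num / n.+1%:R * `|h|).
    elim: k => [_|k IH kn].
      rewrite trunc0 addr0 subrr big_pred0 ?subr0 ?normr0 ?mul0r//.
    pose i := Ordinal kn.
    have inD s : `|s| <= `|h 0 i| -> ball x d (x + trunc i h + s *: 'e_i).
      move=> sh; rewrite -ball_normE/= -addrA opprD addNKr normrN.
      apply: le_lt_trans hd; apply: norm_le_coord => // j.
      rewrite !mxE eqxx/=; case: (eqVneq j i) => [->|ji].
        by rewrite ltnn add0r mulr1 (le_trans sh)// coord_le_norm.
      rewrite mulr0 addr0; case: ifP => _; last by rewrite normr0.
      exact: coord_le_norm.
    have [s|c ch ce] := @MVT_line _ _ f (x + trunc i h) 'e_i (h 0 i).
      by move=> /inD/dD[Ds _]; exact: fd.
    rewrite (bigD1 i)//= -[k.+1]/(i.+1) truncS addrA -[f _](subrK (f (x + trunc i h))) ce.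
    rewrite (eq_bigl (fun j : 'I_n => (j < k)%N)); last first.
      by move=> j; rewrite -val_eqE/= ltnS ltn_neqAle andbC.
    rewrite (_ : _ - _ - _ = (h 0 i * ('D_('e_i) f (x + trunc i h + c *: 'e_i) - partial i f x)) +
      (f (x + trunc i h) - f x - \sum_(i < n | (i < k)%N) h 0 i * partial i f x)); last by ring.
    rewrite -natr1 mulrDl mul1r addrC (le_trans (ler_normD _ _))// lerD//.
      exact/IH/ltnW.
    rewrite normrM mulrC ler_pM// ?coord_le_norm//.
    by have [_ ] := dD _ (inD _ ch); apply.
  have := Pk n (leqnn n); rewrite trunc_all.
  rewrite (_ : \sum_(i < n | (i < n)%N) _ = df h); last first.
    by apply: eq_bigl => i; rewrite ltn_ord.
  move=> /le_trans h1.
  apply: h1.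
  rewrite mulrA ler_wpM2r//= mulrCA ler_piMr// ler_pdivrMr// mul1r ler_nat.
  by rewrite leqnSn.
Unshelve. all: by end_near. Qed.

End ContinuousPartials.

Section Regularity.
Context {R : realType} {n : nat}.
Local Notation V := 'rV[R]_n.
Implicit Types (D : set V) (f g : V -> R) (x v : V).

Lemma is_derive_shift (W : normedModType R) (f : V -> W) a x v :
  derivable f (x + a) v ->
  is_derive x v (fun y => f (y + a)) ('D_v f (x + a)).
Proof.
move=> fd.
have E : (fun h : R => h^-1 *: (f (h *: v + x + a) - f (x + a))) =
    (fun h => h^-1 *: (f (h *: v + (x + a)) - f (x + a))).
  by rewrite funeqE => h; rewrite addrA.
by split; rewrite /derivable /derive/= E.
Qed.

(** Defined by iteration on the partial derivatives, for scalar functions: unlike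
    [smooth_on], it counts derivatives, so that the algebraic closure properties can
    be proved by induction on [k]. *)
Fixpoint Ck k D f : Prop :=
  (forall x, D x -> {for x, continuous f}) /\
  if k is k'.+1 then
    (forall x i, D x -> derivable f x 'e_i) /\
    (forall i, Ck k' D (partial i f))
  else True.

Definition Cinf D f := forall k, Ck k D f.

Lemma Ck_continuous k D f x : Ck k D f -> D x -> {for x, continuous f}.
Proof. by case: k => [|k] [fc _]; exact: fc. Qed.

Lemma Ck_derivable k D f x i : Ck k.+1 D f -> D x -> derivable f x 'e_i.
Proof. by case=> _ [fd _]; exact: fd. Qed.

Lemma Ck_partial k D f i : Ck k.+1 D f -> Ck k D (partial i f).
Proof. by case=> _ [_]; apply. Qed.

Lemma CkW k D f : Ck k.+1 D f -> Ck k D f.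
Proof.
elim: k f => [f [fc _]|k IH f [fc [fd fp]]]; first by split.
by split=> //; split=> // i; exact: IH.
Qed.

Lemma Ck_le k l D f : (k <= l)%N -> Ck l D f -> Ck k D f.
Proof.
by move=> /subnK <-; elim: (l - k)%N => // m IH; rewrite addSn => /CkW.
Qed.

Lemma Ck_sub k D D' f : D' `<=` D -> Ck k D f -> Ck k D' f.
Proof.
move=> DD'; elim: k f => [f [fc _]|k IH f [fc [fd fp]]].
  by split=> // x /DD'; exact: fc.
split=> [x /DD'|]; first exact: fc.
by split=> [x i /DD'|i]; [exact: fd|exact/IH/fp].
Qed.

Lemma near_eq_on D f g x : open D -> {in D, f =1 g} -> D x ->
  \near x, f x = g x.
Proof.
move=> Dop fg Dx; have : nbhs x D by exact: open_nbhs_nbhs.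
by apply: filterS => y Dy; apply: fg; rewrite inE.
Qed.

Lemma partial_eq D f g i : open D -> {in D, f =1 g} ->
  {in D, partial i f =1 partial i g}.
Proof.
move=> Dop fg x; rewrite inE => Dx.
exact/near_eq_derive/(near_eq_on Dop fg Dx).
Qed.

Lemma Ck_eq k D f g : open D -> {in D, f =1 g} -> Ck k D f -> Ck k D g.
Proof.
move=> Dop; elim: k f g => [|k IH] f g fg.
  move=> [fc _]; split=> // x Dx.
  have := fc x Dx; rewrite /prop_for /continuous_at (fg x) ?inE//.
  exact: (cvg_trans (near_eq_cvg (near_eq_on Dop fg Dx))).
move=> [fc [fd fp]]; split.
  move=> x Dx.
  have := fc x Dx; rewrite /prop_for /continuous_at (fg x) ?inE//.
  exact: (cvg_trans (near_eq_cvg (near_eq_on Dop fg Dx))).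
split=> [x i Dx|i].
  exact: (near_eq_derivable (near_eq_on Dop fg Dx) (fd x i Dx)).
by apply: IH (fp i); exact: partial_eq.
Qed.

Lemma Ck_diff k D f x : open D -> Ck k.+1 D f -> D x ->
  is_diff x f (fun v => \sum_(i < n) v 0 i * partial i f x).
Proof.
move=> Dop fk Dx; apply: (@differentiable_partial _ _ D) => //.
  by move=> y i Dy; exact: (Ck_derivable fk Dy).
by move=> i; exact: (Ck_continuous (Ck_partial i fk)).
Qed.

Lemma Ck_is_derive k D f x v : open D -> Ck k.+1 D f -> D x ->
  is_derive x v f (\sum_(i < n) v 0 i * partial i f x).
Proof.
move=> Dop fk Dx; have [df dfE] := Ck_diff Dop fk Dx.
by split; [exact: diff_derivable|rewrite deriveE// dfE].
Qed.

Lemma derive_sum_partial k D f x v : open D -> Ck k.+1 D f -> D x ->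
  'D_v f x = \sum_(i < n) v 0 i * partial i f x.
Proof. by move=> Dop fk Dx; have [_] := Ck_is_derive v Dop fk Dx. Qed.

Lemma Ck_cst k D (a : R) : Ck k D (cst a).
Proof.
elim: k a => [|k IH] a; first by split=> // x _; exact: cst_continuous.
split=> [x _|]; first exact: cst_continuous.
split=> [x i _|i]; first exact: derivable_cst.
rewrite (_ : partial i _ = cst 0); first exact: IH.
by rewrite funeqE => x; exact: derive_cst.
Qed.

Lemma partialD D f g i x k : Ck k.+1 D f -> Ck k.+1 D g -> D x ->
  partial i (fun y => f y + g y) x = partial i f x + partial i g x.
Proof.
move=> fk gk Dx.
by apply: (@deriveD _ _ _ f g); [exact: (Ck_derivable fk)|exact: (Ck_derivable gk)].
Qed.

Lemma partialM D f g i x k : Ck k.+1 D f -> Ck k.+1 D g -> D x ->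
  partial i (fun y => f y * g y) x = partial i f x * g x + f x * partial i g x.
Proof.
move=> fk gk Dx.
rewrite [RHS](_ : _ = f x *: partial i g x + g x *: partial i f x); last first.
  by rewrite /GRing.scale/= addrC [g x * _]mulrC.
by apply: (@deriveM _ _ f g); [exact: (Ck_derivable fk)|exact: (Ck_derivable gk)].
Qed.

Lemma partialZ D f (a : R) i x k : Ck k.+1 D f -> D x ->
  partial i (fun y => a * f y) x = a * partial i f x.
Proof.
by move=> fk Dx; apply: (@deriveZ _ _ _ f); exact: (Ck_derivable fk).
Qed.

Lemma CkD k D f g : open D -> Ck k D f -> Ck k D g ->
  Ck k D (fun y => f y + g y).
Proof.
move=> Dop; elim: k f g => [|k IH] f g fk gk.
  by split=> // x Dx; apply: (@continuousD _ _ _ f g); [exact: (Ck_continuous fk)|exact: (Ck_continuous gk)].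
split=> [x Dx|].
  by apply: (@continuousD _ _ _ f g); [exact: (Ck_continuous fk)|exact: (Ck_continuous gk)].
split=> [x i Dx|i].
  by apply: (@derivableD _ _ _ f g); [exact: (Ck_derivable fk)|exact: (Ck_derivable gk)].
apply: (Ck_eq Dop _ (IH _ _ (Ck_partial i fk) (Ck_partial i gk))) => x.
by rewrite inE => Dx; rewrite (partialD _ fk gk).
Qed.

Lemma CkM k D f g : open D -> Ck k D f -> Ck k D g ->
  Ck k D (fun y => f y * g y).
Proof.
move=> Dop; elim: k f g => [|k IH] f g fk gk.
  by split=> // x Dx; apply: (@continuousM _ _ f g); [exact: (Ck_continuous fk)|exact: (Ck_continuous gk)].
split=> [x Dx|].
  by apply: (@continuousM _ _ f g); [exact: (Ck_continuous fk)|exact: (Ck_continuous gk)].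
split=> [x i Dx|i].
  by apply: (@derivableM _ _ f g); [exact: (Ck_derivable fk)|exact: (Ck_derivable gk)].
have h1 := IH _ _ (Ck_partial i fk) (CkW gk).
have h2 := IH _ _ (CkW fk) (Ck_partial i gk).
apply: (Ck_eq Dop _ (CkD Dop h1 h2)) => x.
by rewrite inE => Dx; rewrite (partialM _ fk gk).
Qed.

Lemma CkZ k D (a : R) f : open D -> Ck k D f -> Ck k D (fun y => a * f y).
Proof. by move=> Dop; apply: (CkM Dop); exact: Ck_cst. Qed.

Lemma CkN k D f : open D -> Ck k D f -> Ck k D (fun y => - f y).
Proof.
move=> Dop /(CkZ (-1) Dop); apply: (Ck_eq Dop) => x _.
by rewrite mulN1r.
Qed.

Lemma CkB k D f g : open D -> Ck k D f -> Ck k D g ->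
  Ck k D (fun y => f y - g y).
Proof. by move=> Dop fk gk; apply: (CkD Dop fk); exact: CkN. Qed.

Lemma partialB D f g i x k : open D -> Ck k.+1 D f -> Ck k.+1 D g -> D x ->
  partial i (fun y => f y - g y) x = partial i f x - partial i g x.
Proof.
move=> Dop fk gk Dx.
by apply: (@deriveB _ _ _ f g); [exact: (Ck_derivable fk)|exact: (Ck_derivable gk)].
Qed.

Lemma Ck_sum k D m (f : 'I_m -> V -> R) : open D -> (forall i, Ck k D (f i)) ->
  Ck k D (fun y => \sum_(i < m) f i y).
Proof.
move=> Dop fk; rewrite (_ : (fun _ => _) = \sum_(i < m) f i); last first.
  by rewrite funeqE => y; rewrite fct_sumE.
elim/big_ind : _ => [|g h gc hc|i _]; [exact: Ck_cst| |exact: fk].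
exact: CkD.
Qed.

Lemma partial_sum D m (f : 'I_m -> V -> R) i x k :
  (forall j, Ck k.+1 D (f j)) -> D x ->
  partial i (fun y => \sum_(j < m) f j y) x = \sum_(j < m) partial i (f j) x.
Proof.
move=> fk Dx; rewrite (_ : (fun _ => _) = \sum_(i < m) f i); last first.
  by rewrite funeqE => y; rewrite fct_sumE.
by rewrite /partial derive_sum// => j; exact: (Ck_derivable (fk j)).
Qed.

Lemma derive_coord (j : 'I_n) x v : 'D_v (fun y : V => y 0 j) x = v 0 j.
Proof.
have H : derivable id x v by exact: derivable_id.
have := derive_mx H; rewrite derive_id => /rowP/(_ j).
by rewrite mxE.
Qed.

Lemma partial_coord (i j : 'I_n) x :
  partial i (fun y : V => y 0 j) x = (i == j)%:R.
Proof. by rewrite /partial derive_coord mxE eqxx/= eq_sym. Qed.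

Lemma Ck_coord k D (j : 'I_n) : Ck k D (fun y : V => y 0 j).
Proof.
case: k => [|k]; first by split=> // x _; exact: coord_continuous.
split=> [x _|]; first exact: coord_continuous.
split=> [x i _|i]; first by apply/diff_derivable/differentiable_coord.
rewrite (_ : partial i _ = cst ((i == j)%:R : R)); first exact: Ck_cst.
by rewrite funeqE => x; rewrite partial_coord.
Qed.

Lemma partialV D f i x k : Ck k.+1 D f -> D x -> f x != 0 ->
  partial i (fun y => (f y)^-1) x = - (f x)^-2 * partial i f x.
Proof.
by move=> fk Dx fx0; apply: deriveV => //; exact: (Ck_derivable fk).
Qed.

Lemma CkV k D f : open D -> (forall x, D x -> f x != 0) -> Ck k D f ->
  Ck k D (fun y => (f y)^-1).
Proof.
move=> Dop f0; elim: k => [|k IH] fk.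
  by split=> // x Dx; apply: continuousV; [exact: f0|exact: (Ck_continuous fk)].
split=> [x Dx|].
  by apply: continuousV; [exact: f0|exact: (Ck_continuous fk)].
split=> [x i Dx|i].
  by apply: derivableV; [exact: f0|exact: (Ck_derivable fk)].
have IH' := IH (CkW fk).
have h := CkN Dop (CkM Dop (CkM Dop IH' IH') (Ck_partial i fk)).
apply: (Ck_eq Dop _ h) => x; rewrite inE => Dx.
by rewrite (partialV _ fk)// ?f0// mulNr expr2 invfM.
Qed.

(** Two mean value theorems turn the mixed second difference on a square of side
    [h] into a mixed second derivative at a nearby point. *)
Lemma mixed_difference D f (i j : 'I_n) x (d h : R) : open D -> Ck 2 D f ->
  (forall y, `|y| < d -> D (x + y)) -> `|h| + `|h| < d ->
  exists2 y, `|y| <= `|h| + `|h| &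
    f (x + h *: 'e_i + h *: 'e_j) - f (x + h *: 'e_i)
    - (f (x + h *: 'e_j) - f x) = h * (h * partial j (partial i f) (x + y)).
Proof.
move=> Dop f2 xD hd.
have e1 k (s : R) : `|s *: 'e_k : V| <= `|s|.
  rewrite normrZ ler_piMr//; apply: norm_le_coord => // l.
  by rewrite !mxE/=; case: eqP => _/=; rewrite ?normr1// normr0.
have eD k l (s t : R) : `|s| <= `|h| -> `|t| <= `|h| ->
    `|s *: 'e_k + t *: 'e_l : V| <= `|h| + `|h|.
  move=> sh th; apply: le_trans (ler_normD _ _) _.
  by apply: lerD; apply: le_trans (e1 _ _) _.
have h0 : `|0 : R| <= `|h| by rewrite normr0.
pose g y := f (y + h *: 'e_j) - f y.
have gd s : `|s| <= `|h| -> is_derive (x + s *: 'e_i) 'e_i g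
    (partial i f (x + s *: 'e_i + h *: 'e_j) - partial i f (x + s *: 'e_i)).
  move=> sh; apply: is_deriveB; [apply: is_derive_shift|apply: derivableP];
    apply: (Ck_derivable f2).
    by rewrite -addrA; apply/xD/(le_lt_trans _ hd)/eD.
  rewrite -[x + _]addr0 -(scale0r 'e_j) -addrA.
  by apply/xD/(le_lt_trans _ hd)/eD.
have [s sh|c ch] := @MVT_line _ _ g x 'e_i h; first by have [] := gd s sh.
have [_ ->] := gd c ch.
have [s sh|c' ch' ->] := @MVT_line _ _ (partial i f) (x + c *: 'e_i) 'e_j h.
  apply: (Ck_derivable (Ck_partial i f2)).
  by rewrite -addrA; apply/xD/(le_lt_trans _ hd)/eD.
move=> e; exists (c *: 'e_i + c' *: 'e_j); first exact: eD.
by rewrite addrA /partial -e.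
Qed.

Lemma dist_le_via (a b c e : R) :
  `|a - c| <= e / 2 -> `|b - c| <= e / 2 -> `|a - b| <= e.
Proof.
move=> ac bc; rewrite (splitr e) -(subrKA c) (le_trans (ler_normD _ _))//.
by rewrite lerD// distrC.
Qed.

(** Schwarz: the mixed second difference is symmetric in [i] and [j], and both
    orders of differentiation are its limit. *)
Lemma partialC D f (i j : 'I_n) x : open D -> Ck 2 D f -> D x ->
  partial i (partial j f) x = partial j (partial i f) x.
Proof.
move=> Dop f2 Dx; apply/eqP; rewrite -subr_eq0 -normr_le0.
apply/ler_addgt0Pl => e e0; rewrite addr0.
have e2 : 0 < e / 2 by rewrite divr_gt0.
have cij k l : \forall y \near x,
    `|partial k (partial l f) x - partial k (partial l f) y| <= e / 2.
  have c : {for x, continuous (partial k (partial l f))}.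
    exact: (Ck_continuous (Ck_partial k (Ck_partial l f2)) Dx).
  by have /cvgrPdist_le/(_ _ e2) := c.
have nD : \forall y \near x, D y by exact: open_nbhs_nbhs.
have : \forall y \near x, D y /\
    (`|partial i (partial j f) x - partial i (partial j f) y| <= e / 2 /\
     `|partial j (partial i f) x - partial j (partial i f) y| <= e / 2).
  by apply: filterS3 nD (cij i j) (cij j i) => y Dy h1 h2; split.
move=> /nbhs_ballP[d /= d0 dP].
have xD y : `|y| < d -> ball x d (x + y).
  by move=> yd; rewrite -ball_normE/= opprD addNKr normrN.
pose h := d / 4; have h0 : 0 < h by rewrite divr_gt0.
have hd : `|h| + `|h| < d by rewrite gtr0_norm// /h; lra.
have DxD y : `|y| < d -> D (x + y) by move=> /xD/dP[].
have [y yh ey] := mixed_difference i j Dop f2 DxD hd.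
have [z zh ez] := mixed_difference j i Dop f2 DxD hd.
have yz : partial j (partial i f) (x + y) = partial i (partial j f) (x + z).
  apply: (mulfI (lt0r_neq0 h0)); apply: (mulfI (lt0r_neq0 h0)).
  apply: (etrans (esym ey)); apply: etrans ez.
  rewrite (_ : x + h *: 'e_j + h *: 'e_i = x + h *: 'e_i + h *: 'e_j).
    by ring.
  by rewrite addrAC.
have [_ [_ ye]] := dP _ (xD _ (le_lt_trans yh hd)).
have [_ [ze _]] := dP _ (xD _ (le_lt_trans zh hd)).
by apply: dist_le_via ze _; rewrite -yz; exact: ye.
Qed.

End Regularity.

(** * Determinants of size four *)

Section FourIndices.

Definition i0 : 'I_4 := @Ordinal 4 0 isT.
Definition i1 : 'I_4 := @Ordinal 4 1 isT.
Definition i2 : 'I_4 := @Ordinal 4 2 isT.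
Definition i3 : 'I_4 := @Ordinal 4 3 isT.

Lemma big_ord4 (V : nmodType) (f : 'I_4 -> V) :
  \sum_(i < 4) f i = f i0 + f i1 + f i2 + f i3.
Proof.
rewrite !big_ord_recl big_ord0 addr0 !addrA.
by congr (f _ + f _ + f _ + f _); exact: val_inj.
Qed.

Lemma ord4_ind (P : 'I_4 -> Prop) : P i0 -> P i1 -> P i2 -> P i3 -> forall i, P i.
Proof.
move=> p0 p1 p2 p3 [[|[|[|[|//]]]] im].
- by rewrite (_ : Ordinal im = i0)//; exact: val_inj.
- by rewrite (_ : Ordinal im = i1)//; exact: val_inj.
- by rewrite (_ : Ordinal im = i2)//; exact: val_inj.
- by rewrite (_ : Ordinal im = i3)//; exact: val_inj.
Qed.

Lemma ord4_eqE : ((i0 == i0 = true) * (i0 == i1 = false) * (i0 == i2 = false) *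
  (i0 == i3 = false) * (i1 == i0 = false) * (i1 == i1 = true) *
  (i1 == i2 = false) * (i1 == i3 = false) * (i2 == i0 = false) *
  (i2 == i1 = false) * (i2 == i2 = true) * (i2 == i3 = false) *
  (i3 == i0 = false) * (i3 == i1 = false) * (i3 == i2 = false) *
  (i3 == i3 = true))%type.
Proof. by []. Qed.

Lemma det_mx44 (R : comNzRingType) (M : 'M[R]_4) : \det M =
  M i0 i0 * (M i1 i1 * (M i2 i2 * M i3 i3 - M i2 i3 * M i3 i2)
    - M i1 i2 * (M i2 i1 * M i3 i3 - M i2 i3 * M i3 i1)
    + M i1 i3 * (M i2 i1 * M i3 i2 - M i2 i2 * M i3 i1))
  - M i0 i1 * (M i1 i0 * (M i2 i2 * M i3 i3 - M i2 i3 * M i3 i2)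
    - M i1 i2 * (M i2 i0 * M i3 i3 - M i2 i3 * M i3 i0)
    + M i1 i3 * (M i2 i0 * M i3 i2 - M i2 i2 * M i3 i0))
  + M i0 i2 * (M i1 i0 * (M i2 i1 * M i3 i3 - M i2 i3 * M i3 i1)
    - M i1 i1 * (M i2 i0 * M i3 i3 - M i2 i3 * M i3 i0)
    + M i1 i3 * (M i2 i0 * M i3 i1 - M i2 i1 * M i3 i0))
  - M i0 i3 * (M i1 i0 * (M i2 i1 * M i3 i2 - M i2 i2 * M i3 i1)
    - M i1 i1 * (M i2 i0 * M i3 i2 - M i2 i2 * M i3 i0)
    + M i1 i2 * (M i2 i0 * M i3 i1 - M i2 i1 * M i3 i0)).
Proof.
pose m (a b : nat) := M (inord a) (inord b).
have mE (a b : 'I_4) : M a b = m a b by rewrite /m !inord_val.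
rewrite (expand_det_row _ ord0) big_ord4 /cofactor.
rewrite !(expand_det_row _ (ord0 : 'I_3)) !big_ord_recl !big_ord0 /cofactor.
rewrite !(expand_det_row _ (ord0 : 'I_2)) !big_ord_recl !big_ord0 /cofactor.
rewrite !det_mx11 !mxE !mE /= /bump /=.
rewrite !addr0 !add0n !addn0 !addn1 /= !expr0 !expr1.
rewrite -[(1 + 2)%N]/3%N; ring.
Qed.

End FourIndices.

(** * Self-dual two-forms in dimension four *)

Section SelfDualForms.
Context {R : realType}.
Local Notation V := 'rV[R]_4.
Local Notation M4 := 'M[R]_4.

(** [*M = o M] for the flat Hodge star of R^4, with a two-form encoded by the
    antisymmetric matrix of its components. *)
Definition dual_form (o : R) (M : M4) : Prop :=
  [/\ M^T = - M, M i2 i3 = o * M i0 i1, M i3 i1 = o * M i0 i2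
    & M i1 i2 = o * M i0 i3].

(** Rewrites all entries to the six in the cyclic convention 01, 02, 03, 23, 31, 12
    of [dual_form]. *)
Lemma antisymE (M : M4) : M^T = - M ->
  ((M i0 i0 = 0) * (M i1 i1 = 0) * (M i2 i2 = 0) * (M i3 i3 = 0) *
   (M i1 i0 = - M i0 i1) * (M i2 i0 = - M i0 i2) * (M i3 i0 = - M i0 i3) *
   (M i3 i2 = - M i2 i3) * (M i1 i3 = - M i3 i1) * (M i2 i1 = - M i1 i2))%type.
Proof.
move=> Ma; have e i j : M j i = - M i j by move/matrixP/(_ i j): Ma; rewrite !mxE.
have z i : M i i = 0 by have := e i i; lra.
by do !split; rewrite ?z// e.
Qed.

Lemma antisymP (M : M4) : (forall i j, M j i = - M i j) -> M^T = - M.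
Proof. by move=> Ma; apply/matrixP => i j; rewrite !mxE Ma. Qed.

Lemma antisymN (M : M4) i j : M^T = - M -> M j i = - M i j.
Proof. by move/matrixP/(_ i j); rewrite !mxE. Qed.

Definition mulv (M : M4) (x : V) (a : 'I_4) : R := \sum_(e < 4) M a e * x 0 e.

(** The [c]-component of the connection matrices of the coframe
    e^a = dx^a + x_a beta with d beta = F: the solution of the first structure
    equation, see [torsion_pointwise]. *)
Definition conn (x : V) (F : M4) (c : 'I_4) : M4 :=
  \matrix_(a, b) (2^-1 * (mulv F x a * (b == c)%:R - mulv F x b * (a == c)%:R
     + x 0 a * F b c - x 0 b * F a c - F a b * x 0 c)).

Lemma conn_antisym x F c : F^T = - F -> (conn x F c)^T = - conn x F c.
Proof.
move=> Fa; apply: antisymP => a b; rewrite !mxE (antisymN a b Fa).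
by ring.
Qed.

Lemma sign_cases (o : R) : o ^+ 2 = 1 -> o = 1 \/ o = -1.
Proof. by move/eqP; rewrite sqrf_eq1 => /orP[]/eqP->; [left|right]. Qed.

(** The two wedge products in [conn] are not self-dual separately, but their sum is. *)
Lemma conn_dual x F c o : o ^+ 2 = 1 -> dual_form o F -> dual_form o (conn x F c).
Proof.
move=> /sign_cases o1 [Fa F23 F31 F12]; split; first exact: conn_antisym.
all: rewrite !mxE /mulv !big_ord4 !(antisymE Fa) F23 F31 F12.
all: elim/ord4_ind: c; rewrite !ord4_eqE /= !(antisymE Fa) ?F23 ?F31 ?F12.
all: by case: o1 => ->; ring.
Qed.

Lemma dual_formD o A B : dual_form o A -> dual_form o B -> dual_form o (A + B).
Proof.
move=> [Aa A1 A2 A3] [Ba B1 B2 B3]; split; rewrite ?linearD/= ?Aa ?Ba ?opprD//.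
all: by rewrite !mxE ?A1 ?A2 ?A3 ?B1 ?B2 ?B3 mulrDr.
Qed.

Lemma dual_formZ o k A : dual_form o A -> dual_form o (k *: A).
Proof.
move=> [Aa A1 A2 A3]; split; rewrite ?linearZ/= ?Aa ?scalerN//.
all: by rewrite !mxE ?A1 ?A2 ?A3 mulrCA.
Qed.

(** The (anti-)self-dual matrices form an ideal of so(4), one of the two factors
    of so(4) = so(3) + so(3). *)
Lemma dual_form_comm o A B : o ^+ 2 = 1 -> dual_form o A -> dual_form o B ->
  dual_form o (A *m B - B *m A).
Proof.
move=> /sign_cases o1 [Aa A1 A2 A3] [Ba B1 B2 B3]; split.
  by rewrite linearB/= !trmx_mul Aa Ba !mulmxN !mulNmx !opprK opprB.
all: rewrite !mxE !big_ord4 !(antisymE Aa) !(antisymE Ba) ?A1 ?A2 ?A3 ?B1 ?B2 ?B3.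
all: by case: o1 => ->; ring.
Qed.

(** The matrix of the coframe e^a = dx^a + x_a beta, with beta = b . dx. *)
Definition frame (x b : V) : M4 := 1%:M + x^T *m b.
Definition coframe (x b : V) : M4 := 1%:M - x^T *m b.

Lemma frameE x b i j : frame x b i j = (i == j)%:R + x 0 i * b 0 j.
Proof. by rewrite !mxE big_ord1 !mxE. Qed.

Lemma coframeE x b i j : coframe x b i j = (i == j)%:R - x 0 i * b 0 j.
Proof. by rewrite !mxE big_ord1 !mxE. Qed.

Lemma dotE (v w : V) : dot v w = (v *m w^T) 0 0.
Proof. by rewrite mxE; apply: eq_bigr => i _; rewrite mxE. Qed.

Lemma dotC (v w : V) : dot v w = dot w v.
Proof. by apply: eq_bigr => i _; rewrite mulrC. Qed.

(** [x^T *m b] squares to zero as x . b = 0. *)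
Lemma coframeK x b : dot x b = 0 -> coframe x b *m frame x b = 1%:M.
Proof.
rewrite dotC dotE => bx; rewrite /frame /coframe mulmxDr mulmx1 mulmxBl mul1mx.
rewrite mulmxA -[x^T *m b *m x^T]mulmxA [b *m x^T]mx11_scalar bx.
by rewrite raddf0 mulmx0 mul0mx subr0 subrK.
Qed.

Lemma det_frame x b : dot x b = 0 -> \det (frame x b) = 1.
Proof.
rewrite /dot big_ord4 => xb; rewrite det_mx44 !frameE !ord4_eqE /=.
by rewrite -[RHS]addr0 -[in RHS]xb; ring.
Qed.

Lemma det4E (a b c d : V) : det4 a b c d =
  a 0 i0 * (b 0 i1 * (c 0 i2 * d 0 i3 - c 0 i3 * d 0 i2)
    - b 0 i2 * (c 0 i1 * d 0 i3 - c 0 i3 * d 0 i1)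
    + b 0 i3 * (c 0 i1 * d 0 i2 - c 0 i2 * d 0 i1))
  - a 0 i1 * (b 0 i0 * (c 0 i2 * d 0 i3 - c 0 i3 * d 0 i2)
    - b 0 i2 * (c 0 i0 * d 0 i3 - c 0 i3 * d 0 i0)
    + b 0 i3 * (c 0 i0 * d 0 i2 - c 0 i2 * d 0 i0))
  + a 0 i2 * (b 0 i0 * (c 0 i1 * d 0 i3 - c 0 i3 * d 0 i1)
    - b 0 i1 * (c 0 i0 * d 0 i3 - c 0 i3 * d 0 i0)
    + b 0 i3 * (c 0 i0 * d 0 i1 - c 0 i1 * d 0 i0))
  - a 0 i3 * (b 0 i0 * (c 0 i1 * d 0 i2 - c 0 i2 * d 0 i1)
    - b 0 i1 * (c 0 i0 * d 0 i2 - c 0 i2 * d 0 i0)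
    + b 0 i2 * (c 0 i0 * d 0 i1 - c 0 i1 * d 0 i0)).
Proof. by rewrite /det4 det_mx44 !mxE. Qed.

Lemma det4_basis i j a b :
  det4 'e_i 'e_j 'e_a 'e_b =
  let m p q := ((i == p)%:R * (j == q)%:R - (i == q)%:R * (j == p)%:R : R) in
  let l p q := ((a == p)%:R * (b == q)%:R - (a == q)%:R * (b == p)%:R : R) in
  m i0 i1 * l i2 i3 + m i2 i3 * l i0 i1 + m i0 i2 * l i3 i1 + m i3 i1 * l i0 i2
  + m i0 i3 * l i1 i2 + m i1 i2 * l i0 i3.
Proof.
rewrite /= det4E !mxE /= ![_ == i]eq_sym ![_ == j]eq_sym ![_ == a]eq_sym ![_ == b]eq_sym.
by ring.
Qed.

Definition hodge_dual (P : M4) : M4 := \matrix_(i, j)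
  (2^-1 * \sum_(a < 4) \sum_(b < 4) det4 'e_i 'e_j 'e_a 'e_b * P a b).

Lemma hodge_dualE (P : M4) : P^T = - P ->
  [/\ (hodge_dual P)^T = - hodge_dual P, hodge_dual P i2 i3 = P i0 i1,
    hodge_dual P i3 i1 = P i0 i2, hodge_dual P i1 i2 = P i0 i3 &
    [/\ hodge_dual P i0 i1 = P i2 i3, hodge_dual P i0 i2 = P i3 i1 &
    hodge_dual P i0 i3 = P i1 i2]].
Proof.
move=> Pa; split; [|..|split].
  apply: antisymP => i j; rewrite !mxE -mulrN -sumrN; congr (_ * _).
  apply: eq_bigr => a _; rewrite -sumrN; apply: eq_bigr => b _.
  by rewrite !det4E; ring.
all: rewrite !mxE (eq_bigr _ (fun a _ => eq_bigr _ (fun b _ => congr1 (fun t => t * P a b)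
  (det4_basis _ _ a b)))).
all: rewrite /= ?ord4_eqE /= !mulr0 ?mul0r ?mulr1 ?subr0 ?sub0r ?addr0 ?add0r.
all: rewrite !big_ord4 ?ord4_eqE /= ?(antisymE Pa).
all: by field.
Qed.

Lemma eq_antisym (A B : M4) : A^T = - A -> B^T = - B ->
  A i0 i1 = B i0 i1 -> A i0 i2 = B i0 i2 -> A i0 i3 = B i0 i3 ->
  A i2 i3 = B i2 i3 -> A i3 i1 = B i3 i1 -> A i1 i2 = B i1 i2 -> A = B.
Proof.
move=> Aa Ba e1 e2 e3 e4 e5 e6; apply/matrixP => i j.
elim/ord4_ind: i; elim/ord4_ind: j.
all: by rewrite ?(antisymE Aa) ?(antisymE Ba) ?e1 ?e2 ?e3 ?e4 ?e5 ?e6.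
Qed.

Lemma invmx_gram (E N : M4) : N *m E = 1%:M -> invmx (E^T *m E) = N *m N^T.
Proof.
move=> NE; have EN := mulmx1C NE.
have h : (N *m N^T) *m (E^T *m E) = 1%:M.
  by rewrite mulmxA -[N *m N^T *m E^T]mulmxA -trmx_mul EN trmx1 mulmx1.
have [_ u] := mulmx1_unit h.
by rewrite -[LHS]mul1mx -h mulmxK.
Qed.

(** Equality modulo the ideal generated by [s]; [k] is the cofactor that makes the
    remaining identity polynomial. *)
Lemma eq_mod_zero (k s u v : R) : s = 0 -> u = v - k * s -> u = v.
Proof. by move=> ->; rewrite mulr0 subr0. Qed.

(** The Hodge star of a metric with coframe [E] is the flat one on frame
    components.  As det E = 1, the minors of the explicit inverse of [E] agree with
    complementary minors of [E], up to a multiple of x . b = 0. *)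
Lemma star2_frame o x b M : o ^+ 2 = 1 -> dot x b = 0 -> dual_form o M ->
  let E := frame x b in star2 o (E^T *m E) (E^T *m M *m E) = E^T *m M *m E.
Proof.
move=> o2 xb Mo /=; set E := frame x b; set N := coframe x b.
have NE : N *m E = 1%:M by exact: coframeK.
have EN := mulmx1C NE.
have [Ma M23 M31 M12] := Mo.
have detG : \det (E^T *m E) = 1.
  by rewrite det_mulmx det_tr det_frame// mulr1.
have -> : star2 o (E^T *m E) (E^T *m M *m E) = o *: hodge_dual (N *m M *m N^T).
  apply/matrixP => i j; rewrite !mxE mulrCA; congr (_ * _).
  rewrite mulr_sumr; apply: eq_bigr => a _; rewrite mulr_sumr; apply: eq_bigr => c _.
  rewrite detG sqrtr1 mulr1 mulrA; congr (_ * _ * _).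
  rewrite (invmx_gram NE) trmx_mul trmxK.
  congr (fun_of_matrix _ _ _).
  rewrite !mulmxA -[N *m N^T *m E^T]mulmxA -trmx_mul EN trmx1 mulmx1.
  by rewrite -[N *m M *m E *m N]mulmxA EN mulmx1.
set P := N *m M *m N^T.
have Pa : P^T = - P.
  by rewrite /P !trmx_mul trmxK Ma mulNmx mulmxN mulmxA.
have Qa : (E^T *m M *m E)^T = - (E^T *m M *m E).
  by rewrite !trmx_mul trmxK Ma mulNmx mulmxN mulmxA.
have PE i j : P i j = \sum_c \sum_d N i c * M c d * N j d.
  rewrite /P mxE exchange_big/=; apply: eq_bigr => d _.
  by rewrite !mxE mulr_suml.
have QE i j : (E^T *m M *m E) i j = \sum_c \sum_d E c i * M c d * E d j.
  rewrite mxE exchange_big/=; apply: eq_bigr => d _.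
  by rewrite !mxE mulr_suml; apply: eq_bigr => c _; rewrite !mxE.
have [Ha H1 H2 H3 [H4 H5 H6]] := hodge_dualE Pa.
move: xb; rewrite /dot big_ord4 => xb.
apply: eq_antisym => //; first by rewrite linearZ/= Ha scalerN.
all: rewrite mxE ?H1 ?H2 ?H3 ?H4 ?H5 ?H6 PE QE !big_ord4.
all: rewrite !frameE !coframeE !ord4_eqE /= !(antisymE Ma) M23 M31 M12.
1: apply: (@eq_mod_zero (M i0 i1) _ _ _ xb).
2: apply: (@eq_mod_zero (M i0 i2) _ _ _ xb).
3: apply: (@eq_mod_zero (M i0 i3) _ _ _ xb).
4: apply: (@eq_mod_zero (o * M i0 i1) _ _ _ xb).
5: apply: (@eq_mod_zero (o * M i0 i2) _ _ _ xb).
6: apply: (@eq_mod_zero (o * M i0 i3) _ _ _ xb).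
all: by case: (sign_cases o2) => ->; ring.
Qed.

End SelfDualForms.

(** * The Ricci tensor as an algebraic expression in F and its derivatives *)

Section FrameRicci.
Context {R : realType}.
Local Notation V := 'rV[R]_4.
Local Notation M4 := 'M[R]_4.

Lemma sum_delta (v : 'I_4 -> R) c : \sum_(a < 4) v a * (a == c)%:R = v c.
Proof.
rewrite (bigD1 c)//= eqxx mulr1 big1 ?addr0// => a /negbTE ->.
by rewrite mulr0.
Qed.

Lemma mulv_basis (F : M4) k a : mulv F 'e_k a = F a k.
Proof.
rewrite -[RHS](sum_delta (F a)); apply: eq_bigr => e _.
by rewrite mxE eqxx.
Qed.

Lemma trace_antisym (F : M4) : F^T = - F -> \sum_(a < 4) F a a = 0.
Proof. by move=> Fa; rewrite big_ord4 !(antisymE Fa) !addr0. Qed.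

Lemma mulv_left (F : M4) (x : V) b : F^T = - F ->
  \sum_(a < 4) x 0 a * F a b = - mulv F x b.
Proof.
move=> Fa; rewrite -sumrN; apply: eq_bigr => a _.
by rewrite (antisymN b a Fa) mulrN mulrC.
Qed.

Lemma trace_conn (x : V) (F : M4) b : F^T = - F ->
  \sum_(a < 4) conn x F a a b = - (2^-1 * mulv F x b).
Proof.
move=> Fa.
transitivity (\sum_(a < 4) (2^-1 * (mulv F x a * (a == b)%:R - mulv F x b
  + F b a * x 0 a - x 0 b * F a a - x 0 a * F a b))).
  by apply: eq_bigr => a _; rewrite !mxE eqxx [b == a]eq_sym /=; ring.
rewrite -mulr_sumr !(sumrB, big_split)/= sum_delta. 
rewrite mulv_left// -mulr_sumr.
rewrite trace_antisym// sumr_const card_ord -/(mulv F x b).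
by field.
Qed.

Variables (x : V) (F : M4) (dF : 'I_4 -> M4).

(** The value of [b] forced by F x = 2 b. *)
Definition half_mulv : V := \row_i (2^-1 * mulv F x i).

(** The derivative in direction [k] of [conn x (F x) c], with [dF] for the derivatives
    of [F]. *)
Definition dconn (k c : 'I_4) : M4 := conn 'e_k F c + conn x (dF k) c.

(** The curvature of the connection [conn] in frame components; the terms
    quadratic in [F] besides the commutator come from de^a and from replacing the
    coordinate derivatives of [F] by frame derivatives. *)
Definition frame_riem (c d : 'I_4) : M4 :=
  dconn c d - dconn d c
  + 2 *: (half_mulv 0 c *: conn x F d - half_mulv 0 d *: conn x F c)
  - (2^-1 * dot x x * F c d) *: F
  + (conn x F c *m conn x F d - conn x F d *m conn x F c).

(** The divergence of the two-form, its electric current if [F] is an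
    electromagnetic field. *)
Definition current (b : 'I_4) : R := \sum_(a < 4) dF a b a.

Definition ricci_lin : M4 := \matrix_(d, b) (2^-1 *
  (- (\sum_(a < 4) current a * x 0 a) * (d == b)%:R
   + x 0 b * current d + x 0 d * current b)).

(** The trace-free square of [F], the stress tensor of an electromagnetic field. *)
Definition stress : M4 := 2^-1 *: (F *m F - (4^-1 * \tr (F *m F))%:M).

Definition ricci_quad : M4 := \matrix_(d, b)
  (dot x x * stress d b - (\sum_(a < 4) x 0 a * mulv stress x a) * (d == b)%:R
   + mulv stress x d * x 0 b + x 0 d * mulv stress x b).

Hypothesis Fa : F^T = - F.
Hypothesis dFa : forall k, (dF k)^T = - dF k.
Hypothesis euler : forall a b, \sum_(k < 4) x 0 k * dF k a b = - 4 * F a b.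

(** The Euler relation for [F] cancels all undifferentiated terms, and only the
    divergence of [F] is left. *)
Lemma dconn_ricci d b :
  \sum_(a < 4) (dconn a d - dconn d a) a b = ricci_lin d b.
Proof.
have J e : \sum_(a < 4) dF a a e = - current e.
  by rewrite -sumrN; apply: eq_bigr => a _; rewrite (antisymN e a (dFa a)).
have t1 : \sum_(a < 4) conn 'e_a F d a b = 3 / 2 * F b d.
  transitivity (\sum_(a < 4) (2^-1 * (F a a * (b == d)%:R - F b a * (a == d)%:R
     + F b d - F a d * (a == b)%:R - F a b * (a == d)%:R))).
    apply: eq_bigr => a _; rewrite !mxE !mulv_basis !eqxx /=.
    by rewrite [d == a]eq_sym [b == a]eq_sym; ring.
  rewrite -mulr_sumr !(sumrB, big_split)/= !sum_delta -mulr_suml trace_antisym//.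
  by rewrite sumr_const card_ord (antisymN b d Fa); field.
have t2 : \sum_(a < 4) conn x (dF a) d a b = 2^-1 *
    (- (\sum_(a < 4) current a * x 0 a) * (d == b)%:R - mulv (dF d) x b
     - 4 * F b d + x 0 b * current d + x 0 d * current b).
  transitivity (\sum_(a < 4) (2^-1 * (mulv (dF a) x a * (b == d)%:R
      - mulv (dF a) x b * (a == d)%:R
     + x 0 a * dF a b d - x 0 b * dF a a d - x 0 d * dF a a b))).
    by apply: eq_bigr => a _; rewrite !mxE; ring.
  rewrite -mulr_sumr !(sumrB, big_split)/= !sum_delta -mulr_suml -!mulr_sumr.
  rewrite !J euler (_ : \sum_(a < 4) mulv (dF a) x a = - \sum_(a < 4) current a * x 0 a).
    by rewrite eq_sym; ring.
  rewrite exchange_big/= -sumrN; apply: eq_bigr => e _.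
  by rewrite -mulr_suml J mulNr.
transitivity (\sum_(a < 4) conn 'e_a F d a b + \sum_(a < 4) conn x (dF a) d a b
  - (\sum_(a < 4) conn 'e_d F a a b + \sum_(a < 4) conn x (dF d) a a b)).
  by rewrite -!big_split -sumrB /=; apply: eq_bigr => a _; rewrite /dconn !mxE.
rewrite t1 t2 !trace_conn// mulv_basis mxE.
by field.
Qed.

Let h (a : 'I_4) : R := half_mulv 0 a.

Lemma conn_entry c a b : conn x F c a b =
  h a * (b == c)%:R - h b * (a == c)%:R
  + 2^-1 * (x 0 a * F b c - x 0 b * F a c - F a b * x 0 c).
Proof. by rewrite /h !mxE; field. Qed.

Lemma conn_contract_left (v : V) c b :
  \sum_(a < 4) v 0 a * conn x F c a b =
  (\sum_(a < 4) v 0 a * h a) * (b == c)%:R - h b * v 0 c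
  + 2^-1 * (dot v x * F b c + x 0 b * mulv F v c + mulv F v b * x 0 c).
Proof.
transitivity (\sum_(a < 4) (v 0 a * h a * (b == c)%:R - h b * (v 0 a * (a == c)%:R)
  + 2^-1 * (v 0 a * x 0 a * F b c - x 0 b * (v 0 a * F a c) - v 0 a * F a b * x 0 c))).
  by apply: eq_bigr => a _; rewrite conn_entry; ring.
rewrite !(sumrB, big_split)/= -mulr_suml -!mulr_sumr sum_delta.
rewrite !sumrB -!mulr_suml -!mulr_sumr !mulv_left//.
by rewrite /dot; ring.
Qed.

Lemma conn_contract_index (v : V) a b :
  \sum_(c < 4) v 0 c * conn x F c a b =
  h a * v 0 b - h b * v 0 a
  + 2^-1 * (x 0 a * mulv F v b - x 0 b * mulv F v a - F a b * dot v x).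
Proof.
transitivity (\sum_(c < 4) (h a * (v 0 c * (c == b)%:R) - h b * (v 0 c * (c == a)%:R)
  + 2^-1 * (x 0 a * (F b c * v 0 c) - x 0 b * (F a c * v 0 c) - F a b * (v 0 c * x 0 c)))).
  apply: eq_bigr => c _; rewrite conn_entry [c == b]eq_sym [c == a]eq_sym.
  by ring.
rewrite !(sumrB, big_split)/= -!mulr_sumr !sum_delta !sumrB -!mulr_sumr.
by rewrite /dot /mulv.
Qed.

Let hv := half_mulv.
Let y (a : 'I_4) : R := mulv F hv a.
Let K d b : R := \sum_(e < 4) F e d * F e b.
Let norm2 : R := \sum_(a < 4) \sum_(e < 4) F a e * F a e.

Lemma mulv_half a : mulv F x a = 2 * h a.
Proof. by rewrite /h mxE; field. Qed.

Lemma dot_mulv (u v : V) : \sum_(a < 4) u 0 a * mulv F v a =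
  - \sum_(a < 4) mulv F u a * v 0 a.
Proof.
transitivity (\sum_(a < 4) \sum_(e < 4) u 0 a * F a e * v 0 e).
  apply: eq_bigr => a _; rewrite mulr_sumr; apply: eq_bigr => e _.
  by rewrite mulrA.
rewrite exchange_big/= -sumrN; apply: eq_bigr => e _.
by rewrite -mulr_suml mulv_left// mulNr.
Qed.

Lemma dot_half_mulv : dot hv x = 0.
Proof.
have e := dot_mulv x x.
have e2 : \sum_(a < 4) x 0 a * mulv F x a = 2 * dot hv x.
  by rewrite mulr_sumr; apply: eq_bigr => a _; rewrite mulv_half /h -/hv; ring.
have e3 : \sum_(a < 4) mulv F x a * x 0 a = 2 * dot hv x.
  by rewrite mulr_sumr; apply: eq_bigr => a _; rewrite mulv_half /h -/hv; ring.
by rewrite e2 e3 in e; lra.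
Qed.

Lemma sum_index_x e b : \sum_(a < 4) x 0 a * conn x F a e b = - (2^-1 * dot x x * F e b).
Proof. by rewrite conn_contract_index !mulv_half; field. Qed.

Lemma sum_left_x a b :
  \sum_(e < 4) x 0 e * conn x F a e b = 2^-1 * dot x x * F b a + x 0 b * h a.
Proof.
rewrite conn_contract_left !mulv_half.
have -> : \sum_(a < 4) x 0 a * h a = 0.
  by rewrite -[RHS]dot_half_mulv; apply: eq_bigr => e _; rewrite mulrC.
by field.
Qed.

Lemma sum_both b :
  \sum_(a < 4) \sum_(e < 4) F a e * conn x F a e b = y b + 2^-1 * x 0 b * norm2.
Proof.
transitivity (\sum_(a < 4) (y a * (a == b)%:R - h b * F a a + F b a * h a
   + 2^-1 * x 0 b * (\sum_(e < 4) F a e * F a e)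
   + 2^-1 * \sum_(e < 4) F b e * (x 0 a * F a e))).
  apply: eq_bigr => a _.
  have rowE e : (row a F) 0 e = F a e by rewrite mxE.
  rewrite (eq_bigr (fun e => (row a F) 0 e * conn x F a e b)); last first.
    by move=> e _; rewrite rowE.
  rewrite conn_contract_left rowE [b == a]eq_sym.
  have -> : \sum_(e < 4) (row a F) 0 e * h e = y a.
    by apply: eq_bigr => e _; rewrite rowE.
  have -> : dot (row a F) x = 2 * h a.
    by rewrite -mulv_half; apply: eq_bigr => e _; rewrite rowE.
  have -> : mulv F (row a F) a = \sum_(e < 4) F a e * F a e.
    by apply: eq_bigr => e _; rewrite rowE.
  have -> : \sum_(e < 4) F b e * (x 0 a * F a e) = mulv F (row a F) b * x 0 a.
    by rewrite mulr_suml; apply: eq_bigr => e _; rewrite rowE; ring.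
  by field.
rewrite !(sumrB, big_split)/= sum_delta -!mulr_sumr trace_antisym// mulr0 subr0.
have -> : \sum_(a < 4) \sum_(e < 4) F b e * (x 0 a * F a e) = - (2 * y b).
  rewrite exchange_big/= /y /mulv mulr_sumr -sumrN; apply: eq_bigr => e _.
  by rewrite -mulr_sumr mulv_left// mulv_half /h -/hv; ring.
have -> : \sum_(a < 4) F b a * h a = y b by [].
by rewrite /norm2; field.
Qed.

Lemma sum_mulv d : \sum_(a < 4) F a d * h a = - y d.
Proof.
by rewrite -[RHS](mulv_left hv d Fa); apply: eq_bigr => a _; rewrite mulrC.
Qed.

Lemma sum_conn_conn d b :
  \sum_(a < 4) \sum_(e < 4) conn x F d a e * conn x F a e b =
  h d * h b - dot hv hv * (d == b)%:R
  - 2^-1 * (x 0 d * y b + x 0 b * y d) - 4^-1 * norm2 * x 0 d * x 0 b.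
Proof.
transitivity (\sum_(a < 4) (h a * conn x F a d b
   - (\sum_(e < 4) h e * conn x F a e b) * (a == d)%:R
   + 2^-1 * \sum_(e < 4) F e d * (x 0 a * conn x F a e b)
   - 2^-1 * (F a d * \sum_(e < 4) x 0 e * conn x F a e b)
   - 2^-1 * x 0 d * \sum_(e < 4) F a e * conn x F a e b)).
  apply: eq_bigr => a _.
  rewrite -(sum_delta (fun e => conn x F a e b) d) mulr_suml !mulr_sumr.
  rewrite -!(sumrB, big_split)/=; apply: eq_bigr => e _.
  by rewrite (conn_entry d a e); ring.
have E1 : \sum_(a < 4) \sum_(e < 4) F e d * (x 0 a * conn x F a e b) =
    - (2^-1 * dot x x) * K d b.
  rewrite exchange_big/= mulr_sumr; apply: eq_bigr => e _.
  by rewrite -mulr_sumr sum_index_x; ring.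
have E2 : \sum_(a < 4) F a d * (\sum_(e < 4) x 0 e * conn x F a e b) =
    - (2^-1 * dot x x) * K d b + x 0 b * - y d.
  rewrite -sum_mulv [X in X + _]mulr_sumr [X in _ + X]mulr_sumr -big_split/=; apply: eq_bigr => a _.
  by rewrite sum_left_x (antisymN a b Fa); ring.
rewrite !(sumrB, big_split)/= sum_delta -!mulr_sumr sum_both E1 E2.
rewrite conn_contract_index conn_contract_left.
rewrite dot_half_mulv -/hv -/(y b) -/(y d) [b == d]eq_sym.
rewrite -/(dot hv hv) -/(h b) -/(h d).
by field.
Qed.

Lemma stressE d b : stress d b = 2^-1 * (4^-1 * norm2 * (d == b)%:R - K d b).
Proof.
rewrite !mxE.
have -> : \sum_j F d j * F j b = - K d b.
  by rewrite -sumrN; apply: eq_bigr => e _; rewrite (antisymN e d Fa); ring.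
have -> : \tr (F *m F) = - norm2.
  rewrite -sumrN; apply: eq_bigr => a _; rewrite mxE -sumrN.
  by apply: eq_bigr => e _; rewrite (antisymN a e Fa); ring.
by rewrite -mulr_natr; ring.
Qed.

Lemma mulv_stress d : mulv stress x d = y d + 8^-1 * norm2 * x 0 d.
Proof.
rewrite /mulv (eq_bigr (fun b => 8^-1 * norm2 * (x 0 b * (b == d)%:R)
  - 2^-1 * \sum_(e < 4) F e d * (F e b * x 0 b))); last first.
  move=> b _; have -> : \sum_(e < 4) F e d * (F e b * x 0 b) = K d b * x 0 b.
    by rewrite mulr_suml; apply: eq_bigr => e _; rewrite mulrA.
  by rewrite stressE [b == d]eq_sym; field.
rewrite sumrB -!mulr_sumr sum_delta.
have -> : \sum_(b < 4) \sum_(e < 4) F e d * (F e b * x 0 b) = - (2 * y d).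
  rewrite exchange_big/= -mulrN -sum_mulv mulr_sumr; apply: eq_bigr => e _.
  by rewrite -mulr_sumr -/(mulv F x e) mulv_half; ring.
by field.
Qed.

Lemma quad_ricci d b :
  \sum_(a < 4) (2 *: (h a *: conn x F d - h d *: conn x F a)
  - (2^-1 * dot x x * F a d) *: F
  + (conn x F a *m conn x F d - conn x F d *m conn x F a)) a b = ricci_quad d b.
Proof.
transitivity (2 * (\sum_(a < 4) h a * conn x F d a b) + 2 * h d * h b
  - 2^-1 * dot x x * K d b - \sum_(e < 4) h e * conn x F d e b
  - \sum_(a < 4) \sum_(e < 4) conn x F d a e * conn x F a e b).
  have -> : - \sum_(e < 4) h e * conn x F d e b =
      \sum_(a < 4) \sum_(e < 4) conn x F a a e * conn x F d e b.
    rewrite exchange_big/= -sumrN; apply: eq_bigr => e _.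
    by rewrite -mulr_suml trace_conn// mulv_half; field.
  have -> : 2 * h d * h b = - (2 * h d * \sum_(a < 4) conn x F a a b).
    by rewrite trace_conn// mulv_half; field.
  rewrite !mulr_sumr -!(sumrB, big_split)/=; apply: eq_bigr => a _.
  by rewrite !mxE; ring.
rewrite sum_conn_conn conn_contract_left [b == d]eq_sym [RHS]mxE stressE !mulv_stress.
rewrite dot_half_mulv -/hv -/(y b) -/(y d) -/(dot hv hv) -/(h b) -/(h d).
have -> : \sum_(a < 4) x 0 a * mulv stress x a = 8^-1 * norm2 * dot x x - 2 * dot hv hv.
  rewrite (eq_bigr (fun a => 8^-1 * norm2 * (x 0 a * x 0 a) + x 0 a * y a)); last first.
    by move=> a _; rewrite mulv_stress; ring.
  rewrite big_split/= -mulr_sumr dot_mulv; congr (_ - _).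
  by rewrite mulr_sumr; apply: eq_bigr => a _; rewrite mulv_half /h -/hv; ring.
by field.
Qed.

(** The Ricci tensor splits into a part of first order in the derivatives of [F],
    through its divergence only, and a part quadratic in [F], through its stress
    tensor only. *)
Lemma frame_ricci d b :
  \sum_(a < 4) frame_riem a d a b = ricci_lin d b + ricci_quad d b.
Proof.
rewrite -dconn_ricci -quad_ricci -big_split/=; apply: eq_bigr => a _.
have -> : frame_riem a d = (dconn a d - dconn d a)
    + (2 *: (h a *: conn x F d - h d *: conn x F a) - (2^-1 * dot x x * F a d) *: F
       + (conn x F a *m conn x F d - conn x F d *m conn x F a)).
  by rewrite /frame_riem !addrA.
by rewrite [LHS]mxE.
Qed.

End FrameRicci.

Section RicciAlgebra.
Context {R : realType}.
Local Notation V := 'rV[R]_4.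
Local Notation M4 := 'M[R]_4.
Implicit Types (x : V) (M : M4).

(** The components of [M - o *M]; they vanish exactly if *M = o M, see
    [dual_defectP]. *)
Definition dual_defect (o : R) M : 'I_3 -> R :=
  tnth [tuple M i0 i1 - o * M i2 i3; M i0 i2 - o * M i3 i1; M i0 i3 - o * M i1 i2].

Lemma dual_defectP o M : o ^+ 2 = 1 -> M^T = - M ->
  (forall k, dual_defect o M k = 0) -> dual_form o M.
Proof.
move=> /sign_cases o1 Ma h; split=> //.
- by have := h (inord 0); rewrite /dual_defect (tnth_nth 0) inordK//=; case: o1 => ->; lra.
- by have := h (inord 1); rewrite /dual_defect (tnth_nth 0) inordK//=; case: o1 => ->; lra.
- by have := h (inord 2); rewrite /dual_defect (tnth_nth 0) inordK//=; case: o1 => ->; lra.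
Qed.

Lemma stress_dual_form o M : o ^+ 2 = 1 -> dual_form o M -> stress M = 0.
Proof.
move=> /sign_cases o1 [Ma M23 M31 M12]; apply/matrixP => d b.
have sE : stress M d b = 2^-1 * (\sum_(e < 4) M d e * M e b
    - 4^-1 * (\sum_(a < 4) \sum_(e < 4) M a e * M e a) * (d == b)%:R).
  rewrite !mxE mulr_natr; congr (_ * (_ - _ * _ *+ _)).
  by apply: eq_bigr => a _; rewrite mxE.
rewrite sE !big_ord4 [RHS]mxE.
elim/ord4_ind: d {sE}; elim/ord4_ind: b; rewrite ?ord4_eqE /= !(antisymE Ma) M23 M31 M12.
all: by case: o1 => ->; field.
Qed.

(** The stress tensor is the product of the self-dual and anti-self-dual parts of
    the two-form: each of the nine products is a combination of the ten entries of
    the symmetric matrix [stress M]. *)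
Lemma stress0_dual_defect M k l : M^T = - M -> stress M = 0 ->
  dual_defect 1 M k * dual_defect (-1) M l = 0.
Proof.
move=> Ma s0.
have e d b : \sum_(e < 4) M d e * M e b =
    4^-1 * (\sum_(a < 4) \sum_(e < 4) M a e * M e a) * (d == b)%:R.
  have : stress M d b = 0 by rewrite s0 mxE.
  rewrite !mxE mulr_natr => /eqP; rewrite mulf_eq0 invr_eq0 pnatr_eq0 /= subr_eq0 => /eqP ->.
  congr (_ * _ *+ _).
  by apply: eq_bigr => a _; rewrite mxE.
have := (e i0 i0, e i1 i1, e i2 i2, e i3 i3, (e i0 i1, e i0 i2, e i0 i3, (e i1 i2, e i2 i3, e i3 i1))).
rewrite !big_ord4 !ord4_eqE /= !(antisymE Ma) => -[[[[e0 e1] e2] e3] [[[e4 e5] e6] [[e7 e8] e9]]].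
case: k => [[|[|[|//]]] ?]; case: l => [[|[|[|//]]] ?]; rewrite /dual_defect !(tnth_nth 0) /=; lra.
Qed.

(** Contracting with [x] gives 2 |x|^2 T x = 0; then only |x|^2 T is left. *)
Lemma ricci_quad_eq0 x M : dot x x != 0 -> ricci_quad x M = 0 -> stress M = 0.
Proof.
move=> x0 q0; pose T := stress M.
have e d b : dot x x * T d b - (\sum_(a < 4) x 0 a * mulv T x a) * (d == b)%:R
   + mulv T x d * x 0 b + x 0 d * mulv T x b = 0.
  have h : ricci_quad x M d b = 0 by rewrite q0 mxE.
  by move: h; rewrite [X in X = _]mxE; apply.
have T0 d : mulv T x d = 0.
  have : 2 * dot x x * mulv T x d = 0.
    transitivity (\sum_(b < 4) (dot x x * T d b
        - (\sum_(a < 4) x 0 a * mulv T x a) * (d == b)%:R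
        + mulv T x d * x 0 b + x 0 d * mulv T x b) * x 0 b); last first.
      by apply: big1 => b _; rewrite e mul0r.
    rewrite (eq_bigr (fun b => dot x x * (T d b * x 0 b)
        - (\sum_(a < 4) x 0 a * mulv T x a) * (x 0 b * (b == d)%:R)
        + mulv T x d * (x 0 b * x 0 b) + x 0 d * (x 0 b * mulv T x b))); last first.
      by move=> b _; rewrite [d == b]eq_sym; ring.
    rewrite !(sumrB, big_split)/= -!mulr_sumr sum_delta -/(mulv T x d) -/(dot x x).
    by ring.
  by move/eqP; rewrite !mulf_eq0 pnatr_eq0 (negbTE x0) /= => /eqP.
apply/matrixP => d b; rewrite [RHS]mxE; have := e d b; rewrite !T0.
rewrite big1 => [|a _]; last by rewrite T0 mulr0.
by rewrite !mul0r mulr0 subr0 !addr0 => /eqP; rewrite mulf_eq0 (negbTE x0) => /eqP.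
Qed.

(** The trace gives x . J = 0, and contracting with [x] then gives |x|^2 J = 0. *)
Lemma ricci_lin_eq0 x (dF : 'I_4 -> M4) : dot x x != 0 -> ricci_lin x dF = 0 ->
  forall d, current dF d = 0.
Proof.
move=> x0 l0 d; pose J := current dF.
set s := \sum_(a < 4) J a * x 0 a.
have e d' b' : 2^-1 * (- s * (d' == b')%:R + x 0 b' * J d' + x 0 d' * J b') = 0.
  have h : ricci_lin x dF d' b' = 0 by rewrite l0 mxE.
  by move: h; rewrite [X in X = _]mxE; apply.
have s0 : s = 0.
  have : \sum_(a < 4) 2^-1 * (- s * (a == a)%:R + x 0 a * J a + x 0 a * J a) = 0.
    by apply: big1 => a _; rewrite e.
  rewrite (eq_bigr (fun a => - (2^-1 * s) + J a * x 0 a)); last first.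
    by move=> a _; rewrite eqxx /=; field.
  rewrite big_split/= -/s big_ord4; lra.
have : dot x x * J d = 0.
  transitivity (2 * (\sum_(b < 4) 2^-1 * (- s * (d == b)%:R + x 0 b * J d + x 0 d * J b) * x 0 b)).
    rewrite [RHS]mulr_sumr s0 [RHS](eq_bigr (fun b => x 0 b * x 0 b * J d + x 0 d * (J b * x 0 b))).
      by rewrite big_split/= -mulr_suml -mulr_sumr -/s s0 mulr0 addr0.
    by move=> b _; field.
  by rewrite big1 ?mulr0// => b _; rewrite e mul0r.
by move/eqP; rewrite mulf_eq0 (negbTE x0) => /eqP.
Qed.

Lemma ricci_quad0 x M : stress M = 0 -> ricci_quad x M = 0.
Proof.
move=> s0; have T0 d : mulv (stress M) x d = 0.
  by rewrite s0 /mulv big1// => e _; rewrite mxE mul0r.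
apply/matrixP => d b; rewrite mxE !T0 s0 !mxE big1 => [|a _]; last by rewrite -s0 T0 mulr0.
by ring.
Qed.

Lemma ricci_lin0 x (dF : 'I_4 -> M4) : (forall d, current dF d = 0) -> ricci_lin x dF = 0.
Proof.
move=> J0; apply/matrixP => d b; rewrite mxE !J0 [RHS]mxE big1 => [|a _].
  by ring.
by rewrite J0 mul0r.
Qed.

(** The divergence is the exterior derivative of the dual form. *)
Lemma dual_closed_current o (dF : 'I_4 -> M4) : o ^+ 2 = 1 ->
  (forall k, dual_form o (dF k)) ->
  (forall i j k, dF i j k + dF j k i + dF k i j = 0) ->
  forall d, current dF d = 0.
Proof.
move=> /sign_cases o1 dFo cl d.
have := (cl i1 i2 i3, cl i0 i2 i3, cl i0 i3 i1, cl i0 i1 i2).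
rewrite /current big_ord4.
have [a0 b0 c0 d0] := dFo i0; have [a1 b1 c1 d1] := dFo i1.
have [a2 b2 c2 d2] := dFo i2; have [a3 b3 c3 d3] := dFo i3.
elim/ord4_ind: d; rewrite ?(antisymE a0) ?(antisymE a1) ?(antisymE a2) ?(antisymE a3).
all: rewrite ?(b0, b1, b2, b3, c0, c1, c2, c3, d0, d1, d2, d3).
all: by case: o1 => ->; move=> [[[]]]; lra.
Qed.

End RicciAlgebra.

(** * The Beltrami equation as pointwise duality *)

Section BeltramiAlgebra.
Context {R : realType}.
Local Notation V := 'rV[R]_4.
Local Notation M4 := 'M[R]_4.

Definition row4 (a c d e : R) : V := \row_(i < 4) tnth [tuple a; c; d; e] i.

Lemma row4E a c d e : ((row4 a c d e 0 i0 = a) * (row4 a c d e 0 i1 = c) *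
  (row4 a c d e 0 i2 = d) * (row4 a c d e 0 i3 = e))%type.
Proof. by rewrite !mxE. Qed.

Definition bilin (M : M4) (v w : V) : R := \sum_(i < 4) v 0 i * mulv M w i.

(** The Beltrami equation on tangent vectors, where dA = M and 2 A = M u: its
    left-hand side is a combination of u . v and u . w. *)
Lemma dual_form_bilin o (M : M4) (u v w : V) : o ^+ 2 = 1 -> dual_form o M ->
  dot u v = 0 -> dot u w = 0 ->
  dot u u * bilin M v w + o * det4 u (\row_i mulv M u i) v w = 0.
Proof.
move=> o2 [Ma M23 M31 M12] uv uw.
have -> : dot u u * bilin M v w + o * det4 u (\row_i mulv M u i) v w =
    dot u v * bilin M u w - dot u w * bilin M u v.
  rewrite det4E /dot /bilin /mulv !big_ord4 !mxE !big_ord4 !(antisymE Ma) M23 M31 M12.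
  by case: (sign_cases o2) => ->; ring.
by rewrite uv uw !mul0r subr0.
Qed.

(** The vectors L1, L2, L3 are, up to sign, the left or right quaternionic multiples
    of [u] by the imaginary units, according to the sign [o].  They span the tangent
    space, and on a pair of them the Beltrami equation is one component of M = o *M. *)
Lemma bilin_dual_form o (M : M4) (u : V) : o ^+ 2 = 1 -> M^T = - M ->
  dot u u = 1 ->
  (forall v w, dot u v = 0 -> dot u w = 0 ->
    bilin M v w + o * det4 u (\row_i mulv M u i) v w = 0) ->
  dual_form o M.
Proof.
move=> o2 Ma uu uM.
(* The signs are those for which the three equations decouple. *)
pose L1 := row4 (u 0 i1) (- u 0 i0) (- o * u 0 i3) (o * u 0 i2).
pose L2 := row4 (u 0 i2) (o * u 0 i3) (- u 0 i0) (- o * u 0 i1).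
pose L3 := row4 (u 0 i3) (- o * u 0 i2) (o * u 0 i1) (- u 0 i0).
have t1 : dot u L1 = 0 by rewrite /dot big_ord4 !row4E; ring.
have t2 : dot u L2 = 0 by rewrite /dot big_ord4 !row4E; ring.
have t3 : dot u L3 = 0 by rewrite /dot big_ord4 !row4E; ring.
have key m : - o * dot u u ^+ 2 * m = 0 -> m = 0.
  move=> /eqP; rewrite uu expr1n mulr1 mulf_eq0 oppr_eq0 => /orP[/eqP o0|/eqP//].
  by move: o2; rewrite o0 expr0n /= => /eqP; rewrite eq_sym oner_eq0.
have h1 : M i0 i1 - o * M i2 i3 = 0.
  apply: key; rewrite -[RHS](uM _ _ t2 t3) -[X in _ = X + _]mul1r -{1}uu.
  rewrite det4E /dot /bilin /mulv !big_ord4 !row4E !mxE !big_ord4 !(antisymE Ma).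
  by case: (sign_cases o2) => ->; ring.
have h2 : M i0 i2 - o * M i3 i1 = 0.
  apply: key; rewrite -[RHS](uM _ _ t3 t1) -[X in _ = X + _]mul1r -{1}uu.
  rewrite det4E /dot /bilin /mulv !big_ord4 !row4E !mxE !big_ord4 !(antisymE Ma).
  by case: (sign_cases o2) => ->; ring.
have h3 : M i0 i3 - o * M i1 i2 = 0.
  apply: key; rewrite -[RHS](uM _ _ t1 t2) -[X in _ = X + _]mul1r -{1}uu.
  rewrite det4E /dot /bilin /mulv !big_ord4 !row4E !mxE !big_ord4 !(antisymE Ma).
  by case: (sign_cases o2) => ->; ring.
by split=> //; case: (sign_cases o2) h1 h2 h3 => ->; lra.
Qed.

End BeltramiAlgebra.

(** * The radial function and the polar chart *)

Section RadialFunction.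
Context {R : realType}.
Local Notation V := 'rV[R]_4.
Local Notation M4 := 'M[R]_4.

Lemma is_derive_of_line (W : normedModType R) (f : V -> W) x v (d : W) :
  is_derive (0 : R) (1 : R) (fun s : R => f (x + s *: v)) d -> is_derive x v f d.
Proof.
have E : (fun h : R => h^-1 *: (f (x + (h *: 1 + 0) *: v) - f (x + 0 *: v))) =
         (fun h => h^-1 *: (f (h *: v + x) - f x)).
  rewrite funeqE => h; rewrite scale0r !addr0; congr (_ *: (f _ - _)).
  by rewrite [h *: 1]mulr1 addrC.
by move=> [d1 d2]; split; move: d1 d2; rewrite /derivable /derive/= E.
Qed.

Lemma is_derive_pair (W1 W2 : normedModType R) (f1 : V -> W1) (f2 : V -> W2) x v d1 d2 :
  is_derive x v f1 d1 -> is_derive x v f2 d2 ->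
  'D_v (fun y => (f1 y, f2 y)) x = (d1, d2).
Proof.
move=> [c1 <-] [c2 <-]; apply: cvg_lim => //=.
have h1 : (fun h => h^-1 *: (f1 (h *: v + x) - f1 x)) @ 0^' --> 'D_v f1 x by exact: c1.
have h2 : (fun h => h^-1 *: (f2 (h *: v + x) - f2 x)) @ 0^' --> 'D_v f2 x by exact: c2.
exact: (cvg_pair h1 h2).
Qed.

Definition rho (y : V) : R := Num.sqrt (dot y y).

Definition punctured : set V := [set y | 0 < rho y].

Lemma Cinf_dot D : open D -> Cinf D (fun y : V => dot y y).
Proof.
move=> Dop k; apply: (Ck_sum Dop) => i.
by apply: (CkM Dop); exact: Ck_coord.
Qed.

Lemma rho_continuous y : {for y, continuous rho}.
Proof.
apply: continuous_comp; last exact: sqrt_continuous.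
exact: (Ck_continuous (Cinf_dot openT 0) I).
Qed.

Lemma punctured_open : open punctured.
Proof.
apply: (@open_comp V R rho [set r | 0 < r]); last exact: open_gt.
by move=> y _; exact: rho_continuous.
Qed.

Lemma dot_ge0 (y : V) : 0 <= dot y y.
Proof. by apply: sumr_ge0 => i _; rewrite -expr2 sqr_ge0. Qed.

Lemma rho_sqr y : rho y ^+ 2 = dot y y.
Proof. by rewrite sqr_sqrtr// dot_ge0. Qed.

Lemma dotZ (a c : R) (v w : V) : dot (a *: v) (c *: w) = a * c * dot v w.
Proof. by rewrite mulr_sumr; apply: eq_bigr => i _; rewrite !mxE; ring. Qed.

Lemma rhoZ t y : 0 <= t -> rho (t *: y) = t * rho y.
Proof.
by move=> t0; rewrite /rho dotZ -expr2 sqrtrM ?sqr_ge0// sqrtr_sqr ger0_norm.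
Qed.

Lemma partial_dot i y : partial i (fun y : V => dot y y) y = 2 * y 0 i.
Proof.
have c1 (j : 'I_4) := Ck_coord 1 (setT : set V) j.
have yT : (setT : set V) y by [].
rewrite (partial_sum i (fun j => CkM openT (c1 j) (c1 j)) yT).
rewrite -(sum_delta (fun j => 2 * y 0 j) i); apply: eq_bigr => j _.
by rewrite (partialM i (c1 j) (c1 j) yT) partial_coord [i == j]eq_sym; ring.
Qed.

Lemma is_derive_rho i y : punctured y -> is_derive y 'e_i rho (y 0 i / rho y).
Proof.
move=> ry; have r0 : 0 < rho y := ry.
have dy : 0 < dot y y by rewrite -rho_sqr exprn_gt0.
have ye : y + (0 : R) *: 'e_i = y by rewrite scale0r addr0.
apply: is_derive_of_line.
have d1 : is_derive (dot (y + (0 : R) *: 'e_i) (y + (0 : R) *: 'e_i)) 1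
    Num.sqrt (2 * rho y)^-1.
  by rewrite ye; exact: is_derive1_sqrt.
have d2 := is_derive_line (Ck_derivable (Cinf_dot openT 1) I :
  derivable (fun y : V => dot y y) (y + (0 : R) *: 'e_i) 'e_i).
apply: (is_derive_eq (is_derive1_comp d1 d2)).
rewrite ye -[X in _ * X]/(partial i (fun y : V => dot y y) y) partial_dot.
by field; rewrite gt_eqF.
Qed.

Lemma partial_rho i y : punctured y -> partial i rho y = y 0 i / rho y.
Proof. by move=> /(is_derive_rho i)[_]. Qed.

Lemma Cinf_rho : Cinf punctured rho.
Proof.
elim=> [|k IH]; first by split=> // y _; exact: rho_continuous.
split=> [y _|]; first exact: rho_continuous.
split=> [y i /(is_derive_rho i)[]//|i].
have r0 y : punctured y -> rho y != 0 by move=> py; rewrite gt_eqF.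
have h := CkM punctured_open (Ck_coord k punctured i) (CkV punctured_open r0 IH).
by apply: (Ck_eq punctured_open _ h) => y; rewrite inE => py; rewrite partial_rho.
Qed.

Lemma Cinf_rhoV : Cinf punctured (fun y => (rho y)^-1).
Proof.
move=> k; apply: (CkV punctured_open _ (Cinf_rho k)) => y py.
by rewrite gt_eqF.
Qed.

Lemma partial_rhoV i y : punctured y ->
  partial i (fun y => (rho y)^-1) y = - ((rho y)^-1 ^+ 3 * y 0 i).
Proof.
move=> py; have r0 : rho y != 0 by rewrite gt_eqF.
rewrite (partialV i (Cinf_rho 1) py r0) partial_rho//.
by field.
Qed.

Lemma partial_polar i y : punctured y -> partial i polar y =
  (y 0 i / rho y, \row_j ((rho y)^-1 * (i == j)%:R - (rho y)^-1 ^+ 3 * y 0 i * y 0 j)).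
Proof.
move=> py; apply: (is_derive_pair (is_derive_rho i py)).
have c1 j : Ck 1 punctured (fun y => (rho y)^-1 * y 0 j).
  exact: (CkM punctured_open (Cinf_rhoV 1) (Ck_coord 1 _ j)).
have fE j : (fun y : V => ((rho y)^-1 *: y) 0 j) = (fun y => (rho y)^-1 * y 0 j).
  by rewrite funeqE => z; rewrite mxE.
have fd : derivable (fun y : V => (rho y)^-1 *: y) y 'e_i.
  apply/derivable_mxP => k j; rewrite ord1 fE.
  exact: (Ck_derivable (c1 j) py).
split=> //; rewrite derive_mx//; apply/matrixP => k j; rewrite ord1 !mxE fE.
rewrite -[LHS]/(partial i (fun y => (rho y)^-1 * y 0 j) y).
rewrite (partialM i (Cinf_rhoV 1) (Ck_coord 1 _ j) py) partial_rhoV// partial_coord.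
by ring.
Qed.

End RadialFunction.

(* Partial derivatives enter only as numbers from here on, not as limits. *)
#[local] Opaque partial.

(** * Unique continuation for harmonic functions *)

Section Harmonic.
Context {R : realType} {n : nat}.
Local Notation V := 'rV[R]_n.
Implicit Types (D : set V) (f g : V -> R) (p x y v : V).

Lemma near0_lt (e : R) : 0 < e -> \forall t \near (0 : R), `|t| < e.
Proof. exact: (@nbhs0_lt R R^o). Qed.

Lemma near_forall (P : 'I_n -> R -> Prop) :
  (forall j, \forall t \near (0 : R), P j t) ->
  \forall t \near (0 : R), forall j, P j t.
Proof.
move=> nP; have h := @filter_forall R 'I_n P (nbhs (0 : R)) _ nP.
exact: h.
Qed.

Lemma first_difference f x v (e : R) : derivable f x v -> 0 < e ->
  \forall t \near (0 : R), `|f (x + t *: v) - f x - t * 'D_v f x| <= e * `|t|.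
Proof.
move=> fd e0.
have : (fun h => h^-1 *: (f (h *: v + x) - f x)) @ 0^' --> 'D_v f x by exact: fd.
move=> /cvgrPdist_le/(_ _ e0); rewrite near_withinE.
apply: filterS => t; have [->|t0 /(_ isT)] := eqVneq t 0.
  by rewrite scale0r addr0 subrr mul0r subr0 normr0 mulr0.
rewrite [t *: v + x]addrC => h.
rewrite (_ : _ - _ - _ = t * (t^-1 * (f (x + t *: v) - f x) - 'D_v f x)); last first.
  by rewrite mulrBr mulVKf.
by rewrite normrM mulrC ler_wpM2r// distrC.
Qed.

Lemma derive_oppv D k f x v : open D -> Ck k.+1 D f -> D x ->
  'D_(- v) f x = - 'D_v f x.
Proof.
move=> Dop fk Dx; rewrite !(derive_sum_partial _ Dop fk Dx) -sumrN.
by apply: eq_bigr => i _; rewrite mxE mulNr.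
Qed.

(** Second order Taylor expansion, symmetrised to be free of first order terms. *)
Lemma second_difference D f x i (e : R) : open D -> Ck 2 D f -> D x -> 0 < e ->
  \forall t \near (0 : R),
    `|f (x + t *: 'e_i) + f (x - t *: 'e_i) - 2 * f x
      - t ^+ 2 * partial i (partial i f) x| <= e * t ^+ 2.
Proof.
move=> Dop f2 Dx e0.
set L := partial i (partial i f) x.
have e2 : 0 < e / 2 by rewrite divr_gt0.
have fdx : derivable (partial i f) x 'e_i.
  exact: (Ck_derivable (Ck_partial i f2)).
have n1 := first_difference fdx e2.
have nD : \forall t \near (0 : R), D (x + t *: 'e_i).
  have : (fun t : R => x + t *: 'e_i) @ (0 : R) --> x.
    rewrite -[X in _ --> X]addr0 -(scale0r 'e_i).
    by apply: cvgD; [exact: cvg_cst|exact: scalel_continuous].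
  apply. exact: open_nbhs_nbhs.
have /nbhs_ballP[d /= d0 dP] : \forall t \near (0:R), D (x + t *: 'e_i) /\
    `|partial i f (x + t *: 'e_i) - partial i f x - t * L| <= e / 2 * `|t|.
  by apply: filterS2 nD n1 => t h1 h2; split.
apply/nbhs_ballP; exists d => //= t; rewrite -ball_normE/= sub0r normrN => td.
have dP' s : `|s| <= `|t| -> D (x + s *: 'e_i) /\
    `|partial i f (x + s *: 'e_i) - partial i f x - s * L| <= e / 2 * `|s|.
  move=> st; apply: dP; rewrite -ball_normE/= sub0r normrN.
  exact: le_lt_trans td.
pose G (s : R) := f (x + s *: 'e_i) + f (x + s *: - 'e_i) - s ^+ 2 * L.
pose dG (s : R) := partial i f (x + s *: 'e_i) - partial i f (x + (- s) *: 'e_i) - (2 * s) * L.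
have Gd s : `|s| <= `|t| -> is_derive s (1 : R) G (dG s).
  move=> st.
  have [Ds _] := dP' s st; have [|DNs _] := dP' (- s); first by rewrite normrN.
  have DNs' : D (x + s *: - 'e_i) by rewrite scalerN -scaleNr.
  have d1 := is_derive_line (Ck_derivable f2 Ds : derivable f _ 'e_i).
  have [d2' d2e] := Ck_is_derive (- 'e_i) Dop f2 DNs'.
  have d2 := is_derive_line d2'.
  rewrite (derive_oppv _ Dop f2 DNs') in d2.
  have d3 : is_derive s (1 : R) (fun u : R => u ^+ 2 * L) (2 * s * L).
    have dss := is_deriveM (is_derive_id s (1 : R)) (is_derive_id s (1 : R)).
    apply: (is_derive_eq (is_deriveM dss (is_derive_cst L s (1 : R)))).
    rewrite scaler0 add0r /GRing.scale/= mulr1 /cst; ring.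
  apply: (is_derive_eq (is_deriveB (is_deriveD d1 d2) d3)).
  by rewrite /dG scaleNr scalerN.
have [c ct e1] := MVT_from0 Gd.
have [_ hc] := dP' c ct; have [|_ hNc] := dP' (- c); first by rewrite normrN.
move: e1; rewrite /G scalerN !scale0r addr0 expr0n/= mul0r subr0 => e1.
rewrite (_ : _ - _ - _ = t * dG c); last by rewrite -e1; ring.
have -> : dG c = (partial i f (x + c *: 'e_i) - partial i f x - c * L)
    - (partial i f (x + - c *: 'e_i) - partial i f x - - c * L).
  by rewrite /dG; ring.
rewrite normrM -(real_normK (num_real t)) expr2 mulrCA ler_wpM2l//.
apply: le_trans (ler_normB _ _) _; apply: le_trans (lerD hc hNc) _.
rewrite normrN -mulrDl -splitr ler_wpM2l// ltW//.
Qed.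

Definition laplacian f x : R := \sum_(i < n) partial i (partial i f) x.

Definition flip (i : 'I_n) y : V := y - (2 * y 0 i) *: 'e_i.

Lemma flipE i y j : flip i y 0 j = if j == i then - y 0 i else y 0 j.
Proof.
rewrite !mxE eqxx/=; case: eqP => [->|_]; last by rewrite mulr0 subr0.
by rewrite mulr1; ring.
Qed.

Lemma flip_norm i y : `|flip i y| <= `|y|.
Proof.
apply: norm_le_coord => // j; rewrite flipE; case: eqP => _; last first.
  exact: coord_le_norm.
by rewrite normrN coord_le_norm.
Qed.

Lemma flipD i y z : flip i (y + z) = flip i y + flip i z.
Proof.
by apply/rowP => j; rewrite [RHS]mxE !flipE !mxE; case: eqP => // _; rewrite opprD.
Qed.

Lemma flip_axis i j (t : R) :
  flip i (t *: 'e_j) = (if j == i then - t else t) *: 'e_j.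
Proof.
apply/rowP => k; rewrite flipE !mxE !eqxx/= [i == j]eq_sym.
case: (eqVneq j i) => [->|ji]; last first.
  by rewrite mulr0 oppr0; case: eqP => // ->; rewrite eq_sym (negbTE ji) mulr0.
by case: eqP => _; rewrite ?mulr1 ?mulr0.
Qed.

(** A superharmonic majorant on the half box 0 <= y_i, |y_j| <= d: its Laplacian is
    - 2 M / d^2, it is nonnegative on y_i = 0 and at least [M] on the other faces. *)
Definition barrier (i : 'I_n) (d M : R) y : R :=
  M / d ^+ 2 * (\sum_j y 0 j ^+ 2 - n.+1%:R * y 0 i ^+ 2 + n.+1%:R * d * y 0 i).

Lemma barrier_second_difference i d M y j (t : R) :
  barrier i d M (y + t *: 'e_j) + barrier i d M (y - t *: 'e_j)
    - 2 * barrier i d M y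
  = M / d ^+ 2 * (2 * t ^+ 2 * (1 - n.+1%:R * (i == j)%:R)).
Proof.
have S u : \sum_k (y + u *: 'e_j) 0 k ^+ 2
    = \sum_k y 0 k ^+ 2 + 2 * u * y 0 j + u ^+ 2.
  rewrite [LHS](bigD1 j)//= [in RHS](bigD1 j)//= !mxE !eqxx/= mulr1.
  rewrite (eq_bigr (fun k => y 0 k ^+ 2)); first by ring.
  by move=> k kj; rewrite !mxE (negbTE kj) andbF mulr0 addr0.
rewrite (_ : y - _ = y + (- t) *: 'e_j); last by rewrite scaleNr.
rewrite /barrier !S !mxE eqxx/=.
by case: eqP => [->|_]; rewrite ?mulr1 ?mulr0; ring.
Qed.

Lemma sum_barrier_second_difference i d M y (t : R) :
  \sum_j (barrier i d M (y + t *: 'e_j) + barrier i d M (y - t *: 'e_j)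
    - 2 * barrier i d M y) = - (2 * (M / d ^+ 2) * t ^+ 2).
Proof.
under eq_bigr do rewrite barrier_second_difference.
have S1 : \sum_(j < n) ((i == j)%:R : R) = 1.
  by rewrite (bigD1 i)//= eqxx big1 ?addr0// => j; rewrite eq_sym => /negbTE ->.
rewrite -!mulr_sumr sumrB -[X in _ - X]mulr_sumr S1.
by rewrite sumr_const card_ord -natr1; ring.
Qed.

(** The interior gradient estimate, by comparison.  The part of [f] that is odd under
    reflection in y_i = 0 is harmonic, vanishes on the hyperplane and is at most [M] on
    the box, so it stays below the barrier on the half box; dividing by y_i bounds the
    derivative at the centre. *)
Lemma gradient_bound D f p (d M : R) i : open D -> Ck 2 D f ->
  (forall x, D x -> laplacian f x = 0) -> 0 < d -> 0 < M ->
  (forall y, `|y| <= d -> D (p + y) /\ `|f (p + y)| <= M) ->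
  `|partial i f p| <= n.+1%:R * M / d.
Proof.
move=> Dop f2 f0 d0 M0 fM.
have d20 : 0 < d ^+ 2 by rewrite exprn_gt0.
pose K : set V := [set y : V | `|y| <= d /\ 0 <= y 0 i].
have Kc : compact K.
  apply: bounded_closed_compact.
    by exists d; split; [exact: num_real|move=> a da y [yd _]; exact: le_trans (ltW da)].
  apply: closedI.
    apply: (@preimage_closed V R (fun y : V => `|y|) _ _ (@closed_le R d)).
    by move=> y _; exact: (@norm_continuous R (V : normedModType R)).
  apply: (@preimage_closed V R (fun y : V => y 0 i) _ _ (@closed_ge R 0)).
  by move=> y _; exact: coord_continuous.
have K0 : K !=set0.
  by exists 0; rewrite /K/=; split; [rewrite normr0 ltW|rewrite mxE].
(* The sign [s] gives the bound for the odd part and for its opposite at once. *)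
have main (s : R) : s ^+ 2 = 1 -> forall y, K y ->
    s * ((f (p + y) - f (p + flip i y)) / 2) <= barrier i d M y.
  move=> s1.
  have sN : `|s| = 1.
    by move/eqP: s1; rewrite sqrf_eq1 => /orP[]/eqP->; rewrite ?normrN normr1.
  pose u y := s * ((f (p + y) - f (p + flip i y)) / 2) - barrier i d M y.
  have uc : {within K, continuous u}.
    apply: continuous_in_subspaceT => y; rewrite inE => -[yd _].
    have [Dy _] := fM _ yd; have [Dy' _] := fM _ (le_trans (flip_norm i y) yd).
    have cc j : {for y, continuous (fun y : V => y 0 j)} by exact: coord_continuous.
    have c1 : {for y, continuous (fun y => f (p + y))}.
      apply: continuous_comp; last exact: (Ck_continuous f2).
      by apply: continuousD; [exact: cst_continuous|move=> ?].
    have c2 : {for y, continuous (fun y => f (p + flip i y))}.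
      apply: continuous_comp; last exact: (Ck_continuous f2).
      apply: continuousD; first exact: cst_continuous.
      apply: continuousB; first by move=> ?.
      apply: continuousZ; last exact: cst_continuous.
      by apply: continuousM; [exact: cst_continuous|exact: cc].
    have c3 : {for y, continuous (barrier i d M)}.
      apply: continuousM; first exact: cst_continuous.
      apply: continuousD; last by apply: continuousM; [exact: cst_continuous|exact: cc].
      apply: continuousB; last first.
        by apply: continuousM; [exact: cst_continuous|apply: continuousM; exact: cc].
      by apply: continuous_sumr => j; apply: continuousM; exact: cc.
    apply: continuousB c3; apply: continuousM; first exact: cst_continuous.
    by apply: continuousM; [exact: continuousB|exact: cst_continuous].
  have [c /[!inE] cK cmax] := EVT_max_rV K0 Kc uc.
  suff uc0 : u c <= 0.
    move=> y Ky; rewrite -subr_le0; apply: le_trans uc0.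
    by apply: cmax; rewrite inE.
  have [cd ci0] := cK.
  have cid : c 0 i <= d by apply: le_trans (ler_norm _) (le_trans (coord_le_norm _ _) cd).
  have half : s * ((f (p + c) - f (p + flip i c)) / 2) <= M.
    apply: le_trans (ler_norm _) _; rewrite normrM sN mul1r normrM.
    rewrite [`|2^-1|]gtr0_norm// ler_pdivrMr//.
    apply: le_trans (ler_normB _ _) _; rewrite mulr_natr mulr2n lerD//.
      by have [] := fM _ cd.
    by have [] := fM _ (le_trans (flip_norm i c) cd).
  have Sge j : c 0 j ^+ 2 <= \sum_j c 0 j ^+ 2.
    by rewrite (bigD1 j)//= lerDl sumr_ge0// => k _; exact: sqr_ge0.
  have [ciE|ci_neq0] := eqVneq (c 0 i) 0.
    rewrite /u (_ : flip i c = c); last first.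
      by apply/rowP => j; rewrite flipE; case: eqP => // ->; rewrite ciE oppr0.
    rewrite subrr mul0r mulr0 sub0r oppr_le0 /barrier ciE expr0n/= !mulr0 subr0 addr0.
    by rewrite mulr_ge0 ?divr_ge0 ?(ltW M0) ?(ltW d20)// sumr_ge0// => k _; exact: sqr_ge0.
  have ci : 0 < c 0 i by rewrite lt_neqAle eq_sym ci_neq0.
  have bM : d ^+ 2 <= \sum_j c 0 j ^+ 2 - n.+1%:R * c 0 i ^+ 2 + n.+1%:R * d * c 0 i -> u c <= 0.
    move=> h; rewrite subr_le0; apply: le_trans half _.
    by rewrite /barrier mulrAC ler_pdivlMr// ler_pM2l.
  (* At an interior maximum of [u], the sum of its second differences is
     nonpositive; but the barrier contributes a positive amount to it, and the
     harmonic part only an error of higher order. *)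
  have [[j cj]|cint] := pselect (exists j, `|c 0 j| = d).
    apply: bM; apply: (@le_trans _ _ (\sum_j c 0 j ^+ 2)).
      by rewrite -cj (real_normK (num_real _)).
    rewrite -addrA lerDl (_ : _ + _ = n.+1%:R * c 0 i * (d - c 0 i)); last by ring.
    by rewrite !mulr_ge0// subr_ge0.
  have ltd j : `|c 0 j| < d.
    rewrite lt_neqAle (le_trans (coord_le_norm _ _) cd) andbT.
    by apply/eqP => e; apply: cint; exists j.
  exfalso.
  pose e := M / d ^+ 2 / n.+1%:R.
  have e0 : 0 < e by rewrite !divr_gt0.
  have Dpc : D (p + c) by have [] := fM _ cd.
  have Dpc' : D (p + flip i c) by have [] := fM _ (le_trans (flip_norm i c) cd).
  pose P (j : 'I_n) (t : R) := `|t| < d - `|c 0 j| /\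
      (`|f (p + c + t *: 'e_j) + f (p + c - t *: 'e_j) - 2 * f (p + c)
      - t ^+ 2 * partial j (partial j f) (p + c)| <= e * t ^+ 2 /\
      `|f (p + flip i c + t *: 'e_j) + f (p + flip i c - t *: 'e_j)
        - 2 * f (p + flip i c)
      - t ^+ 2 * partial j (partial j f) (p + flip i c)| <= e * t ^+ 2).
  have nP j : \forall t \near (0 : R), P j t.
    have n1 : \forall t \near (0 : R), `|t| < d - `|c 0 j|.
      by apply: near0_lt; rewrite subr_gt0.
    apply: filterS3 n1 (second_difference j Dop f2 Dpc e0)
      (second_difference j Dop f2 Dpc' e0) => t h1 h2 h3.
    by split.
  have nt : \forall t \near (0 : R), `|t| < c 0 i /\ forall j, P j t.
    have nP' : \forall t \near (0 : R), forall j, P j t.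
      exact: near_forall.
    by apply: filterS2 (near0_lt ci) nP' => t h1 h2; split.
  move/nbhs_ballP: nt => [r /= r0 /(_ (r / 2))].
  have t0 : 0 < r / 2 by rewrite divr_gt0.
  rewrite -ball_normE/= sub0r normrN gtr0_norm// ltr_pdivrMr// ltr_pMr// ltr1n.
  move=> /(_ isT); set t := r / 2; move=> [tci tP].
  have Kt j (a : R) : `|a| <= t -> K (c + a *: 'e_j).
    move=> at_; split.
      apply: norm_le_coord => [|k]; first exact: ltW.
      rewrite !mxE eqxx/=; apply: le_trans (ler_normD _ _) _.
      have [tk _] := tP k; rewrite -lerBrDl; apply: le_trans (ltW tk).
      apply: le_trans (le_trans at_ (ler_norm t)); rewrite normrM ler_piMr//.
      by case: eqP; rewrite ?normr1 ?normr0.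
    rewrite !mxE eqxx/= -lerBlDl sub0r lerNl.
    apply: (@le_trans _ _ t); last exact: ltW.
    apply: le_trans at_; apply: le_trans (ler_norm _) _.
    by rewrite normrN normrM ler_piMr//; case: eqP; rewrite ?normr1 ?normr0.
  pose a j := f (p + c + t *: 'e_j) + f (p + c - t *: 'e_j) - 2 * f (p + c).
  pose b j := f (p + flip i c + t *: 'e_j) + f (p + flip i c - t *: 'e_j)
        - 2 * f (p + flip i c).
  have uj j : s * ((a j - b j) / 2) - (barrier i d M (c + t *: 'e_j)
      + barrier i d M (c - t *: 'e_j) - 2 * barrier i d M c) <= 0.
    have h1 : u (c + t *: 'e_j) <= u c.
      by apply: cmax; rewrite inE; apply: Kt; rewrite gtr0_norm.
    have h2 : u (c - t *: 'e_j) <= u c.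
      by apply: cmax; rewrite inE -scaleNr; apply: Kt; rewrite normrN gtr0_norm.
    have fl : f (p + flip i (c + t *: 'e_j)) + f (p + flip i (c - t *: 'e_j)) =
        f (p + flip i c + t *: 'e_j) + f (p + flip i c - t *: 'e_j).
      rewrite -scaleNr !flipD !flip_axis !addrA; case: eqP => _ //.
      by rewrite opprK [LHS]addrC.
    rewrite (_ : _ - _ = (u (c + t *: 'e_j) - u c) + (u (c - t *: 'e_j) - u c)).
      rewrite -subr_le0 in h1; rewrite -subr_le0 in h2.
      by apply: le_trans (lerD h1 h2) _; rewrite addr0.
    rewrite /u /a /b -fl !addrA; ring.
  have sumle (g : 'I_n -> R) x : D x -> (forall j,
      `|g j - t ^+ 2 * partial j (partial j f) x| <= e * t ^+ 2) ->
      `|\sum_j g j| <= n%:R * (e * t ^+ 2).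
    move=> Dx gP; rewrite (_ : \sum_j g j = \sum_j (g j - t ^+ 2 * partial j (partial j f) x)).
      apply: le_trans (ler_norm_sum _ _ _) _.
      apply: le_trans (ler_sum _ (fun j _ => gP j)) _.
      by rewrite sumr_const card_ord mulr_natl.
    by rewrite sumrB -mulr_sumr -/(laplacian f x) f0// mulr0 subr0.
  have Sa := sumle a _ Dpc (fun j => (tP j).2.1).
  have Sb := sumle b _ Dpc' (fun j => (tP j).2.2).
  have : \sum_j (s * ((a j - b j) / 2) - (barrier i d M (c + t *: 'e_j)
      + barrier i d M (c - t *: 'e_j) - 2 * barrier i d M c)) <= 0.
    by rewrite -oppr_ge0 -sumrN sumr_ge0// => j _; rewrite oppr_ge0.
  rewrite sumrB sum_barrier_second_difference opprK -mulr_sumr -mulr_suml sumrB.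
  apply/negP; rewrite -ltNge.
  set A := \sum_j a j; set B := \sum_j b j.
  have : `|s * ((A - B) / 2)| <= n%:R * (e * t ^+ 2).
    rewrite normrM sN mul1r normrM [`|2^-1|]gtr0_norm// ler_pdivrMr//.
    by apply: le_trans (ler_normB _ _) _; rewrite mulr_natr mulr2n lerD.
  rewrite ler_norml => /andP[h _].
  rewrite -subr_gt0 subr0; apply: lt_le_trans (lerD h (lexx _)).
  rewrite addrC subr_gt0 /e -natr1.
  have t20 : 0 < t ^+ 2 by rewrite exprn_gt0.
  set q := M / d ^+ 2; have q0 : 0 < q by rewrite divr_gt0.
  rewrite mulrA ltr_pM2r// mulrA ltr_pdivrMr ?ltr_wpDl//.
  by have := ler0n R n; nra.
set B := _ / d.
have odd_bound t : 0 < t -> t <= d ->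
    `|f (p + t *: 'e_i) - f (p + - t *: 'e_i)| <= 2 * (B * t).
  move=> t0 td.
  have tnorm : `|t *: 'e_i : V| <= d.
    apply: norm_le_coord => [|k]; first exact: ltW.
    rewrite !mxE eqxx/= normrM gtr0_norm//; apply: le_trans td.
    by rewrite ler_piMr ?(ltW t0)//; case: eqP; rewrite ?normr1 ?normr0.
  have Kt : K (t *: 'e_i).
    by split=> //; rewrite !mxE !eqxx/= mulr1 ltW.
  have bB : barrier i d M (t *: 'e_i) <= B * t.
    rewrite /barrier !mxE !eqxx/= mulr1 (bigD1 i)//= big1 ?addr0; last first.
      by move=> k ki; rewrite !mxE (negbTE ki) andbF mulr0 expr0n.
    rewrite !mxE !eqxx/= mulr1.
    apply: (@le_trans _ _ (B * t - M / d ^+ 2 * (n%:R * t ^+ 2))).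
      by rewrite le_eqVlt /B -natr1; apply/orP; left; apply/eqP; field; rewrite gt_eqF.
    by rewrite gerBl !mulr_ge0// ?ltW// ?invr_gt0// exprn_gt0.
  have := main 1 (expr1n _ _) _ Kt; have := main (- 1) _ _ Kt.
  rewrite sqrrN expr1n flip_axis eqxx => /(_ erefl) h1 h2.
  rewrite ler_norml; apply/andP; split; lra.
apply/ler_addgt0Pl => e e0.
have [Dp _] : D (p + 0) /\ `|f (p + 0)| <= M by apply: fM; rewrite normr0 ltW.
rewrite addr0 in Dp.
have /nbhs_ballP[r /= r0 rP] := first_difference (Ck_derivable f2 Dp : derivable f p 'e_i) e0.
pose t := Num.min (r / 2) d.
have t0 : 0 < t by rewrite lt_min d0 divr_gt0.
have td : t <= d by rewrite ge_min lexx orbT.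
have tr : `|t| < r.
  by rewrite gtr0_norm// gt_min ltr_pdivrMr// ltr_pMr// ltr1n.
have h1 : `|f (p + t *: 'e_i) - f p - t * partial i f p| <= e * `|t|.
  by apply: rP; rewrite -ball_normE/= sub0r normrN.
have h2 : `|f (p + - t *: 'e_i) - f p - (- t) * partial i f p| <= e * `|- t|.
  by apply: rP; rewrite -ball_normE/= sub0r opprK.
have h3 := odd_bound t t0 td.
rewrite normrN (gtr0_norm t0) in h2; rewrite (gtr0_norm t0) in h1.
move: h1 h2 h3; set a := f (p + _); set b := f (p + _); set L := partial i f p.
rewrite !ler_norml => /andP[a1 a2] /andP[b1 b2] /andP[c1 c2].
apply/andP; split; rewrite -(ler_pM2l t0); lra.
Qed.

Lemma laplacian_partial D f i : open D -> Cinf D f ->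
  (forall x, D x -> laplacian f x = 0) ->
  forall x, D x -> laplacian (partial i f) x = 0.
Proof.
move=> Dop fi f0 x Dx.
have e3 j : partial j (partial j (partial i f)) x = partial i (partial j (partial j f)) x.
  have eji : {in D, partial j (partial i f) =1 partial i (partial j f)}.
    by move=> y; rewrite inE => Dy; exact: (partialC _ _ Dop (fi 2) Dy).
  apply: (etrans (partial_eq _ Dop eji (mem_set Dx))).
  exact: (partialC _ _ Dop (Ck_partial j (fi 3)) Dx).
have fjj j : Ck 1 D (partial j (partial j f)).
  exact: (Ck_partial j (Ck_partial j (fi 3))).
have e2 := @partial_sum R n D n (fun j => partial j (partial j f)) i x 0 fjj Dx.
transitivity (\sum_(j < n) partial i (partial j (partial j f)) x).
  by apply: eq_bigr => j _; exact: e3.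
rewrite -e2.
have z : {in D, laplacian f =1 cst 0} by move=> y; rewrite inE => /f0.
by apply: (etrans (partial_eq i Dop z (mem_set Dx))); exact: derive_cst.
Qed.

Lemma Cinf_foldr D f s : Cinf D f -> Cinf D (foldr partial f s).
Proof.
move=> fi; elim: s => [|i s IH] //= k.
by apply: Ck_partial; exact: IH.
Qed.

Lemma laplacian_foldr D f s : open D -> Cinf D f ->
  (forall x, D x -> laplacian f x = 0) ->
  forall x, D x -> laplacian (foldr partial f s) x = 0.
Proof.
move=> Dop fi f0; elim: s => [|i s IH]; first exact: f0.
exact: (laplacian_partial i Dop (Cinf_foldr s fi) IH).
Qed.

(** Iterating the gradient estimate on boxes of half side r / k, for at most [k]
    derivatives: the shrinking boxes stay in the box of half side 2 r. *)
Lemma derivative_bound D f p (r M : R) k s y : open D -> Cinf D f ->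
  (forall x, D x -> laplacian f x = 0) -> 0 < r -> 0 < M ->
  (forall y, `|y| <= 2 * r -> D (p + y) /\ `|f (p + y)| <= M) ->
  (0 < k)%N -> (size s <= k)%N -> `|y| <= 2 * r - (size s)%:R * (r / k%:R) ->
  `|foldr partial f s (p + y)| <= (n.+1%:R * k%:R / r) ^+ size s * M.
Proof.
move=> Dop fi f0 r0 M0 fM k0.
have rk : 0 < r / k%:R by rewrite divr_gt0// ltr0n.
have C0 : 0 < n.+1%:R * k%:R / r by rewrite divr_gt0// mulr_gt0 ?ltr0n.
elim: s y => [|i s IH] y /=.
  by move=> _; rewrite mul0r subr0 expr0 mul1r => /fM[].
move=> sk yr.
have CM0 : 0 < (n.+1%:R * k%:R / r) ^+ size s * M by rewrite mulr_gt0 ?exprn_gt0.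
apply: le_trans
  (@gradient_bound D (foldr partial f s) (p + y) (r / k%:R) _ i Dop
    (Cinf_foldr s fi 2) (laplacian_foldr s Dop fi f0) rk CM0 _) _; last first.
  rewrite exprS le_eqVlt; apply/orP; left; apply/eqP.
  by field; rewrite gt_eqF// pnatr_eq0 -lt0n k0.
move=> z zr; rewrite -addrA.
have yz : `|y + z| <= 2 * r - (size s)%:R * (r / k%:R).
  apply: le_trans (ler_normD _ _) _; apply: le_trans (lerD yr zr) _.
  set q := r / _; have -> : (size s).+1%:R * q = (size s)%:R * q + q.
    by rewrite -natr1; ring.
  by rewrite opprD addrA subrK.
split; last exact: IH (ltnW sk) yz.
apply: (fM _ _).1; apply: le_trans yz _; rewrite gerBl mulr_ge0//.
exact: ltW.
Qed.

(** A bound by the integral of the bound on the derivative, by the mean value theorem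
    for the difference. *)
Lemma integral_power_bound (g dg : R -> R) (K : R) k :
  (forall s, `|s| <= 1 -> is_derive s (1 : R) g (dg s)) -> g 0 = 0 ->
  (forall s, 0 <= s -> s <= 1 -> `|dg s| <= K * s ^+ k) ->
  `|g 1| <= K / k.+1%:R.
Proof.
move=> gd g0 dgK.
have one_side (a : R) : `|a| = 1 -> a * g 1 <= K / k.+1%:R.
  move=> a1; pose G (s : R) := K / k.+1%:R * s ^+ k.+1 - a * g s.
  have Gd s : `|s| <= 1 -> is_derive s (1 : R) G (K * s ^+ k - a * dg s).
    move=> s1; apply: is_deriveB; last exact: (is_deriveZ a (gd s s1)).
    have h : is_derive s (1 : R) (fun s : R => s ^+ k.+1) (k.+1%:R * s ^+ k).
      split; first exact: exprn_derivable.
      by rewrite exp_derive /GRing.scale/= mulr1.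
    apply: (is_derive_eq (is_deriveZ (K / k.+1%:R) h)).
    by rewrite /GRing.scale/=; field.
  have [||c] := @MVT_segment R G (fun s => K * s ^+ k - a * dg s) 0 1 ler01.
  - move=> s; rewrite in_itv/= => /andP[s0 s1]; apply: Gd.
    by rewrite ger0_norm ltW.
  - apply: derivable_within_continuous => s; rewrite in_itv/= => /andP[s0 s1].
    by have [] := Gd s; rewrite ?ger0_norm.
  rewrite in_itv/= => /andP[c0 c1].
  rewrite /G expr1n mulr1 expr0n/= mulr0 g0 mulr0 subrr subr0 subr0 mulr1 => e.
  rewrite -subr_ge0 e subr_ge0; apply: le_trans (ler_norm _) _.
  by rewrite normrM a1 mul1r dgK.
rewrite ler_norml -lerN2 opprK; apply/andP; split.
  by have := one_side (- 1); rewrite mulN1r; apply; rewrite normrN normr1.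
by have := one_side 1; rewrite mul1r; apply; rewrite normr1.
Qed.

(** Taylor's formula at a point where all derivatives of order less than [k]
    vanish. *)
Lemma taylor_flat D f p (d C : R) k y : open D -> Cinf D f -> 0 <= C ->
  (forall y, `|y| <= d -> D (p + y)) ->
  (forall s, (size s < k)%N -> foldr partial f s p = 0) ->
  (forall s y, size s = k -> `|y| <= d -> `|foldr partial f s (p + y)| <= C) ->
  `|y| <= d -> `|f (p + y)| <= C * (n%:R * `|y|) ^+ k / k`!%:R.
Proof.
move=> Dop + C0 pD; elim: k f y => [|k IH] f y fi fz fC yd.
  by rewrite expr0 fact0 divr1 mulr1; exact: (fC [::]).
have fp : f p = 0 by exact: (fz [::]).
have dfC i t : `|t| <= d ->
    `|partial i f (p + t)| <= C * (n%:R * `|t|) ^+ k / k`!%:R.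
  move=> td; apply: IH => // [l|s sk|s z sk zd]; first exact: Ck_partial (fi l.+1).
    by rewrite -foldr_rcons; apply: fz; rewrite size_rcons.
  by rewrite -foldr_rcons; apply: fC => //; rewrite size_rcons sk.
pose g (t : R) := f (p + t *: y).
pose dg (t : R) := \sum_(j < n) y 0 j * partial j f (p + t *: y).
have tyd t : `|t| <= 1 -> `|t *: y| <= d.
  by move=> t1; rewrite normrZ (le_trans _ yd)// ler_piMl.
have gd t : `|t| <= 1 -> is_derive t (1 : R) g (dg t).
  move=> /tyd/pD Dt; have [fd fdE] := Ck_is_derive y Dop (fi 1) Dt.
  by rewrite /dg -fdE; exact: is_derive_line.
have g0 : g 0 = 0 by rewrite /g scale0r addr0.
have := @integral_power_bound g dg (C * (n%:R * `|y|) ^+ k.+1 / k`!%:R) k gd g0.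
rewrite /g scale1r => h.
apply: le_trans (h _) _.
  move=> t t0 t1; apply: le_trans (ler_norm_sum _ _ _) _.
  have tt : `|t| <= 1 by rewrite ger0_norm.
  apply: (@le_trans _ _ (\sum_(j < n) `|y| * (C * (n%:R * (t * `|y|)) ^+ k / k`!%:R))).
    apply: ler_sum => j _; rewrite normrM ler_pM// ?coord_le_norm//.
    by have := dfC j _ (tyd _ tt); rewrite normrZ (ger0_norm t0).
  rewrite sumr_const card_ord -mulr_natl le_eqVlt; apply/orP; left; apply/eqP.
  by rewrite exprS !exprMn; ring.
rewrite factS natrM invfM le_eqVlt; apply/orP; left; apply/eqP; ring.
Qed.

End Harmonic.

Section UniqueContinuation.
Context {R : realType} {n : nat}.
Local Notation V := 'rV[R]_n.
Implicit Types (D : set V) (f g : V -> R) (p x y v : V).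

(** A weak form of Stirling's formula. *)
Lemma expn_le_expR_fact k : k%:R ^+ k <= expR 1 ^+ k * k`!%:R :> R.
Proof.
elim: k => [|k IH]; first by rewrite !expr0 mul1r fact0.
have h : k.+1%:R ^+ k <= expR 1 * k%:R ^+ k :> R.
  case: k {IH} => [|k]; first by rewrite !expr0 mulr1 -expR0 ler_expR.
  rewrite -ler_pdivrMr ?exprn_gt0// -expr_div_n.
  have -> : expR 1 = expR (k.+1%:R^-1) ^+ k.+1 :> R.
    by rewrite -expRM_natl mulfV.
  apply: lerXn2r; rewrite ?nnegrE ?divr_ge0 ?expR_ge0//.
  by rewrite -natr1 mulrDl mul1r divff// expR_ge1Dx.
rewrite exprS factS natrM exprS.
rewrite (_ : _ * (_ * _) = k.+1%:R * (expR 1 * (expR 1 ^+ k * k`!%:R))); last by ring.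
by rewrite ler_pM2l//; apply: le_trans h _; rewrite ler_pM2l ?expR_gt0.
Qed.

Lemma le_halfX_eq0 (a : R) : 0 <= a -> (forall k, (0 < k)%N -> a <= 2^-1 ^+ k) -> a = 0.
Proof.
move=> a0 ak; apply/eqP; rewrite eq_le a0 andbT leNgt; apply/negP => ap.
have ia : 0 <= a^-1 by rewrite invr_ge0.
have := archi_boundP ia; set k := Num.bound _ => ka.
have := ak k.+1 erefl; apply/negP; rewrite -ltNge.
rewrite exprVn invf_plt ?posrE ?exprn_gt0//; apply: lt_trans ka _.
by rewrite -natrX ltr_nat (ltn_trans (ltnSn _))// ltn_expl.
Qed.

(** Harmonic functions are analytic, quantitatively: the derivatives of order [k] are
    bounded by (C k)^k, and Taylor's formula with k^k <= e^k k! bounds [f] by 2^-k near a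
    point of infinite order of vanishing. *)
Lemma harmonic_flat_near0 D f p : open D -> Cinf D f ->
  (forall x, D x -> laplacian f x = 0) -> D p ->
  (forall s, foldr partial f s p = 0) ->
  \forall x \near p, f x = 0.
Proof.
move=> Dop fi f0 Dp fflat.
have fp : f p = 0 := fflat [::].
have nD : \forall x \near p, D x by exact: open_nbhs_nbhs.
have n1 : \forall x \near p, `|f x| <= 1.
  have c : {for p, continuous f} by exact: (Ck_continuous (fi 0)).
  have /cvgrPdist_le/(_ 1 ltr01) := c.
  by apply: filterS => x; rewrite fp sub0r normrN.
have nD1 : \forall x \near p, D x /\ `|f x| <= 1.
  by apply: filterS2 nD n1 => x h1 h2; split.
move: nD1 => /nbhs_ballP[r0 /= r00 r0P].
pose r := r0 / 4; have r_gt0 : 0 < r by rewrite divr_gt0.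
have rP y : `|y| <= 2 * r -> D (p + y) /\ `|f (p + y)| <= 1.
  move=> yr; apply: r0P; rewrite -ball_normE/= opprD addNKr normrN.
  by apply: le_lt_trans yr _; rewrite /r; lra.
(* The ratio for which the Taylor remainder of order [k] is at most 2^-k. *)
pose c : R := 2 * expR 1 * n.+1%:R ^+ 2.
have c0 : 0 < c by rewrite !mulr_gt0 ?expR_gt0.
have c1 : 1 <= c.
  have e1 : 1 <= expR 1 :> R by rewrite -[leLHS]expR0 ler_expR.
  have n1' : 1 <= n.+1%:R ^+ 2 :> R by rewrite -natrX ler1n expn_gt0.
  have -> : 1 = 1 * 1 * 1 :> R by rewrite !mulr1.
  by rewrite /c ler_pM// ler_pM// ler1n.
pose d := r / c.
have d0 : 0 < d by rewrite divr_gt0.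
have dr : d <= r by rewrite ler_pdivrMr// ler_peMr// ltW.
suff fd y : `|y| <= d -> f (p + y) = 0.
  apply/nbhs_ballP; exists d => //= x; rewrite -ball_normE/= => xd.
  by rewrite -(subrKC p x) fd// distrC ltW.
move=> yd; apply/eqP; rewrite -normr_eq0; apply/eqP.
apply: le_halfX_eq0 => // k k0.
have kr : 0 < k%:R :> R by rewrite ltr0n.
have C0 : 0 <= (n.+1%:R * k%:R / r) ^+ k * 1.
  by rewrite mulr1 exprn_ge0// divr_ge0// ?mulr_ge0// ltW.
have dD z : `|z| <= d -> D (p + z).
  by move=> zd; apply: (rP _ _).1; apply: le_trans zd (le_trans dr _); lra.
have bnd s z : size s = k -> `|z| <= d ->
    `|foldr partial f s (p + z)| <= (n.+1%:R * k%:R / r) ^+ k * 1.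
  move=> sk zd; rewrite -{2}sk.
  apply: (@derivative_bound _ _ D f p r 1 k s z) => //; first by rewrite sk.
  rewrite sk (_ : k%:R * _ = r); last by field; rewrite gt_eqF.
  apply: le_trans zd (le_trans dr _); lra.
have flat0 s : (size s < k)%N -> foldr partial f s p = 0 by move=> _; exact: fflat.
have := taylor_flat Dop fi C0 dD flat0 bnd yd.
move=> /le_trans; apply.
rewrite mulr1 ler_pdivrMr ?ltr0n ?fact_gt0//.
apply: (@le_trans _ _ ((n.+1%:R * k%:R / r) ^+ k * (n.+1%:R * d) ^+ k)).
  rewrite mulr1 in C0; apply: (ler_wpM2l C0).
  have ny : n%:R * `|y| <= n.+1%:R * d by rewrite ler_pM// ler_nat.
  have ny0 : 0 <= n%:R * `|y| by rewrite mulr_ge0.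
  by apply: lerXn2r; rewrite ?nnegrE// (le_trans ny0).
rewrite -exprMn (_ : _ * _ = 2^-1 * (k%:R / expR 1)); last first.
  by rewrite /d /c; field; rewrite !gt_eqF ?expR_gt0.
rewrite exprMn ler_pM2l ?exprn_gt0 ?invr_gt0//.
rewrite expr_div_n ler_pdivrMr ?exprn_gt0 ?expR_gt0// mulrC.
exact: expn_le_expR_fact.
Qed.

End UniqueContinuation.

(** * Curvature in an orthonormal frame *)

Section MatrixCalculus.
Context {R : realType} {n : nat}.
Local Notation V := 'rV[R]_n.
Implicit Types (D : set V) (x : V).

Definition dmx {p q} (i : 'I_n) (M : V -> 'M[R]_(p, q)) (x : V) : 'M[R]_(p, q) :=
  \matrix_(a, b) partial i (fun y => M y a b) x.

Definition Mck {p q} k D (M : V -> 'M[R]_(p, q)) :=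
  forall a b, Ck k D (fun y => M y a b).

Lemma dmx_eq p q D i (A B : V -> 'M[R]_(p, q)) x : open D -> {in D, A =1 B} ->
  D x -> dmx i A x = dmx i B x.
Proof.
move=> Dop AB Dx; apply/matrixP => a b; rewrite !mxE.
have ab : {in D, (fun y => A y a b) =1 (fun y => B y a b)} by move=> y /AB ->.
exact: (partial_eq i Dop ab (mem_set Dx)).
Qed.

Lemma dmxT p q i (A : V -> 'M[R]_(p, q)) x :
  dmx i (fun y => (A y)^T) x = (dmx i A x)^T.
Proof.
apply/matrixP => a b; rewrite !mxE; congr (partial i _ x).
by rewrite funeqE => y; rewrite mxE.
Qed.

Lemma dmxD p q D i (A B : V -> 'M[R]_(p, q)) x : Mck 1 D A -> Mck 1 D B -> D x ->
  dmx i (fun y => A y + B y) x = dmx i A x + dmx i B x.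
Proof.
move=> A1 B1 Dx; apply/matrixP => a b; rewrite !mxE.
rewrite -(partialD i (A1 a b) (B1 a b) Dx); congr (partial i _ x).
by rewrite funeqE => y; rewrite mxE.
Qed.

Lemma dmxM p q r D i (A : V -> 'M[R]_(p, q)) (B : V -> 'M[R]_(q, r)) x :
  open D -> Mck 1 D A -> Mck 1 D B -> D x ->
  dmx i (fun y => A y *m B y) x = dmx i A x *m B x + A x *m dmx i B x.
Proof.
move=> Dop A1 B1 Dx; apply/matrixP => a b; rewrite !mxE -big_split/=.
have ABc c : Ck 1 D (fun y => A y a c * B y c b) by exact: (CkM Dop (A1 a c) (B1 c b)).
transitivity (partial i (fun y => \sum_(c < q) A y a c * B y c b) x).
  by congr (partial i _ x); rewrite funeqE => y; rewrite mxE.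
apply: (etrans (partial_sum i ABc Dx)); apply: eq_bigr => c _; rewrite !mxE.
exact: (partialM i (A1 a c) (B1 c b) Dx).
Qed.

Lemma MckM p q r k D (A : V -> 'M[R]_(p, q)) (B : V -> 'M[R]_(q, r)) :
  open D -> Mck k D A -> Mck k D B -> Mck k D (fun y => A y *m B y).
Proof.
move=> Dop A1 B1 a b.
rewrite (_ : (fun _ => _) = (fun y => \sum_(c < q) A y a c * B y c b)); last first.
  by rewrite funeqE => y; rewrite mxE.
by apply: Ck_sum => // c; exact: (CkM Dop (A1 a c) (B1 c b)).
Qed.

Lemma MckD p q k D (A B : V -> 'M[R]_(p, q)) : open D -> Mck k D A -> Mck k D B ->
  Mck k D (fun y => A y + B y).
Proof.
move=> Dop A1 B1 a b; rewrite (_ : (fun _ => _) = (fun y => A y a b + B y a b)).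
  exact: (CkD Dop (A1 a b) (B1 a b)).
by rewrite funeqE => y; rewrite mxE.
Qed.

Lemma MckT p q k D (A : V -> 'M[R]_(p, q)) : Mck k D A -> Mck k D (fun y => (A y)^T).
Proof.
move=> A1 a b; rewrite (_ : (fun _ => _) = (fun y => A y b a)); first exact: A1.
by rewrite funeqE => y; rewrite mxE.
Qed.

Lemma Mck_dmx p q k D i (A : V -> 'M[R]_(p, q)) : Mck k.+1 D A -> Mck k D (dmx i A).
Proof.
move=> A1 a b; rewrite (_ : (fun _ => _) = partial i (fun y => A y a b)).
  exact: (Ck_partial i (A1 a b)).
by rewrite funeqE => y; rewrite mxE.
Qed.

Lemma MckW p q k l D (A : V -> 'M[R]_(p, q)) : (k <= l)%N -> Mck l D A -> Mck k D A.
Proof. by move=> kl A1 a b; exact: (Ck_le kl (A1 a b)). Qed.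

Lemma dmxC p q D i j (A : V -> 'M[R]_(p, q)) x : open D -> Mck 2 D A -> D x ->
  dmx i (dmx j A) x = dmx j (dmx i A) x.
Proof.
move=> Dop A2 Dx; apply/matrixP => a b; rewrite [LHS]mxE [RHS]mxE.
rewrite (_ : (fun _ => _) = partial j (fun y => A y a b)); last first.
  by rewrite funeqE => y; rewrite mxE.
rewrite [in RHS](_ : (fun _ => _) = partial i (fun y => A y a b)); last first.
  by rewrite funeqE => y; rewrite mxE.
exact: (partialC i j Dop (A2 a b) Dx).
Qed.

End MatrixCalculus.

Section MovingFrame.
Context {R : realType} {n : nat}.
Local Notation V := 'rV[R]_n.
Variables (D : set V) (g E N : V -> 'M[R]_n) (w : 'I_n -> V -> 'M[R]_n).
Hypothesis Dop : open D.
Hypothesis gE : forall x, D x -> g x = (E x)^T *m E x.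
Hypothesis NE : forall x, D x -> N x *m E x = 1%:M.
Hypothesis E2 : Mck 2 D E.
Hypothesis N1 : Mck 1 D N.
Hypothesis w1 : forall i, Mck 1 D (w i).
Hypothesis wA : forall i x, D x -> (w i x)^T = - w i x.
(* The first structure equation de + w /\ e = 0 for the coframe with matrix [E]. *)
Hypothesis torsion_free : forall i k a x, D x ->
  (w i x *m E x + dmx i E x) a k = (w k x *m E x + dmx k E x) a i.

(** The second structure equation dw + w /\ w. *)
Definition frame_curvature i j x : 'M[R]_n :=
  dmx i (w j) x - dmx j (w i) x + (w i x *m w j x - w j x *m w i x).

(* The connection matrices in coordinates. *)
Variable Gam : 'I_n -> V -> 'M[R]_n.
Hypothesis GamE : forall i x, Gam i x = N x *m (w i x *m E x + dmx i E x).

Let EN x : D x -> E x *m N x = 1%:M.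
Proof. by move=> /NE /mulmx1C. Qed.

Let EGam i x : D x -> E x *m Gam i x = w i x *m E x + dmx i E x.
Proof. by move=> /EN e; rewrite GamE mulmxA e mul1mx. Qed.

Lemma metric_unit x : D x -> g x \in unitmx.
Proof.
move=> Dx; rewrite gE// unitmx_mul unitmx_tr.
by have /mulmx1_unit[_ ->] := NE Dx.
Qed.

Let gGam i x : D x -> g x *m Gam i x = (E x)^T *m (w i x *m E x + dmx i E x).
Proof. by move=> Dx; rewrite gE// -mulmxA EGam. Qed.

Let dg i x : D x -> dmx i g x = (g x *m Gam i x)^T + g x *m Gam i x.
Proof.
move=> Dx; rewrite gGam//.
have e : {in D, g =1 (fun y => (E y)^T *m E y)} by move=> y; rewrite inE; exact: gE.
have E1 := MckW (leqnSn 1) E2.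
rewrite (dmx_eq i Dop e Dx) (dmxM i Dop (MckT E1) E1 Dx) dmxT.
rewrite mulmxDr [X in _ = X + _]raddfD/= !trmx_mul trmxK wA//.
by rewrite mulmxN mulNmx !mulmxA addrACA addNr add0r.
Qed.

Let Gam_sym i k l x : D x -> (g x *m Gam i x) l k = (g x *m Gam k x) l i.
Proof.
move=> Dx; rewrite (gGam i Dx) (gGam k Dx) [LHS]mxE [RHS]mxE.
by apply: eq_bigr => a _; congr (_ * _); exact: torsion_free.
Qed.

(** The connection with matrices E^-1 (w E + dE) is symmetric and preserves the metric,
    so it is the Levi-Civita connection: its entries are recovered from the derivatives
    of the metric by the usual cyclic permutation. *)
Lemma christoffel_frame l i k x : D x -> christoffel g l i k x = Gam i x l k.
Proof.
move=> Dx; rewrite /christoffel.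
rewrite -[in RHS](mulKmx (metric_unit Dx) (Gam i x)) mxE mulr_sumr.
apply: eq_bigr => m _.
have dgE a b c : partial a (fun y => g y b c) x =
    (g x *m Gam a x) c b + (g x *m Gam a x) b c.
  by have /matrixP/(_ b c) := dg a Dx; rewrite mxE => ->; rewrite mxE [in LHS]mxE.
have [H HE] : exists H : 'I_n -> 'I_n -> 'I_n -> R,
    forall a b c, (g x *m Gam a x) b c = H a b c.
  by exists (fun a => (g x *m Gam a x)).
have HS a b c : H a b c = H c b a by rewrite -!HE; exact: Gam_sym.
rewrite (dgE i k m) (dgE k i m) (dgE m i k) !HE.
by rewrite (HS k m i) (HS m k i) (HS m i k); field.
Qed.

Lemma curvature_frame_aux l k i j x : D x ->
  curvature g l k i j x = (N x *m frame_curvature i j x *m E x) l k.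
Proof.
move=> Dx.
have E1 := MckW (leqnSn 1) E2.
have G1 m : Mck 1 D (Gam m).
  rewrite (_ : Gam m = fun y => N y *m (w m y *m E y + dmx m E y)); last first.
    by rewrite funeqE => y; exact: GamE.
  by apply: (MckM Dop N1); apply: (MckD Dop (MckM Dop (w1 m) E1)); exact: Mck_dmx.
pose K := dmx i (Gam j) x - dmx j (Gam i) x + (Gam i x *m Gam j x - Gam j x *m Gam i x).
have -> : curvature g l k i j x = K l k.
  have pc a b : partial a (christoffel g l b k) x = (dmx a (Gam b) x) l k.
    have e : {in D, christoffel g l b k =1 fun y => Gam b y l k}.
      by move=> y; rewrite inE => Dy; exact: christoffel_frame.
    by rewrite mxE; exact: (partial_eq a Dop e (mem_set Dx)).
  rewrite /curvature !pc /K !mxE; congr (_ + _).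
  rewrite sumrB; congr (_ - _); apply: eq_bigr => m _;
    by rewrite !christoffel_frame.
have dEGam a b : dmx a E x *m Gam b x + E x *m dmx a (Gam b) x =
    dmx a (w b) x *m E x + w b x *m dmx a E x + dmx a (dmx b E) x.
  have e : {in D, (fun y => E y *m Gam b y) =1 (fun y => w b y *m E y + dmx b E y)}.
    by move=> y; rewrite inE; exact: EGam.
  have := dmx_eq a Dop e Dx.
  rewrite (dmxM a Dop E1 (G1 b) Dx) => ->.
  rewrite (dmxD a (MckM Dop (w1 b) E1) (Mck_dmx b E2) Dx).
  by rewrite (dmxM a Dop (w1 b) E1 Dx).
have dE a : dmx a E x = E x *m Gam a x - w a x *m E x.
  by rewrite EGam// addrC addKr.
have EdGam a b : E x *m dmx a (Gam b) x = dmx a (w b) x *m E x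
    + w b x *m (E x *m Gam a x - w a x *m E x) + dmx a (dmx b E) x
    - (E x *m Gam a x - w a x *m E x) *m Gam b x.
  by rewrite -!dE -dEGam addrC addKr.
suff EK : E x *m K = frame_curvature i j x *m E x.
  by rewrite -mulmxA -EK mulmxA NE// mul1mx.
rewrite /K /frame_curvature mulmxDr mulmxBr !EdGam mulmxBr (dmxC j i Dop E2 Dx).
rewrite !mulmxBr !mulmxBl !mulmxDl !mulNmx !mulmxA.
move: (dmx i (w j) x *m E x) (w j x *m E x *m Gam i x) (w j x *m w i x *m E x)
  (dmx i (dmx j E) x) (E x *m Gam i x *m Gam j x) (w i x *m E x *m Gam j x)
  (dmx j (w i) x *m E x) (w i x *m w j x *m E x) (E x *m Gam j x *m Gam i x).
by move=> t1 t2 t3 t4 t5 t6 t7 t8 t9; apply/matrixP => a b; rewrite !mxE; ring.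
Qed.

End MovingFrame.

(** Curvature is gauge covariant, and the frame is a change of gauge for the
    Levi-Civita connection. *)
Lemma curvature_frame (R : realType) (n : nat) (D : set 'rV[R]_n)
    (g E N : 'rV[R]_n -> 'M[R]_n) (w : 'I_n -> 'rV[R]_n -> 'M[R]_n) :
  open D -> (forall x, D x -> g x = (E x)^T *m E x) ->
  (forall x, D x -> N x *m E x = 1%:M) ->
  Mck 2 D E -> Mck 1 D N -> (forall i, Mck 1 D (w i)) ->
  (forall i x, D x -> (w i x)^T = - w i x) ->
  (forall i k a x, D x ->
    (w i x *m E x + dmx i E x) a k = (w k x *m E x + dmx k E x) a i) ->
  forall l k i j x, D x ->
  curvature g l k i j x = (N x *m frame_curvature w i j x *m E x) l k.
Proof.
move=> Dop gE NE E2 N1 w1 wA tf l k i j x Dx.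
exact: (curvature_frame_aux Dop gE NE E2 N1 w1 wA tf (fun _ _ => erefl)).
Qed.

#[local] Opaque dmx.

(** * Structure equations of the cone metric *)

Section PointwiseStructure.
Context {R : realType}.
Local Notation V := 'rV[R]_4.
Local Notation M4 := 'M[R]_4.
Variables (x : V) (F : M4).
Hypothesis Fa : F^T = - F.

Let h := half_mulv x F.
Let E := frame x h.

Lemma frame_sum (T : 'I_4 -> R) i :
  \sum_(c < 4) E c i * T c = T i + h 0 i * \sum_(c < 4) x 0 c * T c.
Proof.
rewrite -{1}(sum_delta T i) mulr_sumr -big_split/=; apply: eq_bigr => c _.
by rewrite frameE; ring.
Qed.

Lemma x_half_mulv : \sum_(c < 4) x 0 c * h 0 c = 0.
Proof.
by rewrite -[RHS](dot_half_mulv x Fa); apply: eq_bigr => c _; rewrite mulrC.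
Qed.

Lemma frame_half_mulv i : \sum_(c < 4) E c i * h 0 c = h 0 i.
Proof. by rewrite frame_sum x_half_mulv mulr0 addr0. Qed.

Lemma frame_form i j :
  \sum_(c < 4) E c i * (\sum_(d < 4) E d j * F c d) = F i j.
Proof.
have col a : \sum_(d < 4) E d j * F a d = F a j + 2 * h 0 j * h 0 a.
  rewrite frame_sum (eq_bigr (fun c => F a c * x 0 c)); last first.
    by move=> c _; rewrite mulrC.
  by rewrite -/(mulv F x a) mulv_half; ring.
rewrite (eq_bigr (fun c => E c i * F c j + 2 * h 0 j * (E c i * h 0 c))); last first.
  by move=> c _; rewrite col; ring.
rewrite big_split/= -mulr_sumr frame_half_mulv frame_sum mulv_left// mulv_half.
by rewrite -/h; ring.
Qed.

(** First structure equation [de^a + w^a_b e^b = 0] for the coframe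
    [e^a = dx^a + x_a beta], [beta = h_i dx^i], [dbeta = F]. *)
Lemma torsion_pointwise (dh : M4) a i k : (forall i j, dh i j - dh j i = F i j) ->
  \sum_(b < 4) (\sum_(c < 4) E c i * conn x F c a b) * E b k
    + ((a == i)%:R * h 0 k + x 0 a * dh i k) =
  \sum_(b < 4) (\sum_(c < 4) E c k * conn x F c a b) * E b i
    + ((a == k)%:R * h 0 i + x 0 a * dh k i).
Proof.
move=> dhF; apply/eqP; rewrite -subr_eq0; apply/eqP.
have -> : \sum_(b < 4) (\sum_(c < 4) E c k * conn x F c a b) * E b i =
    \sum_(b < 4) (\sum_(c < 4) E c i * conn x F b a c) * E b k.
  transitivity (\sum_(b < 4) \sum_(c < 4) E c k * conn x F c a b * E b i).
    by apply: eq_bigr => b _; rewrite mulr_suml.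
  rewrite exchange_big/=; apply: eq_bigr => c _; rewrite mulr_suml.
  by apply: eq_bigr => b _; ring.
have -> : \sum_(b < 4) (\sum_(c < 4) E c i * conn x F c a b) * E b k =
    \sum_(b < 4) (\sum_(c < 4) E c i * conn x F b a c) * E b k
    + (h 0 i * E a k - h 0 k * E a i + x 0 a * F k i).
  rewrite -(frame_form k i) -{1}(frame_half_mulv i) -(frame_half_mulv k).
  rewrite -(sum_delta (fun b => E b k) a) -(sum_delta (fun c => E c i) a).
  transitivity (\sum_(b < 4) (\sum_(c < 4) E c i * conn x F b a c) * E b k
    + \sum_(b < 4) E b k * (\sum_(c < 4) E c i * (h 0 c * (b == a)%:R
      - h 0 b * (c == a)%:R + x 0 a * F b c))).
    rewrite -big_split/=; apply: eq_bigr => b _; rewrite !mulr_sumr !mulr_suml -big_split/=.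
    apply: eq_bigr => c _; rewrite !conn_entry -/h (antisymN b c Fa).
    by rewrite [c == b]eq_sym [a == c]eq_sym [a == b]eq_sym; field.
  congr (_ + _).
  rewrite (eq_bigr (fun b => (\sum_(c < 4) E c i * h 0 c) * (E b k * (b == a)%:R)
    - (\sum_(c < 4) E c i * (c == a)%:R) * (E b k * h 0 b)
    + x 0 a * (E b k * (\sum_(c < 4) E c i * F b c)))).
    by rewrite !(sumrB, big_split)/= -!mulr_sumr; ring.
  move=> b _; rewrite !mulr_suml !mulr_sumr -!(sumrB, big_split)/=.
  by apply: eq_bigr => c _; ring.
rewrite !frameE -/h -(dhF k i).
by ring.
Qed.

Variable dF : 'I_4 -> M4.
Hypothesis dFa : forall k, (dF k)^T = - dF k.
Hypothesis euler : forall a b, \sum_(k < 4) x 0 k * dF k a b = - 4 * F a b.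

(** [conn] is homogeneous of degree -3 along the cone. *)
Lemma euler_dconn d a b :
  \sum_(c < 4) x 0 c * dconn x F dF c d a b = - 3 * conn x F d a b.
Proof.
have em u : \sum_(c < 4) x 0 c * mulv (dF c) x u = - 4 * mulv F x u.
  rewrite /mulv mulr_sumr.
  rewrite (eq_bigr (fun c => \sum_(e < 4) x 0 c * dF c u e * x 0 e)).
    by rewrite exchange_big/=; apply: eq_bigr => e _; rewrite -mulr_suml euler; ring.
  by move=> c _; rewrite mulr_sumr; apply: eq_bigr => e _; ring.
have e1 u : \sum_(c < 4) x 0 c * (c == u)%:R = x 0 u by exact: (sum_delta (fun c => x 0 c)).
have e2 u : \sum_(c < 4) x 0 c * F u c = mulv F x u.
  by apply: eq_bigr => c _; rewrite mulrC.
rewrite (eq_bigr (fun c => 2^-1 * ((x 0 c * F a c) * (b == d)%:R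
    - (x 0 c * F b c) * (a == d)%:R + x 0 c * (c == a)%:R * F b d
    - x 0 c * (c == b)%:R * F a d - F a b * (x 0 c * (c == d)%:R)
  + ((x 0 c * mulv (dF c) x a) * (b == d)%:R - (x 0 c * mulv (dF c) x b) * (a == d)%:R
    + x 0 a * (x 0 c * dF c b d) - x 0 b * (x 0 c * dF c a d)
    - (x 0 c * dF c a b) * x 0 d)))); last first.
  move=> c _; rewrite !mxE !mulv_basis !eqxx /=.
  by rewrite [a == c]eq_sym [b == c]eq_sym [d == c]eq_sym; ring.
rewrite -mulr_sumr !(sumrB, big_split)/= -!mulr_suml -!mulr_sumr.
by rewrite !e1 !e2 !em !euler mxE; ring.
Qed.

Lemma comb_entry (P Q U S Z : M4) (e p q r t : R) a b :
  (e *: (P - Q + t *: (p *: U - q *: S) - r *: Z)) a b =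
  e * (P a b - Q a b + t * (p * U a b - q * S a b) - r * Z a b).
Proof. by rewrite !mxE. Qed.

Lemma comb2_entry (P Q : M4) (p q : R) a b :
  (p *: P + q *: Q) a b = p * P a b + q * Q a b.
Proof. by rewrite !mxE. Qed.

(** Second structure equation: the curvature of [w_i = sum_c E_ci conn c], in
    terms of its frame components. *)
Lemma curvature_pointwise (dh : M4) i j : (forall i j, dh i j - dh j i = F i j) ->
  \sum_(c < 4) (((c == i)%:R * h 0 j + x 0 c * dh i j) *: conn x F c
     + E c j *: dconn x F dF i c)
  - \sum_(c < 4) (((c == j)%:R * h 0 i + x 0 c * dh j i) *: conn x F c
     + E c i *: dconn x F dF j c)
  + ((\sum_(c < 4) E c i *: conn x F c) *m (\sum_(c < 4) E c j *: conn x F c)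
     - (\sum_(c < 4) E c j *: conn x F c) *m (\sum_(c < 4) E c i *: conn x F c))
  = \sum_(c < 4) \sum_(d < 4) (E c i * E d j) *: frame_riem x F dF c d.
Proof.
move=> dhF.
have comm : (\sum_(c < 4) E c i *: conn x F c) *m (\sum_(c < 4) E c j *: conn x F c)
     - (\sum_(c < 4) E c j *: conn x F c) *m (\sum_(c < 4) E c i *: conn x F c) =
  \sum_(c < 4) \sum_(d < 4) (E c i * E d j) *:
    (conn x F c *m conn x F d - conn x F d *m conn x F c).
  rewrite !mulmx_suml [X in _ - X](eq_bigr (fun c => \sum_(d < 4)
      (E c j *: conn x F c) *m (E d i *: conn x F d))); last first.
    by move=> c _; rewrite mulmx_sumr.
  rewrite [X in _ - X]exchange_big/= -sumrB; apply: eq_bigr => c _.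
  rewrite mulmx_sumr -sumrB; apply: eq_bigr => d _.
  by rewrite -!scalemxAl -!scalemxAr !scalerA scalerBr [E d j * _]mulrC.
rewrite comm [RHS](eq_bigr (fun c => \sum_(d < 4) (E c i * E d j) *: (dconn x F dF c d
    - dconn x F dF d c + 2 *: (h 0 c *: conn x F d - h 0 d *: conn x F c)
    - (2^-1 * dot x x * F c d) *: F) + \sum_(d < 4) (E c i * E d j) *:
    (conn x F c *m conn x F d - conn x F d *m conn x F c))); last first.
  by move=> c _; rewrite -big_split/=; apply: eq_bigr => d _; rewrite -scalerDr.
rewrite [RHS]big_split; congr (_ + _).
apply/matrixP => a b.
pose W c := conn x F c a b; pose G k c := dconn x F dF k c a b.
pose w k := \sum_(c < 4) E c k * W c.
have xW : \sum_(c < 4) x 0 c * W c = - (2^-1 * dot x x * F a b) by exact: sum_index_x.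
have xG d : \sum_(c < 4) x 0 c * G c d = - 3 * W d by exact: euler_dconn.
have rhs : (\sum_(c < 4) \sum_(d < 4) (E c i * E d j) *: (dconn x F dF c d
    - dconn x F dF d c + 2 *: (h 0 c *: conn x F d - h 0 d *: conn x F c)
    - (2^-1 * dot x x * F c d) *: F)) a b =
  \sum_(d < 4) E d j * G i d - \sum_(c < 4) E c i * G j c
  - h 0 i * w j + h 0 j * w i - 2^-1 * dot x x * F i j * F a b.
  have s1 : \sum_(d < 4) E d j * (\sum_(c < 4) E c i * G c d) =
      \sum_(d < 4) E d j * G i d - 3 * h 0 i * w j.
    rewrite mulr_sumr -sumrB; apply: eq_bigr => d _.
    by rewrite (frame_sum (fun c => G c d)) xG; ring.
  have s2 : \sum_(c < 4) E c i * (\sum_(d < 4) E d j * G d c) =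
      \sum_(c < 4) E c i * G j c - 3 * h 0 j * w i.
    rewrite mulr_sumr -sumrB; apply: eq_bigr => c _.
    by rewrite (frame_sum (fun d => G d c)) xG; ring.
  transitivity (\sum_(d < 4) E d j * (\sum_(c < 4) E c i * G c d)
    - \sum_(c < 4) E c i * (\sum_(d < 4) E d j * G d c)
    + 2 * ((\sum_(c < 4) E c i * h 0 c) * w j - (\sum_(d < 4) E d j * h 0 d) * w i)
    - 2^-1 * dot x x * (\sum_(c < 4) E c i * (\sum_(d < 4) E d j * F c d)) * F a b).
    have -> : \sum_(d < 4) E d j * (\sum_(c < 4) E c i * G c d) =
        \sum_(c < 4) E c i * (\sum_(d < 4) E d j * G c d).
      transitivity (\sum_(d < 4) \sum_(c < 4) E c i * (E d j * G c d)).
        by apply: eq_bigr => d _; rewrite mulr_sumr; apply: eq_bigr => c _; ring.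
      by rewrite exchange_big/=; apply: eq_bigr => c _; rewrite mulr_sumr.
    rewrite [(\sum_(d < 4) E d j * h 0 d) * w i]mulrC /w.
    move: (2^-1 * dot x x) => q.
    rewrite !mulr_suml mulr_sumr mulr_suml -!sumrB mulr_sumr -big_split -sumrB summxE.
    apply: eq_bigr => c _; rewrite summxE /=.
    rewrite !mulr_sumr mulr_suml -!sumrB mulr_sumr -big_split -sumrB /=.
    by apply: eq_bigr => d _; rewrite comb_entry /W /G; ring.
  by rewrite s1 s2 !frame_half_mulv frame_form; ring.
rewrite rhs mxE [X in _ + X]mxE !summxE.
rewrite (eq_bigr (fun c => h 0 j * (W c * (c == i)%:R) + dh i j * (x 0 c * W c)
    + E c j * G i c)); last first.
  by move=> c _; rewrite comb2_entry /W /G; ring.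
rewrite [X in _ - X](eq_bigr (fun c => h 0 i * (W c * (c == j)%:R) + dh j i * (x 0 c * W c)
    + E c i * G j c)); last first.
  by move=> c _; rewrite comb2_entry /W /G; ring.
rewrite !big_split/= -!mulr_sumr !sum_delta xW /w !frame_sum xW -(dhF i j).
by ring.
Qed.

End PointwiseStructure.

Section ConeGeometry.
Context {R : realType}.
Local Notation V := 'rV[R]_4.
Local Notation M4 := 'M[R]_4.

Lemma dmx_sumZ (D : set V) i (s : 'I_4 -> V -> R) (M : 'I_4 -> V -> M4) x :
  open D -> (forall c, Ck 1 D (s c)) -> (forall c, Mck 1 D (M c)) -> D x ->
  dmx i (fun y => \sum_(c < 4) s c y *: M c y) x =
  \sum_(c < 4) (partial i (s c) x *: M c x + s c x *: dmx i (M c) x).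
Proof.
move=> Dop s1 M1 Dx; apply/matrixP => a b; rewrite [LHS]mxE summxE.
have f1 c : Ck 1 D (fun y => s c y * M c y a b) by exact: (CkM Dop (s1 c) (M1 c a b)).
transitivity (partial i (fun y => \sum_(c < 4) s c y * M c y a b) x).
  congr (partial i _ x); rewrite funeqE => y; rewrite summxE.
  by apply: eq_bigr => c _; rewrite mxE.
rewrite (partial_sum i f1 Dx); apply: eq_bigr => c _.
by rewrite (partialM i (s1 c) (M1 c a b) Dx) [in RHS]comb2_entry [dmx _ _ _ _ _]mxE.
Qed.

Lemma Mck_sumZ k (D : set V) (s : 'I_4 -> V -> R) (M : 'I_4 -> V -> M4) :
  open D -> (forall c, Ck k D (s c)) -> (forall c, Mck k D (M c)) ->
  Mck k D (fun y => \sum_(c < 4) s c y *: M c y).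
Proof.
move=> Dop s1 M1 a b.
rewrite (_ : (fun _ => _) = (fun y => \sum_(c < 4) s c y * M c y a b)); last first.
  rewrite funeqE => y; rewrite summxE.
  by apply: eq_bigr => c _; rewrite mxE.
by apply: (Ck_sum Dop) => c; exact: (CkM Dop (s1 c) (M1 c a b)).
Qed.

Variables (D : set V) (b : V -> V).
Hypothesis Dop : open D.
Hypothesis bsmooth : forall i, Cinf D (fun y => b y 0 i).

Definition ext_form (y : V) : M4 := \matrix_(i, j)
  (partial i (fun z => b z 0 j) y - partial j (fun z => b z 0 i) y).
Local Notation F := ext_form.

Lemma ext_form_antisym y : (F y)^T = - F y.
Proof. by apply: antisymP => i j; rewrite !mxE opprB. Qed.

Lemma Cinf_ext_form i j : Cinf D (fun y => F y i j).
Proof.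
move=> k; rewrite (_ : (fun _ => _) =
    (fun y => partial i (fun z => b z 0 j) y - partial j (fun z => b z 0 i) y)).
  by apply: (CkB Dop); apply: Ck_partial; exact: bsmooth.
by rewrite funeqE => y; rewrite mxE.
Qed.

Lemma dmx_ext_form_antisym k y : D y -> (dmx k F y)^T = - dmx k F y.
Proof.
move=> Dy; apply: antisymP => i j; rewrite [LHS]mxE [X in _ = - X]mxE.
rewrite -mulN1r -(partialZ (-1) k (Cinf_ext_form i j 1) Dy).
congr (partial k _ y); rewrite funeqE => z.
by rewrite mulN1r (antisymN i j (ext_form_antisym z)).
Qed.

Lemma dmx_frame i y : D y ->
  dmx i (fun z => frame z (b z)) y =
  \matrix_(a, k) ((a == i)%:R * b y 0 k + y 0 a * partial i (fun z => b z 0 k) y).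
Proof.
move=> Dy; apply/matrixP => a k; rewrite [LHS]mxE [RHS]mxE.
have c1 := Ck_coord 1 D a.
have p1 := CkM Dop c1 (bsmooth k 1).
transitivity (partial i (fun z : V => cst (a == k)%:R z + z 0 a * b z 0 k) y).
  by congr (partial i _ y); rewrite funeqE => z; rewrite frameE.
rewrite (partialD i (Ck_cst 1 D _) p1 Dy) (partialM i c1 (bsmooth k 1) Dy).
rewrite partial_coord [i == a]eq_sym -[RHS]add0r; congr (_ + _).
exact: derive_cst.
Qed.

Lemma Mck_frame k : Mck k D (fun z => frame z (b z)).
Proof.
move=> a j; rewrite (_ : (fun _ => _) = (fun z : V => cst (a == j)%:R z + z 0 a * b z 0 j)).
  apply: (CkD Dop); first exact: Ck_cst.
  by apply: (CkM Dop); [exact: Ck_coord|exact: bsmooth].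
by rewrite funeqE => z; rewrite frameE.
Qed.

Lemma Mck_coframe k : Mck k D (fun z => coframe z (b z)).
Proof.
move=> a j; rewrite (_ : (fun _ => _) = (fun z : V => cst (a == j)%:R z - z 0 a * b z 0 j)).
  apply: (CkB Dop); first exact: Ck_cst.
  by apply: (CkM Dop); [exact: Ck_coord|exact: bsmooth].
by rewrite funeqE => z; rewrite coframeE.
Qed.

Let prod (e p q : 'I_4) (z : V) : R := z 0 e * F z p q.

Let prodk k e p q : Ck k D (prod e p q).
Proof. by apply: (CkM Dop); [exact: Ck_coord|exact: Cinf_ext_form]. Qed.

Let prodd i e p q y : D y -> partial i (prod e p q) y =
  (i == e)%:R * F y p q + y 0 e * dmx i F y p q.
Proof.
move=> Dy; rewrite (partialM i (Ck_coord 1 D e) (Cinf_ext_form p q 1) Dy).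
by rewrite partial_coord [dmx _ _ _ _ _]mxE.
Qed.

Let sumprod (p : 'I_4) (z : V) : R := \sum_(e < 4) prod e p e z.

Let conn_fun (c a j : 'I_4) (z : V) : R :=
  2^-1 * ((j == c)%:R * sumprod a z - (a == c)%:R * sumprod j z
  + prod a j c z - prod j a c z - prod c a j z).

Let sumprodk k p : Ck k D (sumprod p).
Proof. by apply: (Ck_sum Dop) => e; exact: prodk. Qed.

Let conn_funE c a j : (fun z => conn z (F z) c a j) = conn_fun c a j.
Proof.
rewrite funeqE => z; rewrite mxE /conn_fun /prod.
have sE p : sumprod p z = mulv (F z) z p by apply: eq_bigr => e _; rewrite mulrC.
by rewrite !sE; ring.
Qed.

Lemma Mck_conn k c : Mck k D (fun z => conn z (F z) c).
Proof.
move=> a j; rewrite conn_funE.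
apply: (CkZ _ Dop); apply: (CkB Dop); last exact: prodk.
apply: (CkB Dop); last exact: prodk.
apply: (CkD Dop); last exact: prodk.
by apply: (CkB Dop); apply: (CkZ _ Dop); exact: sumprodk.
Qed.

Lemma dmx_conn i c y : D y ->
  dmx i (fun z => conn z (F z) c) y = dconn y (F y) (fun k => dmx k F y) i c.
Proof.
move=> Dy; apply/matrixP => a j; rewrite [LHS]mxE conn_funE.
have s1 p := CkZ (p : R) Dop (sumprodk 1 _).
have h1 := CkB Dop (CkZ (j == c)%:R Dop (sumprodk 1 a)) (CkZ (a == c)%:R Dop (sumprodk 1 j)).
have h2 := CkD Dop h1 (prodk 1 a j c).
have h3 := CkB Dop h2 (prodk 1 j a c).
have h4 := CkB Dop h3 (prodk 1 c a j).
rewrite (partialZ _ i h4 Dy) (partialB i Dop h3 (prodk 1 c a j) Dy).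
rewrite (partialB i Dop h2 (prodk 1 j a c) Dy) (partialD i h1 (prodk 1 a j c) Dy).
rewrite (partialB i Dop (CkZ (j == c)%:R Dop (sumprodk 1 a)) (CkZ (a == c)%:R Dop (sumprodk 1 j)) Dy).
rewrite (partialZ _ i (sumprodk 1 a) Dy) (partialZ _ i (sumprodk 1 j) Dy).
have sd p : partial i (sumprod p) y = F y p i + mulv (dmx i F y) y p.
  rewrite (partial_sum i (fun e => prodk 1 e p e) Dy).
  rewrite -(sum_delta (fun e => F y p e) i) -big_split/=; apply: eq_bigr => e _.
  by rewrite prodd// [i == e]eq_sym; ring.
rewrite !sd !prodd// /dconn [RHS]mxE [in RHS]mxE [X in _ = _ + X]mxE.
rewrite !mulv_basis; move: (dmx i F y) => dFi.
rewrite ![(delta_mx _ _) _ _]mxE !eqxx /= [a == i]eq_sym [j == i]eq_sym [c == i]eq_sym.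
by ring.
Qed.

End ConeGeometry.

Section ConeCurvature.
Context {R : realType}.
Local Notation V := 'rV[R]_4.
Local Notation M4 := 'M[R]_4.
Variables (D : set V) (b : V -> V) (g : V -> M4).
Local Notation F := (ext_form b).
Hypothesis Dop : open D.
Hypothesis bsmooth : forall i, Cinf D (fun y => b y 0 i).
Hypothesis Fb : forall y, D y -> half_mulv y (F y) = b y.
Hypothesis eulerF : forall y a c, D y ->
  \sum_(k < 4) y 0 k * dmx k F y a c = - 4 * F y a c.
Hypothesis gE : forall y, D y -> g y = (frame y (b y))^T *m frame y (b y).

(** The connection matrices of the coframe, evaluated on coordinate vector fields. *)
Definition cone_conn (i : 'I_4) (y : V) : M4 :=
  \sum_(c < 4) frame y (b y) c i *: conn y (F y) c.
Local Notation w := cone_conn.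

Let dh (y : V) : M4 := \matrix_(i, j) partial i (fun z => b z 0 j) y.

Let dhF y i j : dh y i j - dh y j i = F y i j.
Proof. by rewrite !mxE. Qed.

Let dfr i y a k : D y -> dmx i (fun z => frame z (b z)) y a k =
  (a == i)%:R * b y 0 k + y 0 a * dh y i k.
Proof. by move=> Dy; rewrite (dmx_frame Dop bsmooth i Dy) mxE [dh _ _ _]mxE. Qed.

Lemma dot_cone y : D y -> dot y (b y) = 0.
Proof.
move=> Dy; rewrite dotC -[RHS](dot_half_mulv y (ext_form_antisym b y)).
by rewrite Fb.
Qed.

Lemma Mck_cone_conn k i : Mck k D (w i).
Proof.
apply: (Mck_sumZ Dop) => c; last exact: Mck_conn.
exact: (Mck_frame Dop bsmooth).
Qed.

Lemma cone_conn_entry i y a k :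
  w i y a k = \sum_(c < 4) frame y (b y) c i * conn y (F y) c a k.
Proof. by rewrite summxE; apply: eq_bigr => c _; rewrite mxE. Qed.

Lemma cone_conn_antisym i y : (w i y)^T = - w i y.
Proof.
apply: antisymP => p q; rewrite !cone_conn_entry -sumrN; apply: eq_bigr => c _.
by rewrite (antisymN p q (conn_antisym y c (ext_form_antisym b y))) mulrN.
Qed.

Lemma cone_torsion_free i k a y : D y ->
  (w i y *m frame y (b y) + dmx i (fun z => frame z (b z)) y) a k =
  (w k y *m frame y (b y) + dmx k (fun z => frame z (b z)) y) a i.
Proof.
move=> Dy; rewrite [LHS]mxE [RHS]mxE (dfr i a k Dy) (dfr k a i Dy).
have tp := @torsion_pointwise _ y _ (ext_form_antisym b y) (dh y) a i k (dhF y).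
rewrite Fb// in tp.
have me p q : (w p y *m frame y (b y)) a q = \sum_(j < 4)
    (\sum_(c < 4) frame y (b y) c p * conn y (F y) c a j) * frame y (b y) j q.
  by rewrite mxE; apply: eq_bigr => j _; rewrite cone_conn_entry.
by rewrite !me; exact: tp.
Qed.

Lemma cone_frame_curvature i j y : D y ->
  frame_curvature w i j y = \sum_(c < 4) \sum_(d < 4)
    (frame y (b y) c i * frame y (b y) d j) *:
      frame_riem y (F y) (fun k => dmx k F y) c d.
Proof.
move=> Dy.
have := @curvature_pointwise _ y _ (ext_form_antisym b y) (fun k => dmx k F y)
  (fun a c => eulerF a c Dy) (dh y) i j (dhF y).
rewrite Fb// => <-; rewrite /frame_curvature; congr (_ - _ + _).
all: rewrite (dmx_sumZ _ Dop _ _ Dy); try by move=> c; exact: (Mck_frame Dop bsmooth).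
all: try by move=> c; exact: (Mck_conn Dop bsmooth).
all: apply: eq_bigr => c _; rewrite (dmx_conn Dop bsmooth _ _ Dy).
all: by rewrite -(dfr _ _ _ Dy) [dmx _ _ _ _ _]mxE.
Qed.

Lemma cone_curvature l k i j y : D y -> curvature g l k i j y =
  (coframe y (b y) *m frame_curvature w i j y *m frame y (b y)) l k.
Proof.
move=> Dy.
have NE z : D z -> coframe z (b z) *m frame z (b z) = 1%:M.
  by move=> Dz; apply: coframeK; exact: dot_cone.
exact: (curvature_frame Dop gE NE (Mck_frame Dop bsmooth 2)
  (Mck_coframe Dop bsmooth 1) (Mck_cone_conn 1)
  (fun p z _ => cone_conn_antisym p z) cone_torsion_free).
Qed.

Lemma cone_riemann i j y : D y -> \matrix_(l, k) riemann g l k i j y =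
  (frame y (b y))^T *m frame_curvature w i j y *m frame y (b y).
Proof.
move=> Dy; apply/matrixP => l k; rewrite mxE /riemann.
transitivity ((g y *m (coframe y (b y) *m frame_curvature w i j y *m frame y (b y))) l k).
  by rewrite [RHS]mxE; apply: eq_bigr => m _; rewrite cone_curvature.
congr (fun_of_matrix _ _ _); rewrite gE// !mulmxA.
rewrite -[_ *m frame y (b y) *m coframe y (b y)]mulmxA.
by rewrite (mulmx1C (coframeK (dot_cone Dy))) mulmx1.
Qed.

(** The Ricci tensor in frame components. *)
Definition ricci_form y : M4 := ricci_lin y (fun k => dmx k F y) + ricci_quad y (F y).

Lemma cone_ricci y : D y ->
  ricci g y = (frame y (b y))^T *m ricci_form y *m frame y (b y).
Proof.
move=> Dy; apply/matrixP => j k; rewrite mxE.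
set E := frame y (b y); set N := coframe y (b y).
have EN : E *m N = 1%:M by exact: (mulmx1C (coframeK (dot_cone Dy))).
pose Rm := frame_riem y (F y) (fun k => dmx k F y).
transitivity (\sum_(d < 4) E d j * (\sum_(a < 4) (Rm a d *m E) a k)).
  transitivity (\sum_(i < 4) \sum_(c < 4) \sum_(d < 4) E c i * E d j *
      (\sum_(a < 4) N i a * (Rm c d *m E) a k)).
    apply: eq_bigr => i _; rewrite cone_curvature// cone_frame_curvature//.
    rewrite -/E -/N -mulmxA mulmx_suml mulmx_sumr summxE; apply: eq_bigr => c _.
    rewrite mulmx_suml mulmx_sumr summxE; apply: eq_bigr => d _.
    by rewrite -scalemxAl -scalemxAr mxE -/(Rm c d) [X in _ * X]mxE.
  rewrite exchange_big/=.
  transitivity (\sum_(c < 4) \sum_(d < 4) E d j * (\sum_(a < 4) (c == a)%:R * (Rm c d *m E) a k)).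
    apply: eq_bigr => c _; rewrite exchange_big/=; apply: eq_bigr => d _.
    rewrite mulr_sumr.
    transitivity (\sum_(i < 4) \sum_(a < 4) E d j * (E c i * N i a * (Rm c d *m E) a k)).
      by apply: eq_bigr => i _; rewrite mulr_sumr; apply: eq_bigr => a _; ring.
    rewrite exchange_big/=; apply: eq_bigr => a _.
    rewrite -mulr_sumr -mulr_suml; congr (_ * (_ * _)).
    by have /matrixP/(_ c a) := EN; rewrite !mxE.
  rewrite exchange_big/=; apply: eq_bigr => d _; rewrite -mulr_sumr; congr (_ * _).
  apply: eq_bigr => c _; rewrite (eq_bigr (fun a => (Rm c d *m E) a k * (a == c)%:R)).
    by rewrite (sum_delta (fun a => (Rm c d *m E) a k)).
  by move=> a _; rewrite mulrC eq_sym.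
rewrite -mulmxA mxE; apply: eq_bigr => d _; rewrite [E^T _ _]mxE; congr (_ * _).
rewrite [RHS]mxE (eq_bigr (fun a => \sum_(p < 4) Rm a d a p * E p k)); last first.
  by move=> a _; rewrite mxE.
rewrite exchange_big/=; apply: eq_bigr => p _; rewrite -mulr_suml; congr (_ * _).
have dFa q := dmx_ext_form_antisym Dop bsmooth q Dy.
rewrite (frame_ricci (ext_form_antisym b y) dFa (fun a c => eulerF a c Dy)).
by rewrite [RHS]mxE.
Qed.

Lemma dual_form_dmx (D' : set V) (M : V -> M4) o i y : open D' -> D' y ->
  Mck 1 D' M -> (forall z, D' z -> dual_form o (M z)) -> dual_form o (dmx i M y).
Proof.
move=> D'op D'y M1 Mo.
have rel (p q r s : 'I_4) (t : R) : (forall z, D' z -> M z p q = t * M z r s) ->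
    dmx i M y p q = t * dmx i M y r s.
  move=> e; rewrite [LHS]mxE [X in _ = _ * X]mxE -(partialZ t i (M1 r s) D'y).
  have e' : {in D', (fun z => M z p q) =1 (fun z => t * M z r s)}.
    by move=> z; rewrite inE; exact: e.
  exact: (partial_eq i D'op e' (mem_set D'y)).
split.
- apply: antisymP => p q; rewrite -mulN1r; apply: rel => z D'z.
  by have [Ma _ _ _] := Mo z D'z; rewrite mulN1r (antisymN p q Ma).
- by apply: rel => z /Mo[].
- by apply: rel => z /Mo[].
- by apply: rel => z /Mo[].
Qed.

(** The curvature is computed from the connection matrices by derivatives and
    commutators, and both preserve duality. *)
Lemma cone_curvature_dual (D' : set V) o i j y : o ^+ 2 = 1 -> open D' ->
  D' `<=` D -> D' y -> (forall z, D' z -> dual_form o (F z)) ->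
  dual_form o (frame_curvature w i j y).
Proof.
move=> o2 D'op D'D D'y Fo.
have wo p z : D' z -> dual_form o (w p z).
  move=> D'z; rewrite /w.
  elim/big_ind: _ => [|A B|c _].
  - by rewrite -(scale0r (F z)); apply: dual_formZ; exact: Fo.
  - exact: dual_formD.
  - by apply: dual_formZ; apply: conn_dual => //; exact: Fo.
have w1 p : Mck 1 D' (w p).
  by move=> a c; exact: (Ck_sub D'D (Mck_cone_conn 1 p a c)).
have wd p q : dual_form o (dmx p (w q) y).
  by apply: (dual_form_dmx p D'op D'y (w1 q)) => z; exact: wo.
rewrite /frame_curvature; apply: dual_formD.
  apply: dual_formD => //; rewrite -scaleN1r; exact: dual_formZ.
by apply: dual_form_comm => //; exact: wo.
Qed.

End ConeCurvature.

(** * Homogeneity and the cone over a spherical domain *)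

Section Homogeneous.
Context {R : realType} {n : nat}.
Local Notation V := 'rV[R]_n.
Variable D : set V.
Hypothesis Dop : open D.
Hypothesis Dscale : forall t y, 0 < t -> D y -> D (t *: y).

Definition homogeneous (m : nat) (f : V -> R) : Prop :=
  forall t y, 0 < t -> D y -> f (t *: y) = t^-1 ^+ m * f y.

Lemma homogeneous_partial m f i : Ck 1 D f -> homogeneous m f ->
  homogeneous m.+1 (partial i f).
Proof.
move=> f1 fh t y t0 Dy; have tn0 : t != 0 by rewrite gt_eqF.
have e1 : partial i (fun z => f (t *: z)) y = t * partial i f (t *: y).
  have Dty := Dscale t0 Dy.
  have eq1 : 'D_('e_i) (fun z => f (t *: z)) y = 'D_(t *: 'e_i) f (t *: y).
    have E : (fun h => h^-1 *: (f (t *: (h *: 'e_i + y)) - f (t *: y))) =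
        (fun h => h^-1 *: (f (h *: (t *: 'e_i) + t *: y) - f (t *: y))).
      rewrite funeqE => h; congr (_ *: (f _ - _)).
      by rewrite scalerDr; congr (_ + _); rewrite !scalerA mulrC.
    by rewrite /derive/= E.
  rewrite -[LHS]/('D_('e_i) (fun z => f (t *: z)) y) eq1.
  rewrite (derive_sum_partial _ Dop f1 Dty) (bigD1 i)//= big1 ?addr0.
    by rewrite !mxE !eqxx mulr1.
  by move=> j ji; rewrite !mxE (negbTE ji) andbF mulr0 mul0r.
have e2 : partial i (fun z => f (t *: z)) y = t^-1 ^+ m * partial i f y.
  rewrite -(partialZ _ i f1 Dy); apply: (partial_eq i Dop _ (mem_set Dy)) => z.
  by rewrite inE => Dz; exact: fh.
apply: (mulfI tn0); rewrite -e1 e2 exprS; field.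
by rewrite tn0.
Qed.

(** Euler's relation, from the constancy of s -> (1 + s)^m f((1 + s) y). *)
Lemma euler_homogeneous m f y : Ck 1 D f -> homogeneous m f -> D y ->
  \sum_(k < n) y 0 k * partial k f y = - m%:R * f y.
Proof.
move=> f1 fh Dy; rewrite -(derive_sum_partial y Dop f1 Dy).
have y0 : y + (0 : R) *: y = y by rewrite scale0r addr0.
have Dy0 : D (y + (0 : R) *: y) by rewrite y0.
have [fd _] := Ck_is_derive y Dop f1 Dy0.
have d1 := is_derive_line fd.
pose P (s : R) : R := (1 + s * 1) ^+ m.
have d2 : is_derive (0 : R) (1 : R) P m%:R.
  have pd : derivable (fun s : R => s ^+ m : R) ((1 : R^o) + (0 : R) *: (1 : R^o)) (1 : R).
    exact: exprn_derivable.
  have h := @is_derive_line R R^o (fun s : R => s ^+ m : R) 1 1 0 pd.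
  apply: (is_derive_eq h); rewrite exp_derive /GRing.scale/= mul0r addr0 expr1n.
  by rewrite !mulr1.
have d3 := is_deriveM d2 d1.
have n1 : \forall s \near (0 : R), 0 < 1 + s.
  have : \forall s \near (0 : R), `|s| < 1 by exact: (@nbhs0_lt R R^o).
  by apply: filterS => s; rewrite ltr_norml => /andP[]; lra.
have c : is_derive (0 : R) (1 : R) (P * (fun s : R => f (y + s *: y))) 0.
  apply: (near_eq_is_derive _ (is_derive_cst (f y) (0 : R) (1 : R))).
  apply: filterS n1 => s s1.
  have -> : (P * (fun s : R => f (y + s *: y))) s = P s * f (y + s *: y) by [].
  rewrite (_ : y + s *: y = (1 + s) *: y); last by rewrite scalerDl scale1r.
  rewrite fh// /P mulr1 exprVn mulrA divff ?mul1r//.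
  by rewrite expf_neq0// gt_eqF.
have e := @derive_val _ _ _ _ _ _ _ d3.
rewrite (@derive_val _ _ _ _ _ _ _ c) in e.
move: e; rewrite y0 /P mul0r addr0 expr1n /GRing.scale/= mul1r => e.
by apply/eqP; rewrite mulNr -addr_eq0 [m%:R * _]mulrC -e.
Qed.

End Homogeneous.

Section SmoothComponents.
Context {R : realType} {n m : nat}.
Variable D : set 'rV[R]_n.
Hypothesis Dop : open D.

Lemma smooth_on_partial (W : normedModType R) (f : 'rV[R]_n -> W) i :
  smooth_on D f -> smooth_on D (partial i f).
Proof. by move=> fs s x Dx; rewrite -foldr_rcons; exact: fs. Qed.

Lemma smooth_component (f : 'rV[R]_n -> 'rV[R]_m) j : smooth_on D f ->
  Cinf D (fun y => f y 0 j).
Proof.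
move=> fs k; elim: k f fs => [|k IH] f fs.
  split=> // x Dx; apply: (@continuous_comp _ _ _ f (fun v : 'rV[R]_m => v 0 j)); last exact: coord_continuous.
  by have [c _] := fs [::] x Dx; exact: c.
have fd x i : D x -> derivable f x 'e_i by move=> Dx; have [_ h] := fs [::] x Dx; exact: h.
split=> [x Dx|].
  apply: (@continuous_comp _ _ _ f (fun v : 'rV[R]_m => v 0 j)); last exact: coord_continuous.
  by have [c _] := fs [::] x Dx; exact: c.
split=> [x i Dx|i]; first by have /derivable_mxP h := fd x i Dx; exact: h.
apply: (Ck_eq Dop _ (IH _ (smooth_on_partial i fs))) => x; rewrite inE => Dx.
have e : partial i f x = \matrix_(p, q) 'D_('e_i) (fun z => f z p q) x.
  exact: (derive_mx (fd x i Dx)).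
by rewrite e mxE.
Qed.

End SmoothComponents.

Section ConeData.
Context {R : realType}.
Local Notation V := 'rV[R]_4.
Local Notation M4 := 'M[R]_4.
Variables (U : set V) (A : V -> V).
Hypothesis hU : open_in_sphere3 U.
Hypothesis hA : smooth_one_form U A.
Local Notation D := (cone U).

Lemma cone_punctured : D `<=` punctured.
Proof. by move=> y []. Qed.

Lemma dot_normalized (y : V) : punctured y -> dot ((rho y)^-1 *: y) ((rho y)^-1 *: y) = 1.
Proof.
move=> py; have r0 : rho y != 0 by rewrite gt_eqF.
by rewrite dotZ -rho_sqr; field.
Qed.

Lemma cone_open : open D.
Proof.
have [W [Wop UE]] := hU.
have DE : cone U = punctured `&` [set y : V | W ((rho y)^-1 *: y)].
  apply/seteqP; split=> y.
    by move=> [ry]; rewrite UE => -[_ Wy]; split.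
  move=> [ry Wy]; split => //; rewrite UE; split=> //.
  exact: dot_normalized.
rewrite DE openE => y [py Wy].
rewrite /interior; apply: filterI; first exact: (open_nbhs_nbhs (conj punctured_open py)).
have c : {for y, continuous (fun z : V => (rho z)^-1 *: z)}.
  apply: continuousZ; last by move=> ?.
  exact: (Ck_continuous (Cinf_rhoV 0) py).
by apply: c; exact: (open_nbhs_nbhs (conj Wop Wy)).
Qed.

Lemma polar_scale t (y : V) : 0 < t -> punctured y -> polar (t *: y) = (t * rho y, (rho y)^-1 *: y).
Proof.
move=> t0 py; rewrite /polar -/(rho _) rhoZ ?ltW//; congr (_, _).
rewrite scalerA; congr (_ *: _); field.
by rewrite !gt_eqF.
Qed.

Lemma cone_scale t y : 0 < t -> D y -> D (t *: y).
Proof.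
move=> t0 Dy; have py := cone_punctured Dy; rewrite /cone /preimage /mkset polar_scale//.
by case: Dy => _ Uy; split=> //=; rewrite mulr_gt0.
Qed.

Lemma rho_sphere u : U u -> rho u = 1.
Proof.
have [W [_ UE]] := hU; rewrite UE => -[/= s _].
by rewrite /rho s sqrtr1.
Qed.

Lemma polar_sphere u : U u -> polar u = (1, u).
Proof. by move=> Uu; rewrite /polar -/(rho u) rho_sphere// invr1 scale1r. Qed.

Lemma sub_cone : U `<=` D.
Proof. by move=> u Uu; rewrite /cone /preimage /mkset polar_sphere//; split. Qed.

Lemma cone_normalize y : D y -> U ((rho y)^-1 *: y).
Proof. by case. Qed.

Lemma normalizeK y : D y -> rho y *: ((rho y)^-1 *: y) = y.
Proof.
by move=> /cone_punctured py; rewrite scalerA divff ?scale1r// gt_eqF.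
Qed.

(** The one-form [beta = rho^-2 A] on the cone, as a covector field. *)
Definition cone_form (y : V) : V := (rho y)^-1 ^+ 3 *: radial A y.
Local Notation b := cone_form.

Lemma cone_form_sphere u : U u -> b u = A u.
Proof.
by move=> Uu; rewrite /b rho_sphere// invr1 expr1n scale1r /radial polar_sphere.
Qed.

Lemma dot_cone_form y : D y -> dot y (b y) = 0.
Proof.
move=> Dy; have [tA _] := hA; have := tA _ (cone_normalize Dy); rewrite /tangent/= => e.
rewrite -{1}(normalizeK Dy) dotZ.
by rewrite -[radial A y]/(A ((rho y)^-1 *: y)) e mulr0.
Qed.

Lemma Cinf_cone_form i : Cinf D (fun y => b y 0 i).
Proof.
move=> k; have [_ sA] := hA.
have r1 : Ck k D (fun y => (rho y)^-1) by exact: (Ck_sub cone_punctured (Cinf_rhoV k)).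
have A1 := smooth_component cone_open i sA k.
have h := CkM cone_open (CkM cone_open r1 (CkM cone_open r1 r1)) A1.
by apply: (Ck_eq cone_open _ h) => y _; rewrite mxE; congr (_ * _); rewrite !exprS expr0 mulr1.
Qed.

Lemma homogeneous_cone_form i : homogeneous D 3 (fun y => b y 0 i).
Proof.
move=> t y t0 Dy; have py := cone_punctured Dy.
rewrite !mxE rhoZ ?ltW// invfM exprMn -mulrA; congr (_ * (_ * _)).
by rewrite /radial polar_scale.
Qed.

Local Notation F := (ext_form b).

Lemma homogeneous_ext_form i j : homogeneous D 4 (fun y => F y i j).
Proof.
move=> t y t0 Dy; rewrite !mxE mulrBr; congr (_ - _).
  exact: (homogeneous_partial cone_open cone_scale i (Cinf_cone_form j 1)
    (homogeneous_cone_form j)).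
exact: (homogeneous_partial cone_open cone_scale j (Cinf_cone_form i 1)
  (homogeneous_cone_form i)).
Qed.

Lemma homogeneous_dmx k i j : homogeneous D 5 (fun y => dmx k F y i j).
Proof.
move=> t y t0 Dy; rewrite [LHS]mxE [X in _ = _ * X]mxE.
exact: (homogeneous_partial cone_open cone_scale k
  (Cinf_ext_form cone_open Cinf_cone_form i j 1) (homogeneous_ext_form i j)).
Qed.

Lemma cone_euler y a c : D y -> \sum_(k < 4) y 0 k * dmx k F y a c = - 4 * F y a c.
Proof.
move=> Dy; rewrite -(euler_homogeneous cone_open
  (Cinf_ext_form cone_open Cinf_cone_form a c 1) (homogeneous_ext_form a c) Dy).
by apply: eq_bigr => k _; rewrite [dmx _ _ _ _ _]mxE.
Qed.

(** F y = 2 b: Euler's relation for [b] contributes 3 b, and the derivative of y . b = 0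
    contributes - b.  In terms of forms, the contraction of d beta with the radial field
    is the Lie derivative of beta, which is - 2 beta. *)
Lemma half_mulv_ext_form y : D y -> half_mulv y (F y) = b y.
Proof.
move=> Dy; apply/rowP => i; rewrite mxE.
have e1 := euler_homogeneous cone_open (Cinf_cone_form i 1) (homogeneous_cone_form i) Dy.
have e2 : \sum_(k < 4) y 0 k * partial i (fun z => b z 0 k) y = - b y 0 i.
  have prod k : Ck 1 D (fun z : V => z 0 k * b z 0 k).
    exact: (CkM cone_open (Ck_coord 1 D k) (Cinf_cone_form k 1)).
  have z : partial i (fun z : V => \sum_(k < 4) z 0 k * b z 0 k) y = 0.
    have eq0 : {in D, (fun z : V => \sum_(k < 4) z 0 k * b z 0 k) =1 cst 0}.
      by move=> z; rewrite inE; exact: dot_cone_form.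
    apply: (etrans (partial_eq i cone_open eq0 (mem_set Dy))).
    exact: derive_cst.
  have := partial_sum i prod Dy; rewrite z.
  rewrite (eq_bigr (fun k => b y 0 k * (k == i)%:R
    + y 0 k * partial i (fun z => b z 0 k) y)); last first.
    move=> k _; rewrite (partialM i (Ck_coord 1 D k) (Cinf_cone_form k 1) Dy).
    by rewrite partial_coord mulrC [i == k]eq_sym.
  rewrite big_split/= sum_delta => e.
  by apply/eqP; rewrite -addr_eq0 addrC -e.
have -> : mulv (F y) y i = \sum_(k < 4) y 0 k * partial i (fun z => b z 0 k) y
    - \sum_(k < 4) y 0 k * partial k (fun z => b z 0 i) y.
  rewrite -sumrB; apply: eq_bigr => k _; rewrite mxE; ring.
by rewrite e1 e2; field.
Qed.

(** rho^2 h + rho^-2 (rho drho + A)^2 = |dy|^2 + 2 rho drho beta + rho^2 beta^2, which is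
    the sum of the squares of dy_a + y_a beta. *)
Lemma warped_coord_frame y : D y ->
  warped_coord A y = (frame y (b y))^T *m frame y (b y).
Proof.
move=> Dy; have py := cone_punctured Dy; have r0 : rho y != 0 by rewrite gt_eqF.
set r := rho y in r0 *; pose u := r^-1 *: y.
have Au i : (A u) 0 i = r ^+ 3 * b y 0 i.
  by rewrite [b y _ _]mxE mulrA -exprMn divff// expr1n mul1r.
have uA : \sum_(k < 4) y 0 k * A u 0 k = 0.
  have := dot_cone_form Dy; rewrite /dot => e.
  rewrite (eq_bigr (fun k => r ^+ 3 * (y 0 k * b y 0 k))).
    by rewrite -mulr_sumr e mulr0.
  by move=> k _; rewrite Au; ring.
have yy : \sum_(k < 4) y 0 k * y 0 k = r ^+ 2 by rewrite rho_sqr.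
pose X i : V := \row_j (r^-1 * (i == j)%:R - r^-1 ^+ 3 * y 0 i * y 0 j).
have dA i : dot (A u) (X i) = r ^+ 2 * b y 0 i.
  rewrite /dot (eq_bigr (fun k => r^-1 * (A u 0 k * (k == i)%:R)
      - r^-1 ^+ 3 * y 0 i * (y 0 k * A u 0 k))); last first.
    by move=> k _; rewrite mxE [i == k]eq_sym; ring.
  by rewrite sumrB -!mulr_sumr sum_delta uA Au; field.
have dX i j : dot (X i) (X j) = r^-1 ^+ 2 * ((i == j)%:R - r^-1 ^+ 2 * y 0 i * y 0 j).
  rewrite /dot (eq_bigr (fun k => r^-1 ^+ 2 * ((i == k)%:R * (k == j)%:R)
      - r^-1 ^+ 4 * y 0 j * (y 0 k * (k == i)%:R) - r^-1 ^+ 4 * y 0 i * (y 0 k * (k == j)%:R)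
      + r^-1 ^+ 6 * y 0 i * y 0 j * (y 0 k * y 0 k))); last first.
    by move=> k _; rewrite !mxE [j == k]eq_sym [k == i]eq_sym; ring.
  rewrite big_split/= !sumrB -!mulr_sumr !sum_delta yy.
  by field.
apply/matrixP => i j; rewrite mxE !partial_polar// /warped_metric /= -/(rho y) -/r.
rewrite -[(\row__ _)]/(X i) -[X in dot _ X]/(X j).
rewrite -/u !dA dX [RHS]mxE.
rewrite (eq_bigr (fun k => (k == j)%:R * (k == i)%:R + b y 0 i * (y 0 k * (k == j)%:R)
   + b y 0 j * (y 0 k * (k == i)%:R) + b y 0 i * b y 0 j * (y 0 k * y 0 k))); last first.
  by move=> k _; rewrite mxE !frameE; ring.
rewrite !big_split/= -!mulr_sumr !sum_delta yy [i == j]eq_sym.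
by field.
Qed.

End ConeData.

(** * The Beltrami equation and the form F *)

Section Beltrami.
Context {R : realType}.
Local Notation V := 'rV[R]_4.
Local Notation M4 := 'M[R]_4.
Variables (U : set V) (A : V -> V).
Hypothesis hU : open_in_sphere3 U.
Hypothesis hA : smooth_one_form U A.
Local Notation D := (cone U).
Local Notation b := (cone_form A).
Local Notation F := (ext_form b).

Let Dop : open D := cone_open hU.

Lemma Cinf_radial j : Cinf D (fun y => radial A y 0 j).
Proof. by have [_ sA] := hA; exact: smooth_component. Qed.

Lemma radial_sphere u : U u -> radial A u = A u.
Proof. by move=> Uu; rewrite /radial (polar_sphere hU Uu). Qed.

(** The factor rho^-3 only contributes a term along the normal, which tangent vectors
    do not see. *)
Lemma partial_cone_form_sphere i j u : U u ->
  partial i (fun y => b y 0 j) u =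
  partial i (fun y => radial A y 0 j) u - 3 * (u 0 i * A u 0 j).
Proof.
move=> Uu; have Du := sub_cone hU Uu; have pu := cone_punctured Du.
pose r (y : V) := (rho y)^-1.
have r1 : Ck 1 D r := Ck_sub (@cone_punctured _ U) (Cinf_rhoV 1).
have rr := CkM Dop r1 r1.
have rrr := CkM Dop r1 rr.
have eq1 : {in D, (fun y => b y 0 j) =1 (fun y => r y * (r y * r y) * radial A y 0 j)}.
  by move=> y _; rewrite mxE; congr (_ * _); rewrite !exprS expr0 mulr1.
rewrite (partial_eq i Dop eq1 (mem_set Du)).
rewrite (partialM i rrr (Cinf_radial j 1) Du) (partialM i r1 rr Du) (partialM i r1 r1 Du).
have -> : partial i r u = - u 0 i.
  rewrite (partial_rhoV i pu) (rho_sphere hU Uu).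
  by rewrite invr1 expr1n mul1r.
have -> : r u = 1 by rewrite /r (rho_sphere hU Uu) invr1.
by rewrite radial_sphere//; ring.
Qed.

Lemma derive_dot_radial (v w u : V) : U u ->
  'D_v (fun x => dot (radial A x) w) u =
  \sum_(i < 4) \sum_(j < 4) v 0 i * w 0 j * partial i (fun y => radial A y 0 j) u.
Proof.
move=> Uu; have Du := sub_cone hU Uu.
have Z j : Ck 1 D (fun y => w 0 j * radial A y 0 j) by exact: (CkZ _ Dop (Cinf_radial j 1)).
have -> : (fun x => dot (radial A x) w) = (fun x => \sum_(j < 4) w 0 j * radial A x 0 j).
  by rewrite funeqE => x; apply: eq_bigr => j _; rewrite mulrC.
rewrite (derive_sum_partial v Dop (Ck_sum Dop Z) Du); apply: eq_bigr => i _.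
rewrite (partial_sum i Z Du) mulr_sumr; apply: eq_bigr => j _.
by rewrite (partialZ _ i (Cinf_radial j 1) Du) mulrA.
Qed.

Lemma ext_deriv_bilin (u v w : V) : U u -> tangent u v -> tangent u w ->
  ext_deriv A u v w = bilin (F u) v w.
Proof.
rewrite /tangent /= => Uu uv uw; rewrite /ext_deriv !derive_dot_radial//.
have tan (p q : V) : dot u p = 0 ->
    \sum_(i < 4) \sum_(j < 4) p 0 i * q 0 j * partial i (fun y => radial A y 0 j) u =
    \sum_(i < 4) \sum_(j < 4) p 0 i * q 0 j * partial i (fun y => b y 0 j) u.
  move=> up; apply/eqP; rewrite -subr_eq0 -sumrB; apply/eqP.
  transitivity (3 * (\sum_(i < 4) u 0 i * p 0 i) * \sum_(j < 4) A u 0 j * q 0 j); last first.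
    by rewrite [X in _ * X * _]up mulr0 mul0r.
  rewrite -mulrA mulr_suml mulr_sumr; apply: eq_bigr => i _.
  rewrite -sumrB !mulr_sumr; apply: eq_bigr => j _.
  rewrite partial_cone_form_sphere//; ring.
rewrite (tan v w uv) (tan w v uw) [X in _ - X]exchange_big/= -sumrB.
apply: eq_bigr => i _; rewrite -sumrB mulr_sumr; apply: eq_bigr => j _.
rewrite [F u i j]mxE; ring.
Qed.

Lemma hodge_bilin o (u v w : V) : U u ->
  2 * hodge o A u v w = o u * det4 u (\row_i mulv (F u) u i) v w.
Proof.
move=> Uu; have Du := sub_cone hU Uu.
have Fu i : mulv (F u) u i = 2 * A u 0 i.
  by rewrite mulv_half (half_mulv_ext_form hU hA Du) (cone_form_sphere _ hU Uu).
by rewrite /hodge !det4E !mxE !Fu; ring.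
Qed.

(** F restricted to the tangent space of the sphere is dA, and its contraction with the
    normal is 2 A up to sign. *)
Lemma beltrami_dual_form (o : V -> R) : (forall u, U u -> o u ^+ 2 = 1) ->
  beltrami U o A <-> forall u, U u -> dual_form (o u) (F u).
Proof.
move=> o2; split=> h u Uu.
  have uu : dot u u = 1 by rewrite -rho_sqr (rho_sphere hU Uu) expr1n.
  apply: (bilin_dual_form (o2 u Uu) (ext_form_antisym _ _) uu) => v w uv uw.
  by rewrite -(ext_deriv_bilin Uu uv uw) -(hodge_bilin o v w Uu); exact: h.
have uu : dot u u = 1 by rewrite -rho_sqr (rho_sphere hU Uu) expr1n.
move=> v w uv uw; rewrite (ext_deriv_bilin Uu uv uw) (hodge_bilin o v w Uu).
rewrite -[bilin _ _ _]mul1r -{1}uu.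
by apply: (dual_form_bilin (o2 u Uu) (h u Uu)).
Qed.

End Beltrami.

(** * From the Beltrami equation to a self-dual Ricci-flat metric *)

Section LocallyConstant.
Context {R : realType} {n : nat}.
Local Notation V := 'rV[R]_n.
Variables (D : set V) (o : V -> R).

Lemma locally_constant_orientation :
  (forall x, D x -> o x = 1 \/ o x = -1) ->
  (forall x, D x -> \forall z \near x, o z = o x) -> is_orientation D o.
Proof.
move=> o1 oc; split=> //.
have c (x : V) : D x -> {for x, continuous o}.
  move=> Dx; rewrite /prop_for /continuous_at.
  suff h : forall e, 0 < e -> \forall z \near x, `|o x - o z| < e.
    by apply/(@cvgrPdist_lt R R _ (nbhs x) _ o (o x)); exact: h.
  move=> e e0; have := oc x Dx; apply: filterS => z ->.
  by rewrite subrr normr0.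
by apply: continuous_in_subspaceT => x; rewrite inE; exact: c.
Qed.

(** Signs at distance less than 1 are equal. *)
Lemma orientation_near x : is_orientation D o -> D x ->
  \forall z \near x, D z -> o z = o x.
Proof.
move=> [ho oc] Dx.
have : (o : subspace D -> R) @ nbhs (x : subspace D) --> o x by exact: oc.
move=> /cvgrPdist_lt/(_ 1 ltr01).
move=> h; have h' : within D (nbhs x) [set z | `|o x - o z| < 1].
  by rewrite nbhs_subspace_in//; exact: h.
have h2 : \forall z \near x, D z -> `|o x - o z| < 1 by exact: h'.
have h3 z : (D z -> `|o x - o z| < 1) -> D z -> o z = o x; last exact: (filterS h3 h2).
move=> zx Dz; have := zx Dz.
case: (ho z Dz) => ->; case: (ho x Dx) => -> //.
  by rewrite ltr_norml => /andP[]; lra.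
by rewrite ltr_norml => /andP[]; lra.
Qed.

End LocallyConstant.

Lemma ricci_flat_weyl {R : realType} {n : nat} (g : 'rV[R]_n -> 'M[R]_n) y l k i j :
  ricci g y = 0 -> weyl g l k i j y = riemann g l k i j y.
Proof.
move=> ry; have s0 p q : schouten g y p q = 0.
  rewrite /schouten /scalar_curvature ry mulmx0 raddf0 mul0r scale0r subr0 scaler0.
  exact: mxE.
by rewrite /weyl !s0 !(mul0r, mulr0) !(addr0, subr0).
Qed.

Section BeltramiToEinstein.
Context {R : realType}.
Local Notation V := 'rV[R]_4.
Local Notation M4 := 'M[R]_4.
Variables (U : set V) (A : V -> V).
Hypothesis hU : open_in_sphere3 U.
Hypothesis hA : smooth_one_form U A.
Local Notation D := (cone U).
Local Notation b := (cone_form A).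
Local Notation F := (ext_form b).
Local Notation g := (warped_coord A).

Let Dop : open D := cone_open hU.
Let bs := Cinf_cone_form hU hA.
Let Fb y := @half_mulv_ext_form _ _ _ hU hA y.
Let eu y a c := @cone_euler _ _ _ hU hA y a c.
Let gE y := @warped_coord_frame _ _ _ hA y.

Lemma normalize_continuous (y : V) : punctured y ->
  {for y, continuous (fun z : V => (rho z)^-1 *: z)}.
Proof.
move=> py; apply: continuousZ; last by move=> ?.
exact: (Ck_continuous (Cinf_rhoV 0) py).
Qed.

(** d (d beta) = 0. *)
Lemma cone_ext_form_closed i j k y : D y ->
  dmx i F y j k + dmx j F y k i + dmx k F y i j = 0.
Proof.
move=> Dy.
pose P p q r := partial p (partial q (fun z => b z 0 r)) y.
have Pc p q r : P p q r = P q p r := partialC p q Dop (bs r 2) Dy.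
have e p q r : dmx p F y q r = P p q r - P p r q.
  rewrite [LHS]mxE -(partialB p Dop (Ck_partial q (bs r 2)) (Ck_partial r (bs q 2)) Dy).
  by congr (partial p _ y); rewrite funeqE => z; rewrite mxE.
move: P Pc e => P Pc e.
apply: (etrans (congr2 +%R (congr2 +%R (e i j k) (e j k i)) (e k i j))).
rewrite (Pc i j k) (Pc i k j) (Pc j k i).
ring.
Qed.

(** Duality propagates along rays, as [F] is homogeneous. *)
Lemma dual_form_cone (o : R) y : D y -> dual_form o (F ((rho y)^-1 *: y)) ->
  dual_form o (F y).
Proof.
move=> Dy Fo; have r0 : 0 < rho y := cone_punctured Dy.
have Du : D ((rho y)^-1 *: y) := sub_cone hU (cone_normalize Dy).
rewrite (_ : F y = (rho y)^-1 ^+ 4 *: F ((rho y)^-1 *: y)); first exact: dual_formZ.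
apply/matrixP => i j; rewrite [RHS]mxE.
rewrite -(homogeneous_ext_form hU hA i j r0 Du).
by rewrite (normalizeK Dy).
Qed.

Variable o : V -> R.
Hypothesis oU : is_orientation U o.
Hypothesis oA : beltrami U o A.

Let o' (y : V) : R := o ((rho y)^-1 *: y).

Let o2 u : U u -> o u ^+ 2 = 1.
Proof. by move=> Uu; have [h _] := oU; case: (h u Uu) => ->; rewrite ?sqrrN expr1n. Qed.

Let o'_near y : D y -> \forall z \near y, D z /\ o' z = o' y.
Proof.
move=> Dy; have py := cone_punctured Dy.
have h1 : \forall z \near y, U ((rho z)^-1 *: z) -> o' z = o' y.
  exact: (normalize_continuous py (orientation_near oU (cone_normalize Dy))).
have h2 : nbhs y D by exact: (open_nbhs_nbhs (conj Dop Dy)).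
apply: filterS2 h1 h2 => z h Dz; split=> //.
exact: (h (cone_normalize Dz)).
Qed.

Lemma beltrami_dual_cone y : D y -> exists D', [/\ open D', D' `<=` D, D' y &
  forall z, D' z -> dual_form (o' y) (F z)].
Proof.
move=> Dy; exists (interior [set z | D z /\ o' z = o' y]); split.
- exact: open_interior.
- by move=> z /nbhs_singleton[].
- exact: o'_near.
- move=> z /nbhs_singleton[Dz <-]; apply: dual_form_cone => //.
  exact: ((beltrami_dual_form hU hA o2).1 oA _ (cone_normalize Dz)).
Qed.

Lemma beltrami_ricci_flat : ricci_flat g D.
Proof.
move=> y Dy; have o2y : o' y ^+ 2 = 1 by apply: o2; exact: cone_normalize.
have [D' [D'op D'D D'y Fo]] := beltrami_dual_cone Dy.
have F1 : Mck 1 D' F by move=> i j; exact: (Ck_sub D'D (Cinf_ext_form Dop bs i j 1)).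
rewrite (cone_ricci Dop bs Fb eu gE Dy) /ricci_form.
rewrite ricci_lin0; last first.
  apply: (dual_closed_current o2y) => [k|i j k]; last exact: cone_ext_form_closed.
  exact: (dual_form_dmx k D'op D'y F1 Fo).
rewrite ricci_quad0; first by rewrite addr0 mulmx0 mul0mx.
exact: (stress_dual_form o2y (Fo _ D'y)).
Qed.

Lemma beltrami_self_dual : exists o : V -> R,
  is_orientation D o /\ self_dual o g D.
Proof.
exists o'; split.
  apply: locally_constant_orientation => y Dy.
    by have [h _] := oU; apply: h; exact: cone_normalize.
  by apply: filterS (o'_near Dy) => z [].
move=> y Dy i j; have o2y : o' y ^+ 2 = 1 by apply: o2; exact: cone_normalize.
have [D' [D'op D'D D'y Fo]] := beltrami_dual_cone Dy.
rewrite /weyl_minus /=.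
have -> : \matrix_(l, k) weyl g l k i j y = \matrix_(l, k) riemann g l k i j y.
  by apply/matrixP => l k; rewrite !mxE ricci_flat_weyl//; exact: beltrami_ricci_flat.
rewrite (cone_riemann Dop bs Fb gE i j Dy) gE//.
rewrite star2_frame//; first by rewrite subrr scaler0.
  exact: (dot_cone_form hA Dy).
exact: (cone_curvature_dual Dop bs i j o2y D'op D'D D'y Fo).
Qed.

End BeltramiToEinstein.

(** * From the Einstein equation to the Beltrami equation *)

Section RicciScaling.
Context {R : realType}.
Local Notation V := 'rV[R]_4.
Local Notation M4 := 'M[R]_4.
Implicit Types (x : V) (M : M4).

Lemma mulvZ a t M x d : mulv (a *: M) (t *: x) d = a * t * mulv M x d.
Proof. by rewrite mulr_sumr; apply: eq_bigr => e _; rewrite !mxE; ring. Qed.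

Lemma stressZ a M : stress (a *: M) = a ^+ 2 *: stress M.
Proof.
rewrite /stress -scalemxAl -scalemxAr scalerA -expr2.
apply/matrixP => i j; rewrite linearZ/= !mxE -mulr_natr -[X in _ = _ * (_ * (_ - X))]mulr_natr.
by ring.
Qed.

Lemma ricci_linZ t s x (dF : 'I_4 -> M4) :
  ricci_lin (t *: x) (fun k => s *: dF k) = (t * s) *: ricci_lin x dF.
Proof.
have J d : current (fun k => s *: dF k) d = s * current dF d.
  by rewrite mulr_sumr; apply: eq_bigr => a _; rewrite mxE.
apply/matrixP => d b; rewrite [LHS]mxE [RHS]mxE [X in _ = _ * X]mxE !J.
rewrite (eq_bigr (fun a => t * s * (current dF a * x 0 a))).
  by rewrite -mulr_sumr !mxE; ring.
by move=> a _; rewrite J mxE; ring.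
Qed.

Lemma ricci_quadZ t s x M :
  ricci_quad (t *: x) (s *: M) = (t * s) ^+ 2 *: ricci_quad x M.
Proof.
apply/matrixP => d b; rewrite [LHS]mxE [RHS]mxE [X in _ = _ * X]mxE dotZ stressZ !mulvZ.
rewrite (eq_bigr (fun a => t ^+ 2 * s ^+ 2 * (x 0 a * mulv (stress M) x a))).
  rewrite -mulr_sumr; move: (stress M) => T; rewrite !mxE; ring.
by move=> a _; rewrite mulvZ mxE; ring.
Qed.

End RicciScaling.

Section EinsteinToMaxwell.
Context {R : realType}.
Local Notation V := 'rV[R]_4.
Local Notation M4 := 'M[R]_4.
Variables (U : set V) (A : V -> V).
Hypothesis hU : open_in_sphere3 U.
Hypothesis hA : smooth_one_form U A.
Local Notation D := (cone U).
Local Notation b := (cone_form A).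
Local Notation F := (ext_form b).
Local Notation g := (warped_coord A).

Let Dop : open D := cone_open hU.
Let bs := Cinf_cone_form hU hA.
Let Fb y := @half_mulv_ext_form _ _ _ hU hA y.
Let eu y a c := @cone_euler _ _ _ hU hA y a c.
Let gE y := @warped_coord_frame _ _ _ hA y.

Lemma einstein_ricci_form : einstein g D ->
  exists c : R, forall y, D y -> ricci_form b y = c%:M.
Proof.
move=> [c gc]; exists c => y Dy; have := gc y Dy.
rewrite (cone_ricci Dop bs Fb eu gE Dy) (gE Dy).
set E := frame y (b y); set N := coframe y (b y).
have EN : E *m N = 1%:M by exact: (mulmx1C (coframeK (dot_cone_form hA Dy))).
have NEt : N^T *m E^T = 1%:M by rewrite -trmx_mul EN trmx1.
move/(congr1 (fun X => N^T *m X *m N)).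
rewrite -!mulmxA EN mulmx1 mulmxA NEt mul1mx => ->.
by rewrite -scalemxAl -scalemxAr -!mulmxA EN mulmx1 NEt scalemx1.
Qed.

Lemma ricci_form_scale t y : 0 < t -> D y -> ricci_form b (t *: y) =
  t^-1 ^+ 4 *: ricci_lin y (fun k => dmx k F y) + t^-1 ^+ 6 *: ricci_quad y (F y).
Proof.
move=> t0 Dy; have tn0 : t != 0 by rewrite gt_eqF.
have e1 : F (t *: y) = t^-1 ^+ 4 *: F y.
  by apply/matrixP => i j; rewrite [RHS]mxE; exact: (homogeneous_ext_form hU hA i j t0 Dy).
have e2 : (fun k => dmx k F (t *: y)) = (fun k => t^-1 ^+ 5 *: dmx k F y).
  rewrite funeqE => k; apply/matrixP => i j; rewrite [RHS]mxE.
  exact: (homogeneous_dmx hU hA k i j t0 Dy).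
apply: (etrans (congr2 +%R (congr1 (ricci_lin _) e2) (congr1 (ricci_quad _) e1))).
rewrite ricci_linZ ricci_quadZ.
by congr (_ *: _ + _ *: _); field.
Qed.

(** The scalings t^-4, t^-6 and 1 of the three terms are linearly independent; they are
    separated by t = 1, 1/2, 1/4. *)
Lemma einstein_ricci_parts y : einstein g D -> D y ->
  ricci_lin y (fun k => dmx k F y) = 0 /\ ricci_quad y (F y) = 0.
Proof.
move=> /einstein_ricci_form[c Sc] Dy.
have h t : 0 < t -> t^-1 ^+ 4 *: ricci_lin y (fun k => dmx k F y)
    + t^-1 ^+ 6 *: ricci_quad y (F y) = c%:M.
  by move=> t0; rewrite -(ricci_form_scale t0 Dy) Sc//; exact: cone_scale.
have t2 : 0 < 2^-1 :> R by rewrite invr_gt0 ltr0n.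
have t4 : 0 < 4^-1 :> R by rewrite invr_gt0 ltr0n.
have := (h 1 ltr01, h _ t2, h _ t4).
rewrite !invrK invr1 !expr1n !scale1r.
move: (ricci_lin _ _) (ricci_quad _ _) => L Q [[h1 h2] h3].
suff e i j : L i j = 0 /\ Q i j = 0.
  by split; apply/matrixP => i j; rewrite [RHS]mxE; have [] := e i j.
move: h1 h2 h3 => /matrixP/(_ i j) h1 /matrixP/(_ i j) h2 /matrixP/(_ i j) h3.
move: h1 h2 h3; rewrite ![(_ + _ : M4) i j]mxE ![(_ *: _ : M4) i j]mxE.
by move: (c%:M i j) (L i j) (Q i j) => C l q; split; lra.
Qed.

End EinsteinToMaxwell.

Section FlatPoints.
Context {R : realType} {n : nat}.
Local Notation V := 'rV[R]_n.
Implicit Types (D : set V) (f g : V -> R).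

Lemma near_neq0 f (x : V) : {for x, continuous f} -> f x != 0 ->
  \forall z \near x, f z != 0.
Proof.
move=> c fx; have f0 : 0 < `|f x| by rewrite normr_gt0.
have /cvgrPdist_lt/(_ _ f0) h := c.
have i z : `|f x - f z| < `|f x| -> f z != 0.
  by apply: contraTneq => ->; rewrite subr0 ltxx.
exact: (filterS i h).
Qed.

Lemma near0_foldr_partial f (x : V) s : (\forall z \near x, f z = 0) ->
  \forall z \near x, foldr partial f s z = 0.
Proof.
move=> f0; elim: s => [//|i s IH] /=.
pose W : set V := interior [set z | foldr partial f s z = 0].
have Wop : open W by exact: open_interior.
have W0 : {in W, foldr partial f s =1 cst 0}.
  by move=> z; rewrite inE => /nbhs_singleton.
have Wi z : W z -> partial i (foldr partial f s) z = 0.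
  move=> Wz; apply: (etrans (partial_eq i Wop W0 (mem_set Wz))).
  exact: derive_cst.
by apply: (filterS Wi); exact: (open_nbhs_nbhs (conj Wop IH)).
Qed.

(** The interior of the zero set of a family of harmonic functions is relatively closed:
    at a point outside it some derivative is nonzero, by unique continuation, and it stays
    nonzero nearby. *)
Lemma harmonic_vanishing_closed m D (p : 'I_m -> V -> R) (x : V) : open D -> D x ->
  (forall k, Cinf D (p k)) -> (forall k z, D z -> laplacian (p k) z = 0) ->
  ~ (\forall z \near x, forall k, p k z = 0) ->
  \forall z \near x, ~ (\forall w \near z, forall k, p k w = 0).
Proof.
move=> Dop Dx pC pH np.
have [k nk] : exists k, ~ (\forall z \near x, p k z = 0).
  apply: contrapT => h; apply: np.
  have pk k : \forall z \near x, p k z = 0.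
    by apply: contrapT => nk; apply: h; exists k.
  exact: (@filter_forall _ 'I_m (fun k z => p k z = 0) (nbhs x) _ pk).
have [s ns] : exists s, foldr partial (p k) s x <> 0.
  apply: contrapT => h; apply: nk.
  apply: (harmonic_flat_near0 Dop (pC k) (pH k) Dx) => s.
  by apply: contrapT => ns; apply: h; exists s.
have c : {for x, continuous (foldr partial (p k) s)}.
  exact: (Ck_continuous (Cinf_foldr s (pC k) 0) Dx).
have i z : foldr partial (p k) s z != 0 -> ~ (\forall w \near z, forall k, p k w = 0).
  move=> /eqP nz h; apply: nz.
  have hk : \forall w \near z, p k w = 0 by apply: filterS h => w; apply.
  exact: (nbhs_singleton (near0_foldr_partial s hk)).
apply: (filterS i); apply: (near_neq0 c); exact/eqP.
Qed.

Lemma laplacian_comb D f g (a : R) x : open D -> Ck 2 D f -> Ck 2 D g -> D x ->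
  laplacian (fun z => f z - a * g z) x = laplacian f x - a * laplacian g x.
Proof.
move=> Dop f2 g2 Dx; rewrite /laplacian mulr_sumr -sumrB; apply: eq_bigr => i _.
have h1 : {in D, partial i (fun z => f z - a * g z) =1
    (fun z => partial i f z - a * partial i g z)}.
  move=> z; rewrite inE => Dz.
  by rewrite (partialB i Dop f2 (CkZ a Dop g2) Dz) (partialZ a i g2 Dz).
apply: (etrans (partial_eq i Dop h1 (mem_set Dx))).
have fi := Ck_partial i f2; have gi := Ck_partial i g2.
by rewrite (partialB i Dop fi (CkZ a Dop gi) Dx) (partialZ a i gi Dx).
Qed.

End FlatPoints.

Section EinsteinToBeltrami.
Context {R : realType}.
Local Notation V := 'rV[R]_4.
Local Notation M4 := 'M[R]_4.
Variables (U : set V) (A : V -> V).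
Hypothesis hU : open_in_sphere3 U.
Hypothesis hA : smooth_one_form U A.
Local Notation D := (cone U).
Local Notation b := (cone_form A).
Local Notation F := (ext_form b).
Local Notation g := (warped_coord A).

Let Dop : open D := cone_open hU.
Let bs := Cinf_cone_form hU hA.
Let f (i j : 'I_4) (z : V) : R := F z i j.

Let fC i j : Cinf D (f i j) := Cinf_ext_form Dop bs i j.

Let dmxE k i j y : dmx k F y i j = partial k (f i j) y.
Proof. by rewrite [LHS]mxE. Qed.

Hypothesis ein : einstein g D.

Let dot_neq0 y : D y -> dot y y != 0.
Proof. by move=> /cone_punctured py; rewrite -rho_sqr expf_neq0// gt_eqF. Qed.

Lemma einstein_current y d : D y -> \sum_(a < 4) partial a (f d a) y = 0.
Proof.
move=> Dy; have [l0 _] := einstein_ricci_parts hU hA ein Dy.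
rewrite -[RHS](ricci_lin_eq0 (dot_neq0 Dy) l0 d); apply: eq_bigr => a _.
by apply: esym; exact: dmxE.
Qed.

(** A closed two-form without divergence is harmonic (Maxwell's equations imply the wave
    equation). *)
Lemma einstein_laplacian i j y : D y -> laplacian (f i j) y = 0.
Proof.
move=> Dy.
have cl c : {in D, partial c (f i j) =1
    (fun z => partial j (f i c) z - partial i (f j c) z)}.
  move=> z; rewrite inE => Dz.
  have := cone_ext_form_closed hU hA c i j Dz.
  have := antisymN i c (dmx_ext_form_antisym Dop bs j Dz).
  by move: (dmxE c i j z) (dmxE i j c z) (dmxE j c i z) (dmxE j i c z) => <- <- _ <-; lra.
have second c : partial c (partial c (f i j)) y =
    partial j (partial c (f i c)) y - partial i (partial c (f j c)) y.
  apply: (etrans (partial_eq c Dop (cl c) (mem_set Dy))).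
  apply: (etrans (partialB c Dop (Ck_partial j (fC i c 2)) (Ck_partial i (fC j c 2)) Dy)).
  exact: (congr2 (fun p q => p - q) (partialC c j Dop (fC i c 2) Dy)
    (partialC c i Dop (fC j c 2) Dy)).
have div0 k l : \sum_(c < 4) partial k (partial c (f l c)) y = 0.
  have c1 c : Ck 1 D (partial c (f l c)) := Ck_partial c (fC l c 2).
  apply: (etrans (esym (partial_sum k c1 Dy))).
  have z0 : {in D, (fun z => \sum_(c < 4) partial c (f l c) z) =1 cst 0}.
    by move=> z; rewrite inE => Dz; exact: einstein_current.
  apply: (etrans (partial_eq k Dop z0 (mem_set Dy))).
  exact: derive_cst.
apply: (etrans (eq_bigr _ (fun c _ => second c))).
apply: (etrans (sumrB _ _ _ _)).
by apply: (etrans (congr2 (fun p q => p - q) (div0 j i) (div0 i j))); rewrite subr0.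
Qed.

Let defect (o : R) (k : 'I_3) (z : V) : R := dual_defect o (F z) k.

Lemma dual_defect_entries (k : 'I_3) : exists c : 'I_4 * 'I_4 * ('I_4 * 'I_4),
  forall (o : R) M, dual_defect o M k = M c.1.1 c.1.2 - o * M c.2.1 c.2.2.
Proof.
case: k => [[|[|[|//]]] ?]; [exists (i0, i1, (i2, i3))|exists (i0, i2, (i3, i1))|
  exists (i0, i3, (i1, i2))] => o M; by rewrite /dual_defect (tnth_nth 0).
Qed.

Lemma Cinf_dual_defect o k : Cinf D (defect o k).
Proof.
have [c e] := dual_defect_entries k.
rewrite (_ : defect o k = fun z => f c.1.1 c.1.2 z - o * f c.2.1 c.2.2 z); last first.
  by rewrite funeqE => z; exact: e.
by move=> m; apply: (CkB Dop (fC _ _ m)); apply: (CkZ _ Dop (fC _ _ m)).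
Qed.

Lemma laplacian_dual_defect o k y : D y -> laplacian (defect o k) y = 0.
Proof.
move=> Dy; have [c e] := dual_defect_entries k.
rewrite (_ : defect o k = fun z => f c.1.1 c.1.2 z - o * f c.2.1 c.2.2 z); last first.
  by rewrite funeqE => z; exact: e.
apply: (etrans (laplacian_comb o Dop (fC _ _ 2) (fC _ _ 2) Dy)).
apply: (etrans (congr2 (fun p q => p - o * q) (einstein_laplacian _ _ Dy)
  (einstein_laplacian _ _ Dy))).
by rewrite mulr0 subr0.
Qed.

Lemma dual_defect_product k l y : D y -> defect 1 k y * defect (-1) l y = 0.
Proof.
move=> Dy; have [_ q0] := einstein_ricci_parts hU hA ein Dy.
apply: (stress0_dual_defect k l (ext_form_antisym b y)).
exact: (ricci_quad_eq0 (dot_neq0 Dy) q0).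
Qed.

Let asd (y : V) := \forall z \near y, forall k, defect (-1) k z = 0.
Let o (y : V) : R := if `[< asd y >] then -1 else 1.

(** Being anti-self-dual near a point is not only an open but also a closed condition
    on the cone. *)
Lemma einstein_not_asd y : D y -> ~ asd y -> \forall z \near y, ~ asd z.
Proof.
by move=> Dy; apply: (harmonic_vanishing_closed Dop Dy) => k;
  [exact: Cinf_dual_defect|move=> z; exact: laplacian_dual_defect].
Qed.

(** Where a component of F - *F is nonzero, it is so on a neighbourhood, and F + *F
    vanishes there by [dual_defect_product]. *)
Lemma einstein_not_asd_sd y : D y -> ~ asd y -> forall l, defect 1 l y = 0.
Proof.
move=> Dy ny l; apply: contrapT => /eqP nl; apply: ny.
have c : {for y, continuous (defect 1 l)}.
  exact: (Ck_continuous (Cinf_dual_defect 1 l 0) Dy).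
have nD : \forall z \near y, D z by exact: (open_nbhs_nbhs (conj Dop Dy)).
apply: filterS2 (near_neq0 c nl) nD => z nz Dz k.
by have /eqP := dual_defect_product l k Dz; rewrite mulf_eq0 (negbTE nz) => /eqP.
Qed.

(** The orientation is -1 where [F] is anti-self-dual on a neighbourhood, and 1
    elsewhere. *)
Lemma einstein_beltrami : exists o : V -> R, is_orientation U o /\ beltrami U o A.
Proof.
have os y : o y = 1 \/ o y = -1 by rewrite /o; case: asboolP; [right|left].
exists o; split.
  apply: locally_constant_orientation => // y Uy.
  have Dy := sub_cone hU Uy.
  have oa z : asd z -> o z = -1 by rewrite /o; case: asboolP.
  have on z : ~ asd z -> o z = 1 by rewrite /o; case: asboolP.
  have [ay|ny] := pselect (asd y).
    by rewrite (oa y ay); apply: (filterS oa); exact: (nbhs_interior ay).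
  by rewrite (on y ny); apply: (filterS on); exact: einstein_not_asd.
apply/(beltrami_dual_form hU hA) => [u _|u Uu].
  by case: (os u) => ->; rewrite ?sqrrN expr1n.
have Du := sub_cone hU Uu; have Fa := ext_form_antisym b u.
rewrite /o; case: asboolP => [au|nu]; apply: dual_defectP => //.
- by rewrite sqrrN expr1n.
- exact: (nbhs_singleton au).
- by rewrite expr1n.
- exact: einstein_not_asd_sd.
Qed.

End EinsteinToBeltrami.

Theorem theorem1p3 (R : realType) (U : set 'rV[R]_4)
    (A : 'rV[R]_4 -> 'rV[R]_4)
    (hU : open_in_sphere3 U) (hA : smooth_one_form U A) :
  (einstein (warped_coord A) (cone U) <->
     exists o : 'rV[R]_4 -> R, is_orientation U o /\ beltrami U o A) /\
  ((exists o : 'rV[R]_4 -> R, is_orientation U o /\ beltrami U o A) ->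
     ricci_flat (warped_coord A) (cone U) /\
     exists o : 'rV[R]_4 -> R, is_orientation (cone U) o /\
       self_dual o (warped_coord A) (cone U)).
Proof.
split; [split=> [|[s [oU oA]]]|move=> [s [oU oA]]; split].
- exact: einstein_beltrami.
- exists 0 => y Dy; rewrite scale0r.
  exact: (beltrami_ricci_flat hU hA oU oA Dy).
- exact: (beltrami_ricci_flat hU hA oU oA).
- exact: (beltrami_self_dual hU hA oU oA).
Qed.
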